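(* The model category of simplicial categories is proper (i.e. both left and right proper).
   Context: A simplicial category is a small category enriched in simplicial sets. The model structure on the category of simplicial categories is the Bergner model structure (equivalently, the one induced from simplicial coloured operads by slicing over the terminal category $\eta$ viewed as an operad). For a simplicial category $A$, $\pi_0(A)$ is the category with the same objects and $\mathrm{Hom}$-sets $\pi_0(A(x,y))$. A simplicial functor $u:A\to B$ is a weak equivalence if all maps $A(x,y)\to B(u(x),u(y))$ are weak homotopy equivalences and $\pi_0(u)$ is essentially surjective; it is a fibration if all maps $A(x,y)\to B(u(x),u(y))$ are Kan fibrations and $\pi_0(u)$ is an isofibration, i.e. every isomorphism $u(x)\to y'$ in $\pi_0(B)$ lifts to an isomorphism $x\to x'$ in $\pi_0(A)$. *)

(* Defs.v *)
(* Sets are types: simplicial sets and simplicial categories are small relative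
   to a universe level that is fixed once and for all.                        *)
From Stdlib Require Import Relation_Operators.
From mathcomp Require Import all_boot boolp.

Set Implicit Arguments.
Unset Strict Implicit.
Unset Printing Implicit Defensive.

Local Open Scope quotient_scope.

Record category := Category {
  ob :> Type;
  hom : ob -> ob -> Type;
  idm : forall x, hom x x;
  cmp : forall x y z, hom y z -> hom x y -> hom x z;
  cmp_idl : forall x y (f : hom x y), cmp (idm y) f = f;
  cmp_idr : forall x y (f : hom x y), cmp f (idm x) = f;
  cmpA : forall x y z t (h : hom z t) (g : hom y z) (f : hom x y),
    cmp h (cmp g f) = cmp (cmp h g) f }.

Arguments hom {c} x y.
Arguments idm {c} x.
Arguments cmp {c x y z} g f.

Record functor (C D : category) := Functor {
  fob :> C -> D;
  fmap : forall x y, hom x y -> hom (fob x) (fob y);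
  fmap_id : forall x, fmap (idm x) = idm (fob x);
  fmap_cmp : forall x y z (g : hom y z) (f : hom x y),
    fmap (cmp g f) = cmp (fmap g) (fmap f) }.

Arguments fmap {C D} f {x y} g : rename.

Definition is_iso (C : category) (x y : C) (f : hom x y) : Prop :=
  exists g : hom y x, cmp g f = idm x /\ cmp f g = idm y.

Definition essentially_surjective (C D : category) (F : functor C D) : Prop :=
  forall y : D, exists (x : C) (f : hom (F x) y), is_iso f.

(* The equality of dependent pairs says that [F x' = y'] and that [F] maps [f]
   to [g] along this identification.                                          *)
Definition isofibration (C D : category) (F : functor C D) : Prop :=
  forall (x : C) (y' : D) (g : hom (F x) y'), is_iso g ->
  exists (x' : C) (f : hom x x'),
    is_iso f /\
    existT (fun y => hom (F x) y) (F x') (fmap F f)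
      = existT (fun y => hom (F x) y) y' g.

Definition has_lifting (C : category) (a b x y : C)
    (i : hom a b) (p : hom x y) : Prop :=
  forall (u : hom a x) (v : hom b y), cmp p u = cmp v i ->
  exists w : hom b x, cmp w i = u /\ cmp p w = v.

(*      f             *)
(*   a ---> c         *)
(* i |      | i'      *)
(*   v      v         *)
(*   b ---> d         *)
(*      f'            *)
Definition is_pushout (C : category) (a b c d : C) (i : hom a b) (f : hom a c)
    (f' : hom b d) (i' : hom c d) : Prop :=
  cmp f' i = cmp i' f /\
  forall (t : C) (h : hom b t) (k : hom c t), cmp h i = cmp k f ->
  exists! w : hom d t, cmp w f' = h /\ cmp w i' = k.

(*      f'            *)
(*   a ---> c         *)
(* p'|      | p       *)
(*   v      v         *)
(*   b ---> d         *)
(*      f             *)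
Definition is_pullback (C : category) (a b c d : C) (p' : hom a b)
    (f' : hom a c) (f : hom b d) (p : hom c d) : Prop :=
  cmp f p' = cmp p f' /\
  forall (t : C) (h : hom t b) (k : hom t c), cmp f h = cmp p k ->
  exists! w : hom t a, cmp p' w = h /\ cmp f' w = k.

Definition hom_class (C : category) := forall x y : C, hom x y -> Prop.

(* In a model category the cofibrations are determined by the weak equivalences
   and the fibrations, as the maps with the left lifting property with respect
   to the trivial fibrations.                                                 *)
Definition cofibration (C : category) (W Fib : hom_class C) : hom_class C :=
  fun a b i => forall (x y : C) (p : hom x y),
    W x y p -> Fib x y p -> has_lifting i p.

Definition left_proper (C : category) (W Fib : hom_class C) : Prop :=
  forall (a b c d : C) (i : hom a b) (f : hom a c) (f' : hom b d)
         (i' : hom c d),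
    is_pushout i f f' i' -> cofibration W Fib i -> W a c f -> W b d f'.

Definition right_proper (C : category) (W Fib : hom_class C) : Prop :=
  forall (a b c d : C) (p' : hom a b) (f' : hom a c) (f : hom b d)
         (p : hom c d),
    is_pullback p' f' f p -> Fib c d p -> W b d f -> W a c f'.

Definition proper (C : category) (W Fib : hom_class C) : Prop :=
  left_proper W Fib /\ right_proper W Fib.

Definition monotone m n (f : {ffun 'I_m.+1 -> 'I_n.+1}) : bool :=
  [forall i : 'I_m.+1, forall j : 'I_m.+1, (i <= j)%N ==> (f i <= f j)%N].

Lemma monotoneP m n (f : {ffun 'I_m.+1 -> 'I_n.+1}) :
  reflect (forall i j : 'I_m.+1, (i <= j)%N -> (f i <= f j)%N) (monotone f).
Proof.
apply: (iffP forallP) => [h i j ij|h i].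
- by move/forallP: (h i) => /(_ j); rewrite ij.
- by apply/forallP => j; apply/implyP; apply: h.
Qed.

Definition delta m n := {f : {ffun 'I_m.+1 -> 'I_n.+1} | monotone f}.

Definition dval m n (f : delta m n) : {ffun 'I_m.+1 -> 'I_n.+1} := val f.

Lemma delta_inj m n (f g : delta m n) : dval f =1 dval g -> f = g.
Proof. by move=> e; apply/val_inj/ffunP. Qed.

Lemma monotone_id n : monotone [ffun i : 'I_n.+1 => i].
Proof. by apply/monotoneP => i j; rewrite !ffunE. Qed.

Lemma monotone_comp m n p (g : delta n p) (f : delta m n) :
  monotone [ffun i => dval g (dval f i)].
Proof.
apply/monotoneP => i j ij; rewrite !ffunE.
exact: (monotoneP _ (valP g)) (monotoneP _ (valP f) _ _ ij).
Qed.

Lemma monotone_cst m n (k : 'I_n.+1) : monotone [ffun _ : 'I_m.+1 => k].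
Proof. by apply/monotoneP => i j; rewrite !ffunE. Qed.

Definition did n : delta n n := exist (@monotone n n) _ (monotone_id n).
Definition dcomp m n p (g : delta n p) (f : delta m n) : delta m p :=
  exist (@monotone m p) _ (monotone_comp g f).
Definition dcst m n (k : 'I_n.+1) : delta m n := exist (@monotone m n) _ (monotone_cst m k).

Lemma dcomp_idl m n (f : delta m n) : dcomp (did n) f = f.
Proof. by apply: delta_inj => i; rewrite !ffunE. Qed.

Lemma dcomp_idr m n (f : delta m n) : dcomp f (did m) = f.
Proof. by apply: delta_inj => i; rewrite !ffunE. Qed.

Lemma dcompA m n p q (h : delta p q) (g : delta n p) (f : delta m n) :
  dcomp h (dcomp g f) = dcomp (dcomp h g) f.
Proof. by apply: delta_inj => i; rewrite !ffunE. Qed.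

Lemma dcst_comp m n p (k : 'I_p.+1) (f : delta m n) :
  dcomp (dcst n k) f = dcst m k.
Proof. by apply: delta_inj => i; rewrite !ffunE. Qed.

Record sset := SSet {
  simp :> nat -> Type;
  sact : forall m n, delta m n -> simp n -> simp m;
  sact_id : forall n (x : simp n), sact (did n) x = x;
  sact_comp : forall m n p (g : delta n p) (f : delta m n) (x : simp p),
    sact (dcomp g f) x = sact f (sact g x) }.

Arguments sact {s m n} f x.

Record smap (X Y : sset) := SMap {
  smap_fun :> forall n, X n -> Y n;
  smap_nat : forall m n (f : delta m n) (x : X n),
    @smap_fun m (sact f x) = sact f (@smap_fun n x) }.

Arguments smap_fun {X Y} f n x : rename.

Lemma smap_eq (X Y : sset) (f g : smap X Y) :
  (forall n (x : X n), f n x = g n x) -> f = g.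
Proof.
case: f g => [f nf] [g ng] /= e.
have {}e : f = g by apply: functional_extensionality_dep => n; apply/funext.
by subst g; congr SMap; apply: Prop_irrelevance.
Qed.

Definition smap_id (X : sset) : smap X X :=
  @SMap X X (fun _ x => x) (fun _ _ _ _ => erefl).

Lemma smap_comp_nat (X Y Z : sset) (g : smap Y Z) (f : smap X Y) m n
    (d : delta m n) (x : X n) : g m (f m (sact d x)) = sact d (g n (f n x)).
Proof. by rewrite !smap_nat. Qed.

Definition smap_comp (X Y Z : sset) (g : smap Y Z) (f : smap X Y) : smap X Z :=
  @SMap X Z (fun n x => g n (f n x)) (smap_comp_nat g f).

Definition SSET : category.
Proof.
apply: (@Category sset smap smap_id smap_comp) => *; exact: smap_eq.
Defined.

Definition sprod (X Y : sset) : sset.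
Proof.
apply: (@SSet (fun n => (X n * Y n)%type)
              (fun m n f xy => (sact f xy.1, sact f xy.2))).
- by move=> n [x y]; rewrite /= !sact_id.
- by move=> m n p g f [x y]; rewrite /= !sact_comp.
Defined.

Definition stdsimplex (n : nat) : sset :=
  @SSet (fun m => delta m n) (fun m p f x => dcomp x f)
    (fun m x => dcomp_idr x) (fun m p q g f x => dcompA x g f).

(* The simplices of the horn omit some vertex other than the [k]-th.          *)
Definition in_horn n (k : 'I_n.+1) m (x : delta m n) : bool :=
  [exists j, (j != k) && [forall i, dval x i != j]].

Lemma in_horn_act n (k : 'I_n.+1) m p (f : delta m p) (x : delta p n) :
  in_horn k x -> in_horn k (dcomp x f).
Proof.
case/existsP=> j /andP[jk /forallP xj]; apply/existsP; exists j.
by rewrite jk; apply/forallP=> i; rewrite ffunE.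
Qed.

Definition horn n (k : 'I_n.+1) : sset.
Proof.
apply: (@SSet (fun m => {x : delta m n | in_horn k x})
  (fun m p f x => exist (@in_horn n k m) (dcomp (val x) f) (in_horn_act f (valP x)))).
- by move=> m x; apply: val_inj; apply: dcomp_idr.
- by move=> m p q g f x; apply: val_inj; apply: dcompA.
Defined.

Definition horn_incl n (k : 'I_n.+1) : smap (horn k) (stdsimplex n) :=
  @SMap (horn k) (stdsimplex n) (fun m x => val x) (fun _ _ _ _ => erefl).

Definition kan_fibration (X Y : sset) (p : smap X Y) : Prop :=
  forall n (k : 'I_n.+2), @has_lifting SSET _ _ _ _ (horn_incl k) p.

Definition kan_complex (Z : sset) : Prop :=
  forall n (k : 'I_n.+2) (h : smap (horn k) Z),
  exists g : smap (stdsimplex n.+1) Z, smap_comp g (horn_incl k) = h.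

Definition edge (X : sset) (x y : X 0) : Prop :=
  exists e : X 1, sact (dcst 0 (ord0 : 'I_2)) e = x
                /\ sact (dcst 0 (ord_max : 'I_2)) e = y.

Definition connected (X : sset) : X 0 -> X 0 -> Prop :=
  clos_refl_sym_trans (X 0) (@edge X).

Definition connectedb (X : sset) : rel {classic X 0} :=
  fun x y => `[< connected x y >].

Lemma connectedb_refl (X : sset) : reflexive (@connectedb X).
Proof. by move=> x; apply/asboolP; apply: rst_refl. Qed.

Lemma connectedb_sym (X : sset) : symmetric (@connectedb X).
Proof. by move=> x y; apply/asboolP/asboolP => h; apply: rst_sym. Qed.

Lemma connectedb_trans (X : sset) : transitive (@connectedb X).
Proof.
move=> y x z /asboolP h /asboolP k; apply/asboolP; exact: rst_trans h k.
Qed.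

Canonical connectedb_equiv (X : sset) := EquivRel (@connectedb X)
  (@connectedb_refl X) (@connectedb_sym X) (@connectedb_trans X).

Definition pi0 (X : sset) : Type := {eq_quot (@connectedb X)}.

Definition pi0_class (X : sset) (x : X 0) : pi0 X :=
  \pi_({eq_quot (@connectedb X)}) (x : {classic X 0}).

Definition pi0_repr (X : sset) (c : pi0 X) : X 0 :=
  repr (c : {eq_quot (@connectedb X)}).

Lemma pi0_reprK (X : sset) (c : pi0 X) : pi0_class (pi0_repr c) = c.
Proof. exact: reprK. Qed.

Lemma pi0_classP (X : sset) (x y : X 0) : pi0_class x = pi0_class y <-> connected x y.
Proof.
split.
- by move/eqmodP => /= /asboolP.
- by move=> h; apply/eqmodP => /=; apply/asboolP.
Qed.

Lemma connected_repr (X : sset) (x : X 0) : connected (pi0_repr (pi0_class x)) x.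
Proof. by apply/pi0_classP; rewrite pi0_reprK. Qed.

Lemma connected_smap (X Y : sset) (f : smap X Y) (x y : X 0) :
  connected x y -> connected (f 0 x) (f 0 y).
Proof.
elim=> {x y} [x y [e [<- <-]]|x|x y _|x y z _ h _ k].
- by apply: rst_step; exists (f 1 e); rewrite !smap_nat.
- exact: rst_refl.
- exact: rst_sym.
- exact: rst_trans h k.
Qed.

Definition pi0_map (X Y : sset) (f : smap X Y) (c : pi0 X) : pi0 Y :=
  pi0_class (f 0 (pi0_repr c)).

Lemma pi0_mapE (X Y : sset) (f : smap X Y) (x : X 0) :
  pi0_map f (pi0_class x) = pi0_class (f 0 x).
Proof. by apply/pi0_classP; apply/connected_smap/connected_repr. Qed.

Definition sprod_map (X X' Y Y' : sset) (f : smap X X') (g : smap Y Y') :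
  smap (sprod X Y) (sprod X' Y').
Proof.
apply: (@SMap (sprod X Y) (sprod X' Y') (fun n xy => (f n xy.1, g n xy.2))).
by move=> m n d [x y] /=; rewrite !smap_nat.
Defined.

Definition stdsimplex_map m n (d : delta m n) :
  smap (stdsimplex m) (stdsimplex n) :=
  @SMap (stdsimplex m) (stdsimplex n) (fun p x => dcomp d x)
    (fun p q f x => dcompA d x f).

Definition mapping_space (X Y : sset) : sset.
Proof.
apply: (@SSet (fun n => smap (sprod X (stdsimplex n)) Y)
  (fun m n d h => smap_comp h (sprod_map (smap_id X) (stdsimplex_map d)))).
- by move=> n h; apply: smap_eq => m [x y] /=; rewrite dcomp_idl.
- by move=> m n p g f h; apply: smap_eq => q [x y] /=; rewrite dcompA.
Defined.

Definition mapping_space_precomp (X Y Z : sset) (f : smap X Y) :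
  smap (mapping_space Y Z) (mapping_space X Z).
Proof.
apply: (@SMap (mapping_space Y Z) (mapping_space X Z)
  (fun n h => smap_comp h (sprod_map f (smap_id (stdsimplex n))))).
by move=> m n d h; apply: smap_eq.
Defined.

(* This is the definition of weak homotopy equivalences (of Joyal, and of
   Lurie's Kerodon) which does not use geometric realizations: [f] induces
   bijections on homotopy classes of maps into every Kan complex.             *)
Definition weak_homotopy_equivalence (X Y : sset) (f : smap X Y) : Prop :=
  forall Z : sset, kan_complex Z ->
    bijective (pi0_map (mapping_space_precomp Z f)).

Definition degen (X : sset) n (x : X 0) : X n := sact (dcst n (ord0 : 'I_1)) x.

Lemma degen0 (X : sset) (x : X 0) : degen 0 x = x.
Proof.
rewrite /degen (_ : dcst 0 _ = did 0) ?sact_id //.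
by apply: delta_inj => i; rewrite !ffunE !ord1.
Qed.

Lemma sact_degen (X : sset) m n (d : delta m n) (x : X 0) :
  sact d (degen n x) = degen m x.
Proof. by rewrite /degen -sact_comp dcst_comp. Qed.

(* Composition is a map of simplicial sets, so associativity and unitality are
   stated in every simplicial degree; the unit in degree [n] is the degenerate
   simplex on the vertex [sid x].                                             *)
Record scat := SCat {
  sob :> Type;
  shom : sob -> sob -> sset;
  sid : forall x, shom x x 0;
  scmp : forall x y z, smap (sprod (shom y z) (shom x y)) (shom x z);
  scmp_idl : forall x y n (f : shom x y n),
    scmp x y y n (degen n (sid y), f) = f;
  scmp_idr : forall x y n (f : shom x y n),
    scmp x x y n (f, degen n (sid x)) = f;
  scmpA : forall x y z t n (h : shom z t n) (g : shom y z n) (f : shom x y n),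
    scmp x z t n (h, scmp x y z n (g, f))
      = scmp x y t n (scmp y z t n (h, g), f) }.

Arguments shom {s} x y.
Arguments sid {s} x.
Arguments scmp {s} x y z.

Record sfunctor (A B : scat) := SFunctor {
  sfob :> A -> B;
  sfmap : forall x y, smap (shom x y) (shom (sfob x) (sfob y));
  sfmap_id : forall x, sfmap x x 0 (sid x) = sid (sfob x);
  sfmap_cmp : forall x y z n (g : shom y z n) (f : shom x y n),
    sfmap x z n (scmp x y z n (g, f))
      = scmp (sfob x) (sfob y) (sfob z) n (sfmap y z n g, sfmap x y n f) }.

Arguments sfmap {A B} F x y : rename.

Definition sfunctor_id (A : scat) : sfunctor A A :=
  @SFunctor A A (fun x => x) (fun x y => smap_id (shom x y))
    (fun _ => erefl) (fun _ _ _ _ _ _ => erefl).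

Definition sfunctor_comp (A B C : scat) (G : sfunctor B C) (F : sfunctor A B) :
  sfunctor A C.
Proof.
apply: (@SFunctor A C (fun x => G (F x))
  (fun x y => smap_comp (sfmap G (F x) (F y)) (sfmap F x y))).
- by move=> x /=; rewrite !sfmap_id.
- by move=> x y z n g f /=; rewrite !sfmap_cmp.
Defined.

Lemma sfunctor_eq (A B : scat) (o : A -> B)
    (m m' : forall x y, smap (@shom A x y) (shom (o x) (o y))) i i' c c' :
  (forall x y, m x y = m' x y) ->
  @SFunctor A B o m i c = @SFunctor A B o m' i' c'.
Proof.
move=> e; have {}e : m = m'.
  by do 2!apply: functional_extensionality_dep => ?; apply: e.
by subst m'; congr SFunctor; apply: Prop_irrelevance.
Qed.

Definition SCAT : category.
Proof.
apply: (@Category scat sfunctor sfunctor_id sfunctor_comp).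
- by move=> A B [o m i c]; apply: sfunctor_eq => x y; apply: smap_eq.
- by move=> A B [o m i c]; apply: sfunctor_eq => x y; apply: smap_eq.
- by move=> A B C D H G F; apply: sfunctor_eq => x y; apply: smap_eq.
Defined.

Lemma connected_scmp (A : scat) (x y z : A) (g g' : shom y z 0)
    (f f' : shom x y 0) : connected g g' -> connected f f' ->
  connected (scmp x y z 0 (g, f)) (scmp x y z 0 (g', f')).
Proof.
move=> hg hf; apply: (@rst_trans _ _ _ (scmp x y z 0 (g', f))).
- elim: hg => {g g'} [g g' [e [<- <-]]|g|g g' _|g g' g'' _ h _ k].
  + apply: rst_step; exists (scmp x y z 1 (e, degen 1 f)).
    by rewrite -!smap_nat /= !sact_degen degen0.
  + exact: rst_refl.
  + exact: rst_sym.
  + exact: rst_trans h k.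
- elim: hf => {f f'} [f f' [e [<- <-]]|f|f f' _|f f' f'' _ h _ k].
  + apply: rst_step; exists (scmp x y z 1 (degen 1 g', e)).
    by rewrite -!smap_nat /= !sact_degen degen0.
  + exact: rst_refl.
  + exact: rst_sym.
  + exact: rst_trans h k.
Qed.

Definition pi0_scmp (A : scat) (x y z : A)
    (c : pi0 (shom y z)) (d : pi0 (shom x y)) : pi0 (shom x z) :=
  pi0_class (scmp x y z 0 (pi0_repr c, pi0_repr d)).

Lemma pi0_scmpE (A : scat) (x y z : A) (g : shom y z 0) (f : shom x y 0) :
  pi0_scmp (pi0_class g) (pi0_class f) = pi0_class (scmp x y z 0 (g, f)).
Proof. by apply/pi0_classP/connected_scmp; apply: connected_repr. Qed.

Definition pi0_cat (A : scat) : category.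
Proof.
apply: (@Category A (fun x y => pi0 (shom x y)) (fun x => pi0_class (sid x))
                  (@pi0_scmp A)).
- move=> x y c; rewrite -[c]pi0_reprK pi0_scmpE.
  by rewrite -{1}[sid y]degen0 scmp_idl.
- move=> x y c; rewrite -[c]pi0_reprK pi0_scmpE.
  by rewrite -{1}[sid x]degen0 scmp_idr.
- move=> x y z t e d c; rewrite -[c]pi0_reprK -[d]pi0_reprK -[e]pi0_reprK.
  by rewrite !pi0_scmpE scmpA.
Defined.

Definition pi0_functor (A B : scat) (F : sfunctor A B) :
  functor (pi0_cat A) (pi0_cat B).
Proof.
apply: (@Functor (pi0_cat A) (pi0_cat B) F
          (fun x y => pi0_map (sfmap F x y))).
- by move=> x /=; rewrite pi0_mapE sfmap_id.
- move=> x y z d c /=; rewrite -[c]pi0_reprK -[d]pi0_reprK.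
  by rewrite pi0_scmpE !pi0_mapE pi0_scmpE sfmap_cmp.
Defined.

Definition bergner_weq : hom_class SCAT := fun A B (F : sfunctor A B) =>
  (forall x y : A, weak_homotopy_equivalence (sfmap F x y)) /\
  essentially_surjective (pi0_functor F).

Definition bergner_fib : hom_class SCAT := fun A B (F : sfunctor A B) =>
  (forall x y : A, kan_fibration (sfmap F x y)) /\
  isofibration (pi0_functor F).

(* Main.v *)
From Stdlib Require Import Relation_Operators.
From mathcomp Require Import all_boot boolp zify.
From mathcomp Require classical_sets.
Require Import Defs.

Set Implicit Arguments.
Unset Strict Implicit.
Unset Printing Implicit Defensive.

(** Right properness is a statement about hom-objects: Kan fibrations of simplicial sets are stable
under base change along weak equivalences.  Every Kan fibration over a horn extends to the simplex
with its restriction to the horn unchanged, so that attaching horns and fibrations over them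
simultaneously extends any Kan fibration over a Kan replacement of its base.  Between Kan complexes
weak equivalences are homotopy equivalences, and homotopic maps have weakly equivalent base changes.

For left properness, a cofibration [A -> B] is a retract of a map [A -> E] obtained by adding the
objects of [B] and then, countably often, freely adjoining hom-objects along injections; here
[E -> B] is a trivial fibration because on hom-objects every stage maps to the next through a
trivial fibration over [B].  The hom-objects of a free extension consist of reduced words.  Filtering them by length, each step is a
pushout along an injection, and by the gluing lemma a functor which is a weak equivalence on
hom-objects induces a weak equivalence on the free extensions. *)

(** Weak equivalences are tested by homotopy classes of maps into Kan complexes, which gives no
    direct hold on pushouts, unions or base change. For an injection the test amounts to a strict
    extension property, [trivial_cof], that pushouts and unions inherit; a general weak equivalence
    becomes an injection in its mapping cylinder, and gluing is done there.

    Base change is directly understood along homotopy equivalences, so the base must become a Kan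
    complex while the fibration over the original base stays literally the same. Over a horn the
    fibration is compared with a product by spans of trivial fibrations, and extendability passes
    through a trivial fibration in both directions: by a dependent product one way, by a retraction
    the other way.

    A cofibration of simplicial categories is known only through lifting, so free generators come
    from a factorization. At each step one hom-object [X] over [Y] is embedded in the product of [Y]
    with a cofree simplicial set on [X], into which maps extend along every injection. *)

(** * Maps from functional relations, the Yoneda lemma and the interval *)

Definition inj (X Y : sset) (f : smap X Y) := forall n, injective (f n).

(** Uniqueness makes the chosen values natural, because a restriction of an admissible value is
    admissible. Maps given by cases or by choice are constructed this way throughout. *)
Lemma ex_smap (X Y : sset) (R : forall n, X n -> Y n -> Prop) :
  (forall n x, exists y, R n x y) ->
  (forall n x y y', R n x y -> R n x y' -> y = y') ->
  (forall m n (d : delta m n) x y, R n x y -> R m (sact d x) (sact d y)) ->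
  exists f : smap X Y, forall n x, R n x (f n x).
Proof.
move=> ex un ac.
pose f n x := projT1 (cid (ex n x)).
have fP n x : R n x (f n x) by rewrite /f; case: cid.
have nat m n (d : delta m n) x : f m (sact d x) = sact d (f n x).
  exact: un (fP _ _) (ac _ _ d _ _ (fP _ _)).
by exists (SMap nat).
Qed.

Lemma yoneda_nat (X : sset) n (x : X n) m p (f : delta m p) (d : delta p n) :
  sact (dcomp d f) x = sact f (sact d x).
Proof. exact: sact_comp. Qed.

Definition yoneda (X : sset) n (x : X n) : smap (stdsimplex n) X :=
  @SMap (stdsimplex n) X (fun m d => sact d x) (yoneda_nat x).

Lemma yonedaK (X : sset) n (f : smap (stdsimplex n) X) m (d : delta m n) :
  f m d = sact d (f n (did n)).
Proof. by rewrite -smap_nat /= dcomp_idl. Qed.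

Definition unitI : sset := stdsimplex 1.
Definition vert (e : bool) n : unitI n := dcst n (if e then ord_max else ord0).

Lemma vert_act e m n (d : delta m n) : sact d (vert e n) = vert e m.
Proof. exact: dcst_comp. Qed.

Lemma ord2E (i : 'I_2) : i = if i == ord_max then ord_max else ord0.
Proof. by case: i => [[|[|//]] h]; apply: val_inj. Qed.

Lemma vert_neq n : vert true n <> vert false n.
Proof.
by move/(congr1 (fun f : delta n 1 => val (dval f ord0))); rewrite /= !ffunE.
Qed.

(** * Simplices and Kan fibrations *)

Definition monoP m n (f : delta m n) : forall i j : 'I_m.+1, i <= j -> dval f i <= dval f j :=
  monotoneP _ (valP f).

Definition mkdelta m n (f : 'I_m.+1 -> 'I_n.+1)
    (h : forall i j : 'I_m.+1, i <= j -> f i <= f j) : delta m n.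
Proof.
exists (finfun f); apply/monotoneP => i j ij; rewrite !ffunE; exact: h.
Defined.

Lemma mkdeltaE m n (f : 'I_m.+1 -> 'I_n.+1) h i : dval (@mkdelta m n f h) i = f i.
Proof. by rewrite ffunE. Qed.

Lemma dcompE m n p (g : delta n p) (f : delta m n) i :
  dval (dcomp g f) i = dval g (dval f i).
Proof. by rewrite ffunE. Qed.

Lemma dcstE m n k i : dval (dcst m k : delta m n) i = k.
Proof. by rewrite ffunE. Qed.

Lemma didE n i : dval (did n) i = i.
Proof. by rewrite ffunE. Qed.

Definition surj m n (f : delta m n) : Prop := forall j, exists i, dval f i = j.

Lemma nsurjP m n (f : delta m n) : ~ surj f -> exists j, forall i, dval f i != j.
Proof.
move=> /existsNP[j h]; exists j => i; apply/eqP => e; apply: h; by exists i.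
Qed.

Lemma missing_nsurj m n (f : delta m n) j : (forall i, dval f i != j) -> ~ surj f.
Proof. by move=> h /(_ j)[i /eqP]; apply/negP. Qed.

Lemma dface_subproof n (j : 'I_n.+2) (a b : 'I_n.+1) : a <= b -> lift j a <= lift j b.
Proof. by move=> ab; rewrite /= leq_bump2. Qed.

Definition dface n (j : 'I_n.+2) : delta n n.+1 := mkdelta (@dface_subproof n j).

Lemma dface_factor m n (f : delta m n.+1) (j : 'I_n.+2) :
  (forall i, dval f i != j) -> exists g, f = dcomp (dface j) g.
Proof.
move=> h.
have ex i : exists k, lift j k = dval f i.
  have := h i; rewrite eq_sym => /unlift_some[k e _]; by exists k.
pose g i := projT1 (cid (ex i)).
have gP i : lift j (g i) = dval f i by rewrite /g; case: cid.
have gm (a b : 'I_m.+1) : a <= b -> g a <= g b.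
  move=> ab; rewrite -(leq_bump2 j); have := monoP f ab.
  by rewrite -!gP.
exists (mkdelta gm); apply: delta_inj => i.
by rewrite dcompE !mkdeltaE gP.
Qed.

Lemma surj0 m (f : delta m 0) : surj f.
Proof. by move=> j; exists ord0; rewrite !ord1. Qed.

Lemma nsurj_factor m n (f : delta m n) : ~ surj f ->
  exists r (u : delta r n) (v : delta m r), r < n /\ f = dcomp u v.
Proof.
case: n f => [|n] f h; first by case: h; exact: surj0.
have [j /dface_factor[g e]] := nsurjP h.
by exists n, (dface j), g.
Qed.

(** Any choice of preimages is monotone, so one of them may be prescribed. This freedom lets
    [nondegenerate_inj] compare two surjections at each point. *)
Lemma surj_section m n (f : delta m n) i : surj f ->
  exists s : delta n m, dcomp f s = did n /\ dval s (dval f i) = i.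
Proof.
move=> h.
have ex j : exists k, dval f k = j /\ (j = dval f i -> k = i).
  have [->|ne] := pselect (j = dval f i); first by exists i.
  by have [k e] := h j; exists k.
pose s j := projT1 (cid (ex j)).
have sP j : dval f (s j) = j /\ (j = dval f i -> s j = i) by rewrite /s; case: cid.
have sm (a b : 'I_n.+1) : a <= b -> s a <= s b.
  move=> ab; case: leqP => // lt; have := monoP f (ltnW lt); rewrite !(proj1 (sP _)) => ba.
  have e : a = b by apply/val_inj/anti_leq; rewrite ab.
  by move: lt; rewrite e ltnn.
exists (mkdelta sm); split.
  by apply: delta_inj => j; rewrite dcompE mkdeltaE (proj1 (sP _)) didE.
by rewrite mkdeltaE (proj2 (sP _)).
Qed.

(** A section of [f] is strictly increasing, and on a finite ordinal that forces the identity. *)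
Lemma surj_endo n (f : delta n n) : surj f -> f = did n.
Proof.
move=> h; have [s [fs _]] := surj_section ord0 h.
have fsE j : dval f (dval s j) = j by rewrite -dcompE fs didE.
have sinj : injective (dval s) by move=> a b e; rewrite -(fsE a) e fsE.
have slt (a b : 'I_n.+1) : a < b -> dval s a < dval s b.
  move=> ab; rewrite ltn_neqAle (monoP s (ltnW ab)) andbT.
  by apply/eqP => /val_inj /sinj e; move: ab; rewrite e ltnn.
have sge k (a : 'I_n.+1) : a = k :> nat -> k <= dval s a.
  elim: k a => // k IH a e.
  have lt : k < n.+1 by have := ltn_ord a; lia.
  have := IH (Ordinal lt) erefl; move/leq_ltn_trans; apply; apply: slt.
  by rewrite /= e.
have sle k (a : 'I_n.+1) : n - a = k -> dval s a <= a.
  elim: k a => [|k IH] a e.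
    by have := ltn_ord (dval s a); rewrite ltnS => /leq_trans; apply; rewrite -subn_eq0 e.
  have lt : a.+1 < n.+1 by rewrite ltnS -subn_gt0 e.
  rewrite -ltnS; apply: leq_trans (slt a (Ordinal lt) _) (IH _ _) => //=.
  by rewrite subnS e.
have sid a : dval s a = a by apply/val_inj/anti_leq; rewrite (sle _ _ erefl) (sge _ _ erefl).
by apply: delta_inj => i; rewrite didE -{1}(sid i) fsE.
Qed.

(** This is the uniqueness in the Eilenberg-Zilber lemma, relative to a subcomplex [S]. If [s] is a
    section of [f], then [g s] fixes [x]; it must be surjective, hence the identity, since otherwise
    [x] would come from a smaller dimension and lie in [S]. *)
Lemma nondegenerate_inj (X : sset) (S : forall n, X n -> Prop) n (x : X n) m (f g : delta m n) :
  (forall p q (d : delta p q) y, S q y -> S p (sact d y)) ->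
  (forall r (y : X r), r < n -> S r y) -> ~ S n x ->
  surj f -> surj g -> sact f x = sact g x -> f = g.
Proof.
move=> cl low nx sf sg e; apply: delta_inj => i.
have [s [fs si]] := surj_section i sf.
have gs : dcomp g s = did n.
  apply: surj_endo; apply: contrapT => /nsurj_factor[r [u [v [rn uv]]]].
  apply: nx; rewrite -(sact_id x) -fs sact_comp e -sact_comp uv sact_comp.
  exact/cl/low.
by rewrite -[in RHS]si -dcompE gs didE.
Qed.

Lemma surj_notin (X : sset) (S : forall n, X n -> Prop) n (x : X n) m (f : delta m n) :
  (forall p q (d : delta p q) y, S q y -> S p (sact d y)) ->
  surj f -> S m (sact f x) -> S n x.
Proof.
move=> cl sf h; have [s [fs _]] := surj_section ord0 sf.
by rewrite -(sact_id x) -fs sact_comp; apply: cl.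
Qed.

(** Partial maps are encoded by their graphs, so that extension is inclusion of relations and chains
    have unions. *)
Definition pfun (X Y : sset) (G : forall n, X n -> Y n -> Prop) :=
  (forall n x y y', G n x y -> G n x y' -> y = y') /\
  (forall m n (d : delta m n) x y, G n x y -> G m (sact d x) (sact d y)).

(** The map [s] is the characteristic map of a cell: it has to be injective only away from the
    domain of [G]. *)
Lemma pfun_attach (W X V : sset) (s : smap V W) (g : smap V X)
    (G : forall n, W n -> X n -> Prop) : pfun G ->
  (forall n v x, G n (s n v) x -> x = g n v) ->
  (forall n v v', s n v = s n v' -> v = v' \/ exists x, G n (s n v) x) ->
  pfun (fun n w x => G n w x \/ exists v, w = s n v /\ x = g n v).
Proof.
move=> [fG aG] ag ij; split.
- move=> n w x x' [h|[v [-> ->]]] [h'|[v' [e ->]]].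
  + exact: fG h h'.
  + by rewrite e in h; apply: ag h.
  + by symmetry; apply: ag h'.
  + have [->//|[y h]] := ij _ _ _ e.
    by rewrite -(ag _ _ _ h); rewrite e in h; apply: ag h.
- move=> m n d w x [h|[v [-> ->]]]; first by left; apply: aG.
  by right; exists (sact d v); rewrite !smap_nat.
Qed.

Lemma pfun_total (X Y : sset) (G : forall n, X n -> Y n -> Prop) : pfun G ->
  (forall n x, exists y, G n x y) -> exists f : smap X Y, forall n x, G n x (f n x).
Proof. by move=> [fG aG] tG; apply: ex_smap. Qed.

Definition lifts (A B X Y : sset) (i : smap A B) (p : smap X Y) : Prop :=
  forall (u : smap A X) (v : smap B Y), (forall n a, p n (u n a) = v n (i n a)) ->
  exists w : smap B X, (forall n a, w n (i n a) = u n a) /\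
                       (forall n b, p n (w n b) = v n b).

Lemma lifts_has_lifting (A B X Y : sset) (i : smap A B) (p : smap X Y) :
  lifts i p <-> @has_lifting SSET _ _ _ _ i p.
Proof.
split=> h u v e.
- have [|w [wi pw]] := h u v.
    by move=> n a; have := congr1 (fun f : smap _ _ => f n a) e.
  by exists w; split; apply: smap_eq.
- have [|w [wi pw]] := h u v; first exact: smap_eq.
  exists w; split=> n a.
    exact: (congr1 (fun f : smap _ _ => f n a) wi).
  exact: (congr1 (fun f : smap _ _ => f n a) pw).
Qed.

Lemma kanP (X Y : sset) (p : smap X Y) : kan_fibration p <->
  (forall n (k : 'I_n.+2) (u : smap (horn k) X) (y : Y n.+1),
    (forall m (a : horn k m), p m (u m a) = sact (val a) y) ->
    exists z : X n.+1, p _ z = y /\ forall m (a : horn k m), sact (val a) z = u m a).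
Proof.
split=> h n k.
- move=> u y e; have /lifts_has_lifting := h n k.
  case/(_ u (yoneda y) e) => w [wu wy]; exists (w _ (did _)).
  rewrite wy /= sact_id; split=> // m a.
  by rewrite -yonedaK -wu.
- apply/lifts_has_lifting => u v e.
  have [|z [pz zu]] := h n k u (v _ (did _)).
    by move=> m a; rewrite -yonedaK e.
  exists (yoneda z); split=> m a; first exact: zu.
  by rewrite /= smap_nat pz -yonedaK.
Qed.

(** * Filling prisms *)

Section Prism.
Variable n : nat.
Let W := sprod (stdsimplex n) unitI.

(** The filtration along which the prism is filled. Stage 0 is the boundary together with the end at
    time 1, and stage [n.+1] is everything. *)
Definition prism_le (i : nat) m (w : W m) : Prop :=
  ~ surj w.1 \/ forall t, dval w.2 t = ord0 -> dval w.1 t < i.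

Variable i : 'I_n.+1.

Lemma cell_base_subproof (a b : 'I_n.+2) : a <= b ->
  (inord (if a <= i then a : nat else a.-1) : 'I_n.+1)
    <= (inord (if b <= i then b : nat else b.-1) : 'I_n.+1).
Proof.
move=> ab; have ia := ltn_ord i; have ha := ltn_ord a; have hb := ltn_ord b.
by rewrite !inordK; (do 2?case: ifP); lia.
Qed.

Lemma cell_time_subproof (a b : 'I_n.+2) : a <= b ->
  (if a <= i then ord0 else ord_max : 'I_2) <= (if b <= i then ord0 else ord_max : 'I_2).
Proof. by move=> ab; do 2?case: ifP => //=; lia. Qed.

(* The nondegenerate cell of the prism with vertices
   (0,0), ..., (i,0), (i,1), ..., (n,1). *)
Definition cell : W n.+1 :=
  (mkdelta cell_base_subproof, mkdelta cell_time_subproof).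

Lemma cell1E j : dval cell.1 j = (if j <= i then j : nat else j.-1) :> nat.
Proof.
have ia := ltn_ord i; have hj := ltn_ord j.
by rewrite mkdeltaE inordK //; case: ifP; lia.
Qed.

Lemma cell2E j : (dval cell.2 j == ord0) = (j <= i).
Proof. by rewrite mkdeltaE; case: ifP. Qed.

Lemma cell_inj m (d d' : delta m n.+1) : sact d cell = sact d' cell -> d = d'.
Proof.
move=> e; apply: delta_inj => t.
have := congr1 (fun w : W m => dval w.2 t == ord0) e.
have := congr1 (fun w : W m => val (dval w.1 t)) e.
rewrite /= !dcompE !cell2E !cell1E => a1 a2; apply: val_inj => /=; move: a1 a2.
by have := ltn_ord i; do 2?case: ifP; lia.
Qed.

Definition cell_vertex : 'I_n.+2 := lift ord0 i.

(* The cell is attached along the horn opposite its vertex (i,1). *)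
Lemma cell_horn m (d : delta m n.+1) :
  in_horn cell_vertex d <-> prism_le i (sact d cell).
Proof.
have ia := ltn_ord i.
have b1 t : dval (dcomp cell.1 d) t = (if dval d t <= i then dval d t : nat else (dval d t).-1) :> nat.
  by rewrite dcompE cell1E.
have b2 t : (dval (dcomp cell.2 d) t == ord0) = (dval d t <= i).
  by rewrite dcompE cell2E.
split.
- case/existsP => j /andP[jk /forallP mj].
  have {}jk : j != i.+1 :> nat by apply: contra jk => /eqP e; apply/eqP/val_inj; rewrite /= e.
  have {}mj t : dval d t != j :> nat := mj t.
  have hj := ltn_ord j.
  have [ji|ji] := eqVneq (j : nat) i.
    right=> t /= /eqP; rewrite b2 => h; rewrite b1 h ltn_neqAle h andbT.
    by rewrite -ji; apply: mj.
  left; have lt : (if j < i then j : nat else j.-1) < n.+1 by case: ifP; lia.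
  apply: (@missing_nsurj _ _ _ (Ordinal lt)) => t; apply/eqP => /(congr1 val).
  rewrite /= b1; have := mj t; move: ji jk.
  by do 2?case: ifP; lia.
- case=> [/nsurjP[j mj]|h].
  + have {}mj t : (if dval d t <= i then dval d t : nat else (dval d t).-1) != j.
      by rewrite -b1; apply: mj.
    have hj := ltn_ord j.
    have lt : (if j <= i then j : nat else j.+1) < n.+2 by case: ifP; lia.
    apply/existsP; exists (Ordinal lt); apply/andP; split.
      by apply/eqP => /(congr1 val) /=; rewrite /bump /=; case: ifP; lia.
    apply/forallP => t; apply/eqP => /(congr1 val) /=; have := mj t.
    by do 2?case: ifP; lia.
  + apply/existsP; exists (inord i); apply/andP; split.
      apply/eqP => /(congr1 val) /=; rewrite /bump /= inordK; lia.
    apply/forallP => t; apply/eqP => /(congr1 val) /=.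
    rewrite inordK; last by lia.
    move=> e; have := h t; rewrite /= b1 e leqnn ltnn => /(_ _)/notF; apply.
    by apply/eqP; rewrite b2 e.
Qed.

(** A simplex that is new at this stage has a vertex at time 0 over at least [i]. All its vertices
    at time 1 then lie over at least [i] as well, and it factors through the chain of vertices of
    the cell. *)
Lemma cell_cover m (w : W m) :
  prism_le i.+1 w <-> prism_le i w \/ exists d : delta m n.+1, w = sact d cell.
Proof.
case: w => b a; split.
- case=> [h|h]; first by left; left.
  have [p|np] := pselect (prism_le i (b, a)); first by left.
  have [sb|] := pselect (surj b); last by move=> nb; case: np; left.
  right.
  have [t0 [at0 bt0]] : exists t, dval a t = ord0 /\ i <= dval b t.
    apply: contrapT => ne; apply: np; right => t /= at0.
    by rewrite ltnNge; apply/negP => ib; apply: ne; exists t.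
  have hi t : dval a t != ord0 -> i <= dval b t.
    move=> at1; apply: leq_trans bt0 _; apply: (monoP b).
    case: leqP => // /ltnW /(monoP a); rewrite at0 leqn0 => /eqP e.
    by case/eqP: at1; apply: val_inj.
  (* The index is shifted by one at time 1 because [i] occurs at both times in the cell. *)
  pose f t : 'I_n.+2 := inord (if dval a t == ord0 then dval b t : nat else (dval b t).+1).
  have fE t : f t = (if dval a t == ord0 then dval b t : nat else (dval b t).+1) :> nat.
    by have := ltn_ord (dval b t) => hb; rewrite inordK //; case: ifP; lia.
  have fm (x y : 'I_m.+1) : x <= y -> f x <= f y.
    move=> xy; rewrite !fE; have := monoP b xy; have := monoP a xy.
    case: eqP => ex; case: eqP => ey; rewrite ?ey ?ex; try lia.
    rewrite leqn0 => /eqP e; by case: ex; apply: val_inj.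
  exists (mkdelta fm).
  have c t : (f t <= i) = (dval a t == ord0).
    rewrite fE; case: eqP => e; first by have := h t e => /=; lia.
    by have := hi t; case: eqP => // _ /(_ isT) ?; apply/negbTE; rewrite -ltnNge ltnS.
  congr pair; apply: delta_inj => t; rewrite dcompE mkdeltaE.
    by apply: ord_inj; rewrite cell1E c fE; case: (dval a t == ord0).
  have := cell2E (f t); rewrite c.
  by rewrite [dval a t]ord2E [dval _ (f t)]ord2E; do 2?case: ifP.
- case=> [[h|h]|[d e]]; [by left|right=> t /h|].
    by move/ltnW; rewrite ltnS.
  case: e => -> ->; right=> t /eqP.
  by rewrite /= !dcompE cell2E => h; have := cell1E (dval d t); rewrite h => ->; rewrite ltnS.
Qed.

End Prism.

(** By [cell_horn] the part of the new cell that is already lifted is a horn, so one use of the Kan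
    condition extends the partial lift. *)
Lemma prism_step (X Y : sset) (p : smap X Y) n (w0 : smap (sprod (stdsimplex n) unitI) Y)
    (i : 'I_n.+1) (G : forall m, sprod (stdsimplex n) unitI m -> X m -> Prop) :
  kan_fibration p -> pfun G -> (forall m w x, G m w x -> p m x = w0 m w) ->
  (forall m w, (exists x, G m w x) <-> prism_le i w) ->
  exists G' : forall m, sprod (stdsimplex n) unitI m -> X m -> Prop,
  [/\ pfun G', forall m w x, G' m w x -> p m x = w0 m w,
      forall m w, (exists x, G' m w x) <-> prism_le i.+1 w &
      forall m w x, G m w x -> G' m w x].
Proof.
move=> /kanP kp [fG aG] pG dG.
have [u uP] : exists u : smap (horn (cell_vertex i)) X,
    forall m a, G m (sact (val a) (cell i)) (u m a).
  apply: (@ex_smap (horn (cell_vertex i)) X (fun m a x => G m (sact (val a) (cell i)) x)).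
  - by move=> m a; apply/dG/cell_horn/(valP a).
  - by move=> m a x x'; apply: fG.
  - by move=> m q d a x h; rewrite (_ : val (sact d a) = dcomp (val a) d) // sact_comp; apply: aG.
have [|z [pz zu]] := kp n (cell_vertex i) u (w0 _ (cell i)).
  by move=> m a; rewrite (pG _ _ _ (uP m a)) smap_nat.
have ag m (d : delta m n.+1) x : G m (sact d (cell i)) x -> x = sact d z.
  move=> h; have hd : in_horn (cell_vertex i) d by apply/cell_horn/dG; exists x.
  have e : sact d z = u m (exist _ d hd) := zu m (exist _ d hd).
  by rewrite e; apply: fG h (uP m (exist _ d hd)).
exists (fun m w x => G m w x \/ exists d : delta m n.+1, w = sact d (cell i) /\ x = sact d z).
split.
- apply: (@pfun_attach _ _ _ (yoneda (cell i)) (yoneda z) G) => //=.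
  by move=> m d d' /cell_inj; left.
- move=> m w x [/pG //|[d [-> ->]]]; by rewrite !smap_nat pz.
- move=> m w; rewrite cell_cover -dG; split.
    by case=> x [h|[d [e _]]]; [left; exists x|right; exists d].
  by case=> [[x h]|[d e]]; [exists x; left|exists (sact d z); right; exists d].
- by move=> m w x h; left.
Qed.

Definition prism_side (e : bool) n m (w : sprod (stdsimplex n) unitI m) : Prop :=
  ~ surj w.1 \/ w.2 = vert e m.

Lemma prism_fill_true (X Y : sset) (p : smap X Y) n
    (w0 : smap (sprod (stdsimplex n) unitI) Y)
    (G : forall m, sprod (stdsimplex n) unitI m -> X m -> Prop) :
  kan_fibration p -> pfun G -> (forall m w x, G m w x -> p m x = w0 m w) ->
  (forall m w, (exists x, G m w x) <-> prism_side true w) ->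
  exists h : smap (sprod (stdsimplex n) unitI) X,
    (forall m w, p m (h m w) = w0 m w) /\ (forall m w x, G m w x -> h m w = x).
Proof.
move=> kp fG pG dG.
have H i : i <= n.+1 -> exists G' : forall m, sprod (stdsimplex n) unitI m -> X m -> Prop,
  [/\ pfun G', forall m w x, G' m w x -> p m x = w0 m w,
      forall m w, (exists x, G' m w x) <-> prism_le i w &
      forall m w x, G m w x -> G' m w x].
  elim: i => [|i IH] hi.
    exists G; split=> // m w; rewrite dG /prism_side /prism_le.
    have -> : (w.2 = vert true m) = (forall t, dval w.2 t = ord0 -> dval w.1 t < 0).
      apply/propext; split=> [->|h] => [t|]; first by rewrite dcstE.
      apply: delta_inj => t; rewrite dcstE [LHS]ord2E.
      case: eqP => // ne; have := h t; rewrite [dval _ _]ord2E; case: eqP => // _.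
      by move/(_ erefl).
    by [].
  have [G1 [fG1 pG1 dG1 e1]] := IH (ltnW hi).
  have [G2 [fG2 pG2 dG2 e2]] := @prism_step _ _ p n w0 (Ordinal hi) G1 kp fG1 pG1 dG1.
  by exists G2; split=> // m w x h; apply/e2/e1.
have [G1 [fG1 pG1 dG1 e1]] := H n.+1 (leqnn _).
have [|h hP] := pfun_total fG1.
  by move=> m w; apply/dG1; right.
exists h; split=> [m w|m w x g]; first exact: pG1 (hP m w).
exact: fG1.1 (hP m w) (e1 _ _ _ g).
Qed.

(** * Reversal of the order of vertices *)

Lemma drev_subproof m n (f : delta m n) (i j : 'I_m.+1) :
  i <= j -> rev_ord (dval f (rev_ord i)) <= rev_ord (dval f (rev_ord j)).
Proof.
move=> ij /=; have : dval f (rev_ord j) <= dval f (rev_ord i) by apply: monoP => /=; lia.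
lia.
Qed.

Definition drev m n (f : delta m n) : delta m n := mkdelta (@drev_subproof m n f).

Lemma drevE m n (f : delta m n) i : dval (drev f) i = rev_ord (dval f (rev_ord i)).
Proof. exact: mkdeltaE. Qed.

Lemma drevK m n (f : delta m n) : drev (drev f) = f.
Proof. by apply: delta_inj => i; rewrite !drevE !rev_ordK. Qed.

Lemma drev_comp m n p (g : delta n p) (f : delta m n) :
  drev (dcomp g f) = dcomp (drev g) (drev f).
Proof. by apply: delta_inj => i; rewrite !(drevE, dcompE) rev_ordK. Qed.

Lemma drev_id n : drev (did n) = did n.
Proof. by apply: delta_inj => i; rewrite !(drevE, didE) rev_ordK. Qed.

Lemma drev_surj m n (f : delta m n) : surj (drev f) -> surj f.
Proof.
move=> h j; have [i] := h (rev_ord j); rewrite drevE => /rev_ord_inj e.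
by exists (rev_ord i).
Qed.

Lemma drev_vert e n : drev (vert e n) = vert (~~ e) n.
Proof.
by apply: delta_inj => i; rewrite drevE !dcstE; apply: val_inj; case: e.
Qed.

Definition sop (X : sset) : sset.
Proof.
apply: (@SSet (fun n => X n) (fun m n f x => sact (drev f) x)).
- by move=> n x; rewrite drev_id sact_id.
- by move=> m n p g f x; rewrite drev_comp sact_comp.
Defined.

Definition sop_map (X Y : sset) (f : smap X Y) : smap (sop X) (sop Y) :=
  @SMap (sop X) (sop Y) f (fun m n d x => smap_nat f (drev d) x).

Lemma drev_horn n (k : 'I_n.+1) m (x : delta m n) :
  in_horn k x -> in_horn (rev_ord k) (drev x).
Proof.
case/existsP=> j /andP[jk /forallP h]; apply/existsP; exists (rev_ord j).
rewrite (inj_eq rev_ord_inj) jk; apply/forallP => i.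
by rewrite drevE (inj_eq rev_ord_inj).
Qed.

(* Reversing the order of vertices exchanges the two ends of the interval, so it suffices to fill
   prisms from one end. *)
Lemma kan_sop (X Y : sset) (p : smap X Y) : kan_fibration p -> kan_fibration (sop_map p).
Proof.
move=> /kanP h; apply/kanP => n k u y e.
pose r m (a : horn (rev_ord k) m) : horn k m :=
  exist _ (drev (val a)) (eq_rect _ (fun k => in_horn k (drev (val a))) (drev_horn (valP a)) _ (rev_ordK k)).
have rK m (a : horn k m) : r m (exist _ (drev (val a)) (drev_horn (valP a))) = a.
  by apply: val_inj; rewrite /= drevK.
have rn m q (d : delta m q) a : r m (sact d a) = sact (drev d) (r q a).
  by apply: val_inj; rewrite /= drev_comp.
have un m q (d : delta m q) a : u m (r m (sact d a)) = sact d (u q (r q a) : X q).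
  by rewrite rn (smap_nat u) /= drevK.
have [|z [pz zu]] := h n (rev_ord k) (@SMap _ X (fun m a => u m (r m a)) un) y.
  move=> m a; have := e m (r m a); by rewrite /= drevK.
exists z; split=> // m a.
by have := zu m (exist _ (drev (val a)) (drev_horn (valP a))); rewrite /= rK.
Qed.

Lemma prism_fill (e : bool) (X Y : sset) (p : smap X Y) n
    (w0 : smap (sprod (stdsimplex n) unitI) Y)
    (G : forall m, sprod (stdsimplex n) unitI m -> X m -> Prop) :
  kan_fibration p -> pfun G -> (forall m w x, G m w x -> p m x = w0 m w) ->
  (forall m w, (exists x, G m w x) <-> prism_side e w) ->
  exists h : smap (sprod (stdsimplex n) unitI) X,
    (forall m w, p m (h m w) = w0 m w) /\ (forall m w x, G m w x -> h m w = x).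
Proof.
case: e; first exact: prism_fill_true.
move=> kp [fG aG] pG dG.
pose r m (w : sprod (stdsimplex n) unitI m) : sprod (stdsimplex n) unitI m :=
  (drev w.1, drev w.2).
have rK m w : r m (r m w) = w by case: w => a b; rewrite /r /= !drevK.
have rn m q (d : delta m q) w : r m (sact d w) = sact (drev d) (r q w).
  by rewrite /r /= !drev_comp.
have w0n m q (d : delta m q) w : w0 m (r m (sact d w)) = sact (drev d) (w0 q (r q w)).
  by rewrite rn smap_nat.
have [||||h [ph hG]] := @prism_fill_true (sop X) (sop Y) (sop_map p) n
    (@SMap _ (sop Y) (fun m w => w0 m (r m w)) w0n) (fun m w x => G m (r m w) x).
- exact: kan_sop.
- split=> [m w x x'|m q d w x g]; first exact: fG.
  by rewrite rn; apply: aG.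
- by move=> m w x /pG.
- move=> m w; rewrite dG /prism_side /r /=; split.
    case=> [a|/(congr1 (@drev _ _))]; last by rewrite drevK drev_vert; right.
    by left=> b; apply: a; apply: drev_surj; rewrite drevK.
  case=> [a|->]; last by rewrite drev_vert; right.
  by left=> b; apply/a/drev_surj.
have hn m q (d : delta m q) w : h m (r m (sact d w)) = sact d (h q (r q w) : X q).
  by rewrite rn smap_nat /= drevK.
exists (@SMap _ X (fun m w => h m (r m w)) hn); split=> [m w|m w x g] /=.
  by have := ph m (r m w); rewrite /= rK.
by apply: hG; rewrite rK.
Qed.

(** * Homotopy lifting *)

Section HLP.
Variables (e : bool) (K L X Y : sset) (p : smap X Y) (j : smap K L).
Hypotheses (kp : kan_fibration p) (ij : inj j).
Variables (u : smap L X) (v : smap (sprod K unitI) X) (w : smap (sprod L unitI) Y).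
Hypothesis uv : forall n k, v n (k, vert e n) = u n (j n k).
Hypothesis pu : forall n l, p n (u n l) = w n (l, vert e n).
Hypothesis pv : forall n k t, p n (v n (k, t)) = w n (j n k, t).

(** Zorn's lemma is applied to subsets of one type, so the graphs of partial lifts in all dimensions
    live in the sum over [n]. *)
Let T := {n & ((L n * unitI n) * X n)%type}.
Let rel (A : T -> Prop) n (lt : sprod L unitI n) (x : X n) := A (existT _ n (lt, x)).

Let dom (A : T -> Prop) n (l : L n) := forall t, exists x, rel A (l, t) x.

(** The last clause makes the domain the product of a subcomplex of [L] with the interval. The
    clause on [vert e] only asks for agreement with [u] where the partial lift is defined. *)
Let good (A : T -> Prop) :=
  [/\ pfun (rel A), forall n lt x, @rel A n lt x -> p n x = w n lt,
      forall n k t, rel A (j n k, t) (v n (k, t)),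
      forall n l x, rel A (l, vert e n) x -> x = u n l &
      forall n lt x, @rel A n lt x -> @dom A n lt.1].

Let base : T -> Prop := fun z => exists k : K (tag z), (tagged z).1.1 = j _ k /\
   (tagged z).2 = v _ (k, (tagged z).1.2).

Let good_base : good base.
Proof.
split.
- split=> [n lt x x' [k [/= a ->]] [k' [/= a' ->]]|m n d lt x [k [/= a ->]]].
    by rewrite a in a'; rewrite (ij a').
  by exists (sact d k); rewrite /= a -!smap_nat.
- by move=> n [l t] x [k /= [-> ->]]; rewrite pv.
- by move=> n k t; exists k; split.
- by move=> n l x [k /= [-> ->]]; rewrite uv.
- by move=> n lt x [k /= [-> _]] t; exists (v _ (k, t)), k.
Qed.

Let good_union (F : (T -> Prop) -> Prop) :
  (exists A, F A) -> (forall A, F A -> good A) ->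
  (forall A B, F A -> F B -> (forall z, A z -> B z) \/ (forall z, B z -> A z)) ->
  good (fun z => exists2 A, F A & A z).
Proof.
move=> [A0 FA0] gF tF.
have fn n lt x x' A B : F A -> F B -> @rel A n lt x -> @rel B n lt x' -> x = x'.
  move=> FA FB a b; case: (tF _ _ FA FB) => s.
    by have [[fn _] _ _ _ _] := gF _ FB; apply: (fn n lt) => //; apply: s.
  by have [[fn _] _ _ _ _] := gF _ FA; apply: (fn n lt) => //; apply: s.
split.
- split=> [n lt x x' [A FA a] [B FB b]|m n d lt x [A FA a]]; first exact: fn FA FB a b.
  by exists A => //; have [[_ ac] _ _ _ _] := gF _ FA; apply: (ac m n d lt).
- by move=> n lt x [A /gF[_ h _ _ _] a]; apply: h.
- by move=> n k t; exists A0 => //; have [_ _ h _ _] := gF _ FA0; apply: h.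
- by move=> n l x [A /gF[_ _ _ h _] a]; apply: h.
- move=> n lt x [A FA a] t; have [_ _ _ _ h] := gF _ FA.
  by have [y b] := h _ _ _ a t; exists y, A.
Qed.

Let dom_act A : good A -> forall m n (d : delta m n) l, dom A l -> dom A (sact d l).
Proof.
move=> [[_ ac] _ _ _ h] m n d l /(_ (vert e n))[x a].
exact: h _ _ _ (ac _ _ d _ _ a).
Qed.

(** The boundary of [l] is already in the domain and [u] supplies one end, so the prism over [l] can
    be filled and attached. Its characteristic map is injective away from the domain by
    [nondegenerate_inj]. *)
Let good_step (A : T -> Prop) n (l : L n) : good A ->
  (forall r (y : L r), r < n -> dom A y) -> ~ dom A l ->
  exists2 B, good B & (forall z, A z -> B z) /\ dom B l.
Proof.
move=> gA low nl; have cl := dom_act gA; have [[fA aA] pA vA uA dA] := gA.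
have nd m (f : delta m n) : ~ surj f -> dom A (sact f l).
  case/nsurj_factor=> r [a [b [rn ->]]]; rewrite sact_comp.
  by apply: cl; apply: low.
have sd m (f : delta m n) : dom A (sact f l) -> ~ surj f.
  by move=> h sf; apply: nl; apply: surj_notin sf h.
pose s : smap (sprod (stdsimplex n) unitI) (sprod L unitI) :=
  sprod_map (yoneda l) (smap_id unitI).
pose G m (z : sprod (stdsimplex n) unitI m) (x : X m) :=
  rel A (s m z) x \/ (z.2 = vert e m /\ x = u m (sact z.1 l)).
have [||||h [ph hG]] := @prism_fill e X Y p n (smap_comp w s) G.
- by [].
- split=> [m [f t] x x' [a|[/= -> ->]] [b|[/= e' ->]]|m q d [f t] x [a|[/= -> ->]]].
  + exact: fA a b.
  + by move: a; rewrite e' => /uA.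
  + by move: b => /uA ->.
  + by [].
  + by left; rewrite /s smap_nat; apply: aA.
  + by right; split; [exact: vert_act|rewrite /= sact_comp !smap_nat].
- by move=> m [f t] x [/pA //|[/= -> ->]]; rewrite pu.
- move=> m [f t]; split.
    by case=> x [a|[/= -> _]]; [left; apply: sd; apply: dA a|right].
  case=> /= [nf|->]; last by exists (u m (sact f l)); right.
  by have [x a] := nd _ _ nf t; exists x; left.
have ag m z x : rel A (s m z) x -> x = h m z by move=> a; rewrite (hG m z x) //; left.
exists (fun z : T => A z \/ exists q, (tagged z).1 = s _ q /\ (tagged z).2 = h _ q).
  split.
  - apply: pfun_attach => // m [f t] [f' t'] /= [a <-].
    have [nf|sf] := pselect (surj f); last by right; have := nd _ _ sf t.
    have [nf'|sf'] := pselect (surj f'); last by right; rewrite a; have := nd _ _ sf' t.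
    by left; rewrite (nondegenerate_inj cl low nl nf nf' a).
  - by move=> m lt x [/pA //|[q [/= -> ->]]]; rewrite ph.
  - by move=> m k t; left; apply: vA.
  - move=> m l' x [/uA //|[[f t] [/= [-> <-] ->]]].
    by apply: hG; right.
  - move=> m lt x [/dA a t|[[f t'] [/= -> _]] t].
      by have [y b] := a t; exists y; left.
    by exists (h _ (f, t)); right; exists (f, t).
split=> [z|t]; first by left.
exists (h _ (did n, t)); right; exists (did n, t) => /=.
by rewrite sact_id.
Qed.

Theorem homotopy_lifting : exists h : smap (sprod L unitI) X,
  [/\ forall n l, h n (l, vert e n) = u n l,
      forall n k t, h n (j n k, t) = v n (k, t) &
      forall n z, p n (h n z) = w n z].
Proof.
have [A [gA mA]] : exists A : T -> Prop, good A /\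
    (forall B, good B -> (forall z, A z -> B z) -> forall z, B z -> A z).
  have [|A [PA mA]] := @classical_sets.Zorn_bigcup T (fun A => good A \/ A = (fun _ => False)).
    move=> F FP tF.
    have [[A0 [FA0 gA0]]|nF] := pselect (exists A, F A /\ good A).
      left.
      rewrite (_ : classical_sets.bigcup _ _ =
                   (fun z => exists2 A, F A /\ good A & A z)); last first.
        apply/funext => z; apply/propext; split=> [[A FA Az]|[A [FA _] Az]]; last by exists A.
        by exists A => //; split => //; case: (FP _ FA) => // e0; rewrite e0 in Az.
      apply: good_union; first by exists A0.
        by move=> A [].
      by move=> A B [FA _] [FB _]; apply: tF.
    right; apply/funext => z; apply/propext; split=> // -[A FA Az].
    by case: (FP _ FA) => [g|e0]; [case: nF; exists A|rewrite e0 in Az].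
  have key B : good B -> (forall z, A z -> B z) -> forall z, B z -> A z.
    move=> gB AB; apply: contrapT => /existsNP[z /not_implyP[Bz nAz]].
    apply: (mA B); last by left.
    by split => // BA; apply/nAz/BA.
  case: PA => [gA|A0]; first by exists A.
  exists base; split; first exact: good_base.
  move=> B gB _ z Bz; have := key B gB; rewrite A0 => /(_ _)/(_ z Bz) k.
  by exfalso; apply: k.
have tA n (l : L n) : dom A l.
  apply: contrapT => nl.
  pose bad n := `[< exists l : L n, ~ dom A l >].
  have ex : exists n, bad n by exists n; apply/asboolP; exists l.
  case: (ex_minnP ex) => {nl l} {}n /asboolP[l nl] mn.
  have low r (y : L r) : r < n -> dom A y.
    by move=> rn; apply: contrapT => ny; have := mn r; rewrite leqNgt rn => /(_ _)/notF; apply; apply/asboolP; exists y.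
  have [B gB [AB dB]] := good_step gA low nl.
  apply: nl => t; have [x b] := dB t; exists x; exact: mA gB AB _ b.
have [fA pA vA uA _] := gA.
have [|h hP] := pfun_total fA.
  by move=> n [l t]; have := tA n l t.
exists h; split.
- by move=> n l; apply: uA (hP _ _).
- move=> n k t; exact: fA.1 (hP _ _) (vA _ _ _).
- by move=> n z; apply: pA.
Qed.

End HLP.

(** * Discrete simplicial sets, products, subcomplexes and lifting against horns *)

Definition disc (T : Type) : sset :=
  @SSet (fun _ => T) (fun _ _ _ x => x) (fun _ _ => erefl) (fun _ _ _ _ _ _ => erefl).

Definition pt : sset := disc unit.

Definition bang (X : sset) : smap X pt :=
  @SMap X pt (fun _ _ => tt) (fun _ _ _ _ => erefl).

Definition const_map (X Y : sset) (y : Y 0) : smap X Y :=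
  @SMap X Y (fun n _ => degen n y) (fun m n d _ => esym (sact_degen d y)).

Definition smap_fst (X Y : sset) : smap (sprod X Y) X :=
  @SMap (sprod X Y) X (fun _ z => z.1) (fun _ _ _ _ => erefl).
Definition smap_snd (X Y : sset) : smap (sprod X Y) Y :=
  @SMap (sprod X Y) Y (fun _ z => z.2) (fun _ _ _ _ => erefl).

Definition smap_pair (X Y Z : sset) (f : smap Z X) (g : smap Z Y) : smap Z (sprod X Y).
Proof.
by apply: (@SMap Z (sprod X Y) (fun n z => (f n z, g n z))) => m n d z; rewrite !smap_nat.
Defined.

Definition svoid : sset := disc Empty_set.
Definition svoid_map (X : sset) : smap svoid X :=
  @SMap svoid X (fun n (x : svoid n) => match x with end) (fun m n d (x : svoid n) => match x with end).

Record subc (X : sset) := Subc {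
  sc :> forall n, X n -> Prop;
  sc_act : forall m n (d : delta m n) x, @sc n x -> @sc m (sact d x) }.

Arguments sc {X} s n x.

Definition ssub (X : sset) (S : subc X) : sset.
Proof.
apply: (@SSet (fun n => {x : X n | S n x})
  (fun m n d x => exist (S m) (sact d (proj1_sig x)) (sc_act d (proj2_sig x)))).
- by move=> n [x h]; apply: eq_exist; rewrite /= sact_id.
- by move=> m n p g f [x h]; apply: eq_exist; rewrite /= sact_comp.
Defined.

Definition sincl (X : sset) (S : subc X) : smap (ssub S) X :=
  @SMap (ssub S) X (fun n x => proj1_sig x) (fun _ _ _ _ => erefl).

Lemma sincl_inj (X : sset) (S : subc X) : inj (sincl S).
Proof. by move=> n [x h] [y k] /= e; apply: eq_exist. Qed.

Definition scorestr (T X : sset) (S : subc X) (f : smap T X) (h : forall n t, S n (f n t)) :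
  smap T (ssub S).
Proof.
apply: (@SMap T (ssub S) (fun n t => exist (S n) (f n t) (h n t))).
by move=> m n d t; apply: eq_exist; rewrite /= smap_nat.
Defined.

Definition simage (X Y : sset) (f : smap X Y) : subc Y.
Proof.
apply: (@Subc Y (fun n y => exists x, f n x = y)).
by move=> m n d y [x <-]; exists (sact d x); rewrite smap_nat.
Defined.

Definition at_end (X : sset) (e : bool) : smap X (sprod X unitI) :=
  smap_pair (smap_id X) (const_map X (vert e 0)).

Lemma at_endE (X : sset) e n (x : X n) : at_end X e n x = (x, vert e n).
Proof. by rewrite /= /degen dcst_comp. Qed.

Lemma at_end_comp (X Y : sset) (h : smap (sprod X unitI) Y) e n (x : X n) :
  smap_comp h (at_end X e) n x = h n (x, vert e n).
Proof. by rewrite -at_endE. Qed.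

Section Retract.
Variables (e : bool) (n : nat) (k : 'I_n.+2).

(* Exhibits the horn inclusion as a retract of its pushout product with the inclusion of an end
   of the interval. *)
Definition rtr_fun (a : 'I_n.+2) (t : 'I_2) : 'I_n.+2 :=
  if t == (if e then ord_max else ord0) then
    (if e then (if a <= k then k else a) else (if a <= k then a else k)) else a.

Lemma rtr_subproof m (x : delta m n.+1) (t : delta m 1) (i j : 'I_m.+1) :
  i <= j -> rtr_fun (dval x i) (dval t i) <= rtr_fun (dval x j) (dval t j).
Proof.
move=> ij; have := monoP x ij; have := monoP t ij; rewrite /rtr_fun.
rewrite [dval t i]ord2E [dval t j]ord2E.
case: e; case: (dval t i == ord_max); case: (dval t j == ord_max) => /= hx; do ?case: ifP; lia.
Qed.

Definition rtr m (z : sprod (stdsimplex n.+1) unitI m) : delta m n.+1 :=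
  mkdelta (@rtr_subproof m z.1 z.2).

Lemma rtrE m z i : dval (@rtr m z) i = rtr_fun (dval z.1 i) (dval z.2 i).
Proof. exact: mkdeltaE. Qed.

Lemma rtr_nat m p (d : delta m p) z : rtr (sact d z) = sact d (rtr z : stdsimplex n.+1 p).
Proof.
apply: delta_inj => i; rewrite -[RHS]/(dval (dcomp (rtr z) d) i).
by rewrite (dcompE (rtr z)) !rtrE /= !dcompE.
Qed.

Lemma rtr_id m (x : delta m n.+1) : rtr (x, vert (~~ e) m) = x.
Proof. by apply: delta_inj => i; rewrite rtrE dcstE /rtr_fun; case: e. Qed.

Lemma rtr_horn m (z : sprod (stdsimplex n.+1) unitI m) :
  in_horn k z.1 -> in_horn k (rtr z).
Proof.
case/existsP=> j /andP[jk /forallP h]; apply/existsP; exists j; rewrite jk.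
apply/forallP => i; rewrite rtrE /rtr_fun; have := h i.
case: (dval z.2 i == _) => //; case: e; case: (dval z.1 i <= k) => //= _; by rewrite eq_sym.
Qed.

(** At the end [e] each vertex is replaced by its maximum, respectively minimum, with [k], which
    misses the first, respectively last, vertex. *)
Lemma rtr_end m (x : delta m n.+1) : (if e then 0 < k else k < n.+1) ->
  in_horn k (rtr (x, vert e m)).
Proof.
move=> hk; apply/existsP; exists (if e then ord0 else ord_max); apply/andP; split.
  by case: e hk => h; apply/eqP => /(congr1 val) /=; lia.
apply/forallP => i; apply/eqP => /(congr1 val).
rewrite rtrE dcstE /rtr_fun eqxx; case: e hk => /= h; case: ifP => /=; lia.
Qed.
End Retract.

Definition in_hornE n (k : 'I_n.+1) m (x : delta m n) (h : in_horn k x) : horn k m :=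
  exist _ x h.

(** The homotopy [rtr] sends both the end [e] and the cylinder on the subcomplex [S], where the lift
    is prescribed, into [S]. Homotopy lifting along it gives a map whose value at the other end,
    where [rtr] is the identity, is the required lift. *)
Theorem horn_lifting (K L X Y : sset) (p : smap X Y) (j : smap K L) n (k : 'I_n.+2)
    (u : smap (sprod K (stdsimplex n.+1)) X) (v : smap (sprod L (horn k)) X)
    (w : smap (sprod L (stdsimplex n.+1)) Y) :
  kan_fibration p -> inj j ->
  (forall m c a, u m (c, val a) = v m (j m c, a)) ->
  (forall m c x, p m (u m (c, x)) = w m (j m c, x)) ->
  (forall m l a, p m (v m (l, a)) = w m (l, val a)) ->
  exists h : smap (sprod L (stdsimplex n.+1)) X,
    [/\ forall m c x, h m (j m c, x) = u m (c, x),
        forall m l a, h m (l, val a) = v m (l, a) &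
        forall m z, p m (h m z) = w m z].
Proof.
move=> kp ij uv pu pv.
(* The vertex [k] cannot be both the first and the last, so one of the two ends is always usable. *)
have [e ek] : exists e : bool, (if e then 0 < k else k < n.+1).
  by case: (posnP k) => [k0|k0]; [exists false; rewrite k0|exists true].
pose R m (z : sprod L (stdsimplex n.+1) m) (y : X m) :=
  (exists c, j m c = z.1 /\ y = u m (c, z.2)) \/
  (exists a : horn k m, val a = z.2 /\ y = v m (z.1, a)).
have Rf m z y y' : @R m z y -> R m z y' -> y = y'.
  case=> [[c [a ->]]|[a [b ->]]] [[c' [a' ->]]|[a' [b' ->]]].
  - by rewrite -a' in a; rewrite (ij _ _ _ a).
  - by rewrite -b' uv a.
  - by rewrite -b uv a'.
  - by have -> : a = a' by apply: val_inj; rewrite b b'.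
have Ra m q (d : delta m q) z y : R q z y -> R m (sact d z) (sact d y).
  case=> [[c [a ->]]|[a [b ->]]].
    by left; exists (sact d c); rewrite smap_nat a -smap_nat.
  by right; exists (sact d a); rewrite -smap_nat /= -b.
have Sa m q (d : delta m q) z : (exists y, R q z y) -> exists y, R m (sact d z) y.
  by case=> y h; exists (sact d y); apply: Ra.
pose S := Subc Sa.
pose r m (z : sprod (sprod L (stdsimplex n.+1)) unitI m) : sprod L (stdsimplex n.+1) m :=
  (z.1.1, @rtr e n k m (z.1.2, z.2)).
have rn m q (d : delta m q) z : r m (sact d z) = sact d (r q z).
  by congr pair; exact: (rtr_nat e k d (z.1.2, z.2)).
pose rm : smap _ _ := SMap rn.
have wR m z y : R m z y -> p m y = w m z.
  by case: z => l x [[c [/= <- ->]]|[a [/= <- ->]]]; rewrite ?pu ?pv.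
have [u0 u0P] : exists u0 : smap (sprod L (stdsimplex n.+1)) X,
    forall m z, R m (r m (z, vert e m)) (u0 m z).
  apply: (@ex_smap _ _ (fun m z y => R m (r m (z, vert e m)) y)) => //.
  - move=> m [l x]; have hx := rtr_end x ek; exists (v m (l, in_hornE hx)).
    by right; exists (in_hornE hx).
  - by move=> m z y y'; apply: Rf.
  - by move=> m q d z y h; rewrite -(vert_act e d) (rn m q d (z, vert e q)); apply: Ra.
have [v0 v0P] : exists v0 : smap (sprod (ssub S) unitI) X,
    forall m z, R m (r m (proj1_sig z.1, z.2)) (v0 m z).
  apply: (@ex_smap (sprod (ssub S) unitI) X (fun m z y => R m (r m (proj1_sig z.1, z.2)) y)).
  - move=> m [[[l x] [y [[c [/= <- _]]|[a [/= e0 _]]]]] t].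
      by eexists; left; exists c.
    have h : in_horn k (rtr e k (x, t)) by rewrite -e0; apply: rtr_horn; apply: (valP a).
    exists (v m (l, in_hornE h)).
    by right; exists (in_hornE h).
  - by move=> m z y y'; apply: Rf.
  - by move=> m q d z y h; rewrite (rn m q d (proj1_sig z.1, z.2)); apply: Ra.
have [||||h [hu hv ph]] := @homotopy_lifting e (ssub S) _ X Y p (sincl S) kp _ u0 v0 (smap_comp w rm).
- exact: sincl_inj.
- by move=> m z; exact: Rf (v0P m (z, vert e m)) (u0P m (sincl S m z)).
- by move=> m z; apply: wR (u0P m z).
- by move=> m z t; apply: wR (v0P m (z, t)).
have hR m z y : R m z y -> h m (z, vert (~~ e) m) = y.
  move=> Rz; rewrite -[z]/(sincl S m (exist _ z (ex_intro _ y Rz))) hv.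
  apply: Rf (v0P _ _) _; rewrite /r /= rtr_id; by case: (z) Rz.
exists (smap_comp h (at_end _ (~~ e))); split.
- by move=> m c x; rewrite at_end_comp; apply: hR; left; exists c.
- by move=> m l a; rewrite at_end_comp; apply: hR; right; exists a.
- by move=> m z; rewrite at_end_comp ph /= /r /= rtr_id; case: z.
Qed.

(** * Homotopies and weak equivalences *)

Definition homotopy (X Y : sset) (f g : smap X Y) (H : smap (sprod X unitI) Y) :=
  forall n x, H n (x, vert false n) = f n x /\ H n (x, vert true n) = g n x.

Definition homotopic (X Y : sset) (f g : smap X Y) := exists H, homotopy f g H.

(** Homotopy lifting relative to the two ends of a cylinder: three sides of a square are prescribed
    and the fourth is produced. *)
Lemma box_lifting (e : bool) (T X Y : sset) (p : smap X Y)
    (w : smap (sprod (sprod T unitI) unitI) Y) (b l r : smap (sprod T unitI) X) :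
  kan_fibration p ->
  (forall n t, l n (t, vert e n) = b n (t, vert false n)) ->
  (forall n t, r n (t, vert e n) = b n (t, vert true n)) ->
  (forall n z, p n (b n z) = w n (z, vert e n)) ->
  (forall n t s, p n (l n (t, s)) = w n ((t, vert false n), s)) ->
  (forall n t s, p n (r n (t, s)) = w n ((t, vert true n), s)) ->
  exists h : smap (sprod (sprod T unitI) unitI) X,
    [/\ forall n z, h n (z, vert e n) = b n z,
        forall n t s, h n ((t, vert false n), s) = l n (t, s),
        forall n t s, h n ((t, vert true n), s) = r n (t, s) &
        forall n z, p n (h n z) = w n z].
Proof.
move=> kp lb rb pb pl pr.
pose j0 n (z : sprod T (disc bool) n) : sprod T unitI n := (z.1, vert z.2 n).
have jn m n (d : delta m n) (z : sprod T (disc bool) n) : j0 m (sact d z) = sact d (j0 n z).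
  by congr pair; symmetry; apply: vert_act.
pose j : smap _ (sprod T unitI) := SMap jn.
have ij : inj j.
  move=> n [t s] [t' s'] e0; have /= e1 := congr1 fst e0; have /= e2 := congr1 snd e0.
  congr pair; first exact: e1.
  by case: s s' e2 {e0} => [] [] // e2; case: (@vert_neq n).
pose v0 n (z : sprod (sprod T (disc bool)) unitI n) : X n :=
  if z.1.2 then r n (z.1.1, z.2) else l n (z.1.1, z.2).
have vn m n (d : delta m n) z : v0 m (sact d z) = sact d (v0 n z).
  by case: z => [[t [|]] s]; rewrite /v0 -smap_nat.
have [|||h [hb hv ph]] := @homotopy_lifting e _ _ X Y p j kp ij b (SMap vn) w.
- by move=> n [t [|]] /=; rewrite /v0 /= ?lb ?rb.
- by [].
- by move=> n [t [|]] s /=; rewrite /v0 /= ?pl ?pr.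
exists h; split=> // n t s.
  exact: hv n (t, false) s.
exact: hv n (t, true) s.
Qed.

Lemma kan_bang (Z : sset) : kan_complex Z <-> kan_fibration (bang Z).
Proof.
split=> h n k.
- apply/lifts_has_lifting => u v _; have [g gu] := h n k u.
  exists g; split=> m a; last by case: (v m a).
  by rewrite -gu.
- move=> u; have /lifts_has_lifting := h n k.
  case/(_ u (bang _) (fun _ _ => erefl)) => g [gu _].
  by exists g; apply: smap_eq.
Qed.

Section Homotopic.
Variables (X Z : sset).
Hypothesis kZ : kan_complex Z.

Lemma homotopic_refl (f : smap X Z) : homotopic f f.
Proof. by exists (smap_comp f (smap_fst X unitI)). Qed.

(** An open box with three homotopies as sides. Constant homotopies on suitable sides turn it into
    symmetry and transitivity. *)
Let htr (f g f' g' : smap X Z) : homotopic f g -> homotopic f f' -> homotopic g g' -> homotopic f' g'.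
Proof.
move=> [b hb] [l hl] [r hr].
have [||||||h [_ hl' hr' _]] := @box_lifting false X Z pt (bang Z) (bang _) b l r.
- exact/kan_bang.
- by move=> n t; rewrite (hl n t).1 (hb n t).1.
- by move=> n t; rewrite (hr n t).1 (hb n t).2.
- by [].
- by [].
- by [].
exists (smap_comp h (at_end _ true)) => n x; split; rewrite at_end_comp.
  by rewrite hl' (hl n x).2.
by rewrite hr' (hr n x).2.
Qed.

Lemma homotopic_sym (f g : smap X Z) : homotopic f g -> homotopic g f.
Proof. by move=> h; apply: (htr (homotopic_refl f) h (homotopic_refl f)). Qed.

Lemma homotopic_trans (f g h : smap X Z) : homotopic f g -> homotopic g h -> homotopic f h.
Proof. by move=> fg gh; apply: (htr fg (homotopic_refl f) gh). Qed.
End Homotopic.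

Lemma homotopic_compr (X X' Z : sset) (f g : smap X Z) (a : smap X' X) :
  homotopic f g -> homotopic (smap_comp f a) (smap_comp g a).
Proof.
case=> H hH; exists (smap_comp H (sprod_map a (smap_id _))) => n x /=.
by rewrite (hH n _).1 (hH n _).2.
Qed.

Lemma homotopic_compl (X Z Z' : sset) (f g : smap X Z) (b : smap Z Z') :
  homotopic f g -> homotopic (smap_comp b f) (smap_comp b g).
Proof.
case=> H hH; exists (smap_comp b H) => n x /=.
by rewrite (hH n _).1 (hH n _).2.
Qed.

Definition mapping_eval (X Y : sset) n (f : mapping_space X Y n) :
  smap (sprod X (stdsimplex n)) Y := f.

Lemma scurry_nat (T X Y : sset) (h : smap (sprod T X) Y) n (t : T n) m q (d : delta m q)
    (z : sprod X (stdsimplex n) q) :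
  h m (sact (sact d z).2 t, (sact d z).1) = sact d (h q (sact z.2 t, z.1)).
Proof. by rewrite -smap_nat /= sact_comp. Qed.

Definition scurry (T X Y : sset) (h : smap (sprod T X) Y) : smap T (mapping_space X Y).
Proof.
apply: (@SMap T (mapping_space X Y) (fun n t => SMap (scurry_nat h t))).
by move=> m n d t; apply: smap_eq => q z /=; rewrite sact_comp.
Defined.

Lemma scurryE (T X Y : sset) (h : smap (sprod T X) Y) n t m z :
  mapping_eval (scurry h n t) m z = h m (sact z.2 t, z.1).
Proof. by []. Qed.

Definition suncurry (T X Y : sset) (g : smap T (mapping_space X Y)) : smap (sprod T X) Y.
Proof.
apply: (@SMap (sprod T X) Y (fun n z => (g n z.1 : smap _ _) n (z.2, did n))).
move=> m n d [t x] /=; rewrite smap_nat /= -smap_nat /=.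
by rewrite dcomp_idl dcomp_idr.
Defined.

Lemma scurryK (T X Y : sset) (h : smap (sprod T X) Y) : suncurry (scurry h) = h.
Proof. by apply: smap_eq => n [t x] /=; rewrite sact_id. Qed.

Lemma suncurry_scurry (T X Y : sset) (g : smap T (mapping_space X Y)) : scurry (suncurry g) = g.
Proof.
apply: smap_eq => n t; apply: smap_eq => m [x d] /=.
by rewrite smap_nat /= dcomp_idr.
Qed.

Definition sswap (X Y : sset) : smap (sprod X Y) (sprod Y X) :=
  smap_pair (smap_snd X Y) (smap_fst X Y).

(** By adjunction this is [horn_lifting] over the point. *)
Lemma mapping_space_precomp_kan (K L Z : sset) (j : smap K L) : kan_complex Z -> inj j ->
  kan_fibration (mapping_space_precomp Z j).
Proof.
move=> /kan_bang kZ ij n k; apply/lifts_has_lifting => u v uv.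
have [|||h [hu hv _]] := @horn_lifting K L Z pt (bang Z) j n k
    (smap_comp (suncurry v) (sswap _ _)) (smap_comp (suncurry u) (sswap _ _)) (bang _) kZ ij.
- move=> m c a /=; have := congr1 (fun f => mapping_eval f m (c, did m)) (uv m a).
  by move=> /= <-.
- by [].
- by [].
exists (scurry (smap_comp h (sswap _ _))); split.
- move=> m a; apply: smap_eq => q [l d] /=.
  rewrite -[dcomp _ _]/(val (sact d a)) hv /= smap_nat /=.
  by rewrite dcomp_idr.
- move=> m b; apply: smap_eq => q [c d] /=.
  rewrite hu /= -[dcomp b d]/(sact d (b : stdsimplex n.+1 m)) smap_nat /=.
  by rewrite dcomp_idr.
Qed.

Lemma svoid_inj (X : sset) : inj (svoid_map X).
Proof. by move=> n []. Qed.

Lemma mapping_space_kan (X Z : sset) : kan_complex Z -> kan_complex (mapping_space X Z).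
Proof.
move=> kZ n k u; have := @mapping_space_precomp_kan svoid X Z (svoid_map X) kZ (@svoid_inj X) n k.
move/lifts_has_lifting.
have z0 (Y : sset) : smap Y (mapping_space svoid Z).
  by apply: scurry; apply: (@SMap (sprod Y svoid) Z (fun n (x : sprod Y svoid n) => match x.2 with end)) => m q d [y []].
case/(_ u (z0 _))=> [m a|w [wu _]]; first by apply: smap_eq => q [[]].
by exists w; apply: smap_eq.
Qed.

Lemma smap_compA (X Y Z T : sset) (h : smap Z T) (g : smap Y Z) (f : smap X Y) :
  smap_comp h (smap_comp g f) = smap_comp (smap_comp h g) f.
Proof. exact: smap_eq. Qed.

Lemma smap_comp_id (X Y : sset) (f : smap X Y) : smap_comp f (smap_id X) = f.
Proof. exact: smap_eq. Qed.

Lemma pi0_bijP (X Y : sset) (q : smap X Y) : bijective (pi0_map q) <->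
  (forall y, exists x, connected (q 0 x) y) /\
  (forall x x', connected (q 0 x) (q 0 x') -> connected x x').
Proof.
split=> [[g gK Kg]|[sq iq]].
- split=> [y|x x' h].
    exists (pi0_repr (g (pi0_class y))); apply/pi0_classP.
    by rewrite -pi0_mapE pi0_reprK Kg.
  apply/pi0_classP; apply: (can_inj gK); rewrite !pi0_mapE; exact/pi0_classP.
- have ex (c : pi0 Y) : exists d : pi0 X, pi0_map q d = c.
    have [x h] := sq (pi0_repr c); exists (pi0_class x).
    by rewrite pi0_mapE -[RHS]pi0_reprK; apply/pi0_classP.
  pose g c := projT1 (cid (ex c)); have gP c : pi0_map q (g c) = c by rewrite /g; case: cid.
  exists g => // c; move: (g _) (gP (pi0_map q c)) => d.
  by rewrite -[d]pi0_reprK -[c]pi0_reprK !pi0_mapE => /pi0_classP/iq/pi0_classP.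
Qed.

Definition vertex_map (X Z : sset) (g : mapping_space X Z 0) : smap X Z :=
  smap_comp (mapping_eval g) (smap_pair (smap_id X) (const_map X (did 0 : stdsimplex 0 0))).

Definition map_vertex (X Z : sset) (f : smap X Z) : mapping_space X Z 0 :=
  smap_comp f (smap_fst X (stdsimplex 0)).

Lemma map_vertexK (X Z : sset) (f : smap X Z) : vertex_map (map_vertex f) = f.
Proof. exact: smap_eq. Qed.

Lemma delta0_eq m (d d' : delta m 0) : d = d'.
Proof. by apply: delta_inj => i; rewrite !ord1. Qed.

Lemma vertex_mapE (X Z : sset) (g : mapping_space X Z 0) n x d :
  mapping_eval g n (x, d) = vertex_map g n x.
Proof. by rewrite /vertex_map /=; congr (mapping_eval g n (x, _)); apply: delta0_eq. Qed.

Lemma edge_homotopic (X Z : sset) (g g' : mapping_space X Z 0) :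
  edge g g' <-> homotopic (vertex_map g) (vertex_map g').
Proof.
split=> [[e [<- <-]]|[H hH]].
- exists (mapping_eval e) => n x; split.
    rewrite /vertex_map /=; congr (mapping_eval e n (x, _)).
    by apply: delta_inj => i; rewrite dcompE !dcstE.
  rewrite /vertex_map /=; congr (mapping_eval e n (x, _)).
  by apply: delta_inj => i; rewrite dcompE !dcstE.
- exists H; split; apply: smap_eq => n [x d].
    rewrite -[RHS]/(mapping_eval g n (x, d)) vertex_mapE -(hH n x).1 /=.
    by congr (H n (x, _)); apply: delta_inj => i; rewrite dcompE !dcstE.
  rewrite -[RHS]/(mapping_eval g' n (x, d)) vertex_mapE -(hH n x).2 /=.
  by congr (H n (x, _)); apply: delta_inj => i; rewrite dcompE !dcstE.
Qed.

Lemma connected_homotopic (X Z : sset) (g g' : mapping_space X Z 0) : kan_complex Z ->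
  connected g g' <-> homotopic (vertex_map g) (vertex_map g').
Proof.
move=> kZ; split=> [|h]; last exact/rst_step/edge_homotopic.
elim=> {g g'} [g g' /edge_homotopic //|g|g g' _|g h k _ gh _ hk].
- exact: homotopic_refl.
- exact: homotopic_sym.
- exact: homotopic_trans gh hk.
Qed.

Notation weq := weak_homotopy_equivalence.

(** In a mapping space into a Kan complex, being connected means being homotopic. The definition
    thus becomes extension along [f] up to homotopy, with uniqueness up to homotopy. *)
Lemma weqP (X Y : sset) (f : smap X Y) : weq f <->
  forall Z, kan_complex Z ->
    (forall u : smap X Z, exists v : smap Y Z, homotopic (smap_comp v f) u) /\
    (forall v v' : smap Y Z, homotopic (smap_comp v f) (smap_comp v' f) -> homotopic v v').
Proof.
have pE Z g : vertex_map (mapping_space_precomp Z f 0 g) = smap_comp (vertex_map g) f.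
  by apply: smap_eq.
split=> h Z kZ.
- have /pi0_bijP[sf jf] := h Z kZ; split=> [u|v v' hv].
    have [g hg] := sf (map_vertex u); exists (vertex_map g).
    by rewrite -pE -(map_vertexK u); apply/connected_homotopic.
  rewrite -(map_vertexK v) -(map_vertexK v'); apply/connected_homotopic => //; apply: jf.
  by apply/connected_homotopic => //; rewrite !pE !map_vertexK.
- have [sf jf] := h Z kZ; apply/pi0_bijP; split=> [y|x x' /connected_homotopic hx].
    have [v hv] := sf (vertex_map y); exists (map_vertex v).
    by apply/connected_homotopic => //; rewrite pE map_vertexK.
  by apply/connected_homotopic => //; apply: jf; rewrite -!pE; apply: hx.
Qed.

Lemma weq_id (X : sset) : weq (smap_id X).
Proof.
apply/weqP => Z kZ; split=> [u|v v']; last by rewrite !smap_comp_id.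
by exists u; rewrite smap_comp_id; apply: homotopic_refl.
Qed.

Lemma weq_comp (X Y Z : sset) (g : smap Y Z) (f : smap X Y) :
  weq f -> weq g -> weq (smap_comp g f).
Proof.
move=> /weqP wf /weqP wg; apply/weqP => T kT.
have [sf jf] := wf T kT; have [sg jg] := wg T kT; split=> [u|v v'].
  have [v hv] := sf u; have [w hw] := sg v; exists w; rewrite smap_compA.
  exact: homotopic_trans (homotopic_compr f hw) hv.
by rewrite !smap_compA => /jf/jg.
Qed.

Lemma weq_2of3l (X Y Z : sset) (g : smap Y Z) (f : smap X Y) :
  weq f -> weq (smap_comp g f) -> weq g.
Proof.
move=> /weqP wf /weqP wg; apply/weqP => T kT.
have [sf jf] := wf T kT; have [sg jg] := wg T kT; split=> [u|v v' hv].
  have [v hv] := sg (smap_comp u f); exists v; apply: jf.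
  by rewrite -smap_compA.
by apply: jg; rewrite !smap_compA; apply: homotopic_compr.
Qed.

Lemma weq_2of3r (X Y Z : sset) (g : smap Y Z) (f : smap X Y) :
  weq g -> weq (smap_comp g f) -> weq f.
Proof.
move=> /weqP wf /weqP wg; apply/weqP => T kT.
have [sf jf] := wf T kT; have [sg jg] := wg T kT; split=> [u|v v' hv].
  have [v hv] := sg u; exists (smap_comp v g); by rewrite -smap_compA.
have [w hw] := sf v; have [w' hw'] := sf v'.
apply: (homotopic_trans kT (homotopic_sym kT hw)).
apply: (homotopic_trans kT _ hw'); apply: homotopic_compr; apply: jg.
rewrite !smap_compA; apply: (homotopic_trans kT (homotopic_compr f hw)).
exact: (homotopic_trans kT hv (homotopic_sym kT (homotopic_compr f hw'))).
Qed.

(** Surjectivity on homotopy classes comes from [h g], injectivity from [g f]. *)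
Lemma weq_2of6 (X Y Z T : sset) (h : smap Z T) (g : smap Y Z) (f : smap X Y) :
  weq (smap_comp g f) -> weq (smap_comp h g) -> weq g.
Proof.
move=> /weqP gf /weqP hg; apply/weqP => S kS.
have [sf jf] := gf S kS; have [sg jg] := hg S kS; split=> [u|v v' hv].
  by have [v hv] := sg u; exists (smap_comp v h); rewrite -smap_compA.
by apply: jf; rewrite !smap_compA; apply: homotopic_compr.
Qed.

Lemma weq_eq (X Y : sset) (f g : smap X Y) : (forall n x, f n x = g n x) -> weq f -> weq g.
Proof. by move=> /smap_eq ->. Qed.

Lemma weq_retract (X Y X' Y' : sset) (f : smap X Y) (g : smap X' Y')
    (s : smap X X') (r : smap X' X) (s' : smap Y Y') (r' : smap Y' Y) :
  (forall n x, r n (s n x) = x) -> (forall n y, r' n (s' n y) = y) ->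
  (forall n x, s' n (f n x) = g n (s n x)) -> (forall n x, r' n (g n x) = f n (r n x)) ->
  weq g -> weq f.
Proof.
move=> rs rs' sf rg /weqP wg; apply/weqP => Z kZ; have [sg jg] := wg Z kZ.
have rs'K (v : smap Y Z) : smap_comp (smap_comp v r') s' = v.
  by apply: smap_eq => n y /=; rewrite rs'.
have rK (v : smap Y Z) : smap_comp (smap_comp v r') g = smap_comp (smap_comp v f) r.
  by apply: smap_eq => n y /=; rewrite rg.
split=> [u|v v' hv].
  have [v hv] := sg (smap_comp u r); exists (smap_comp v s').
  have -> : smap_comp (smap_comp v s') f = smap_comp (smap_comp v g) s.
    by apply: smap_eq => n x /=; rewrite sf.
  have -> : u = smap_comp (smap_comp u r) s by apply: smap_eq => n x /=; rewrite rs.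
  exact: homotopic_compr.
rewrite -(rs'K v) -(rs'K v'); apply: homotopic_compr; apply: jg.
by rewrite !rK; apply: homotopic_compr.
Qed.

(** Homotopy need not be symmetric or transitive when the target is not a Kan complex. The generated
    relation is enough, as it becomes homotopy after any map to a Kan complex. *)
Definition hrel (X Y : sset) := clos_refl_sym_trans (smap X Y) (@homotopic X Y).

Lemma hrel_kan (X Y Z : sset) (f g : smap X Y) (u : smap Y Z) :
  kan_complex Z -> hrel f g -> homotopic (smap_comp u f) (smap_comp u g).
Proof.
move=> kZ; elim=> {f g} [f g|f|f g _|f g h _ fg _ gh].
- exact: homotopic_compl.
- exact: homotopic_refl.
- exact: homotopic_sym.
- exact: homotopic_trans fg gh.
Qed.

Lemma hequiv_weq (X Y : sset) (f : smap X Y) (g : smap Y X) :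
  hrel (smap_comp g f) (smap_id X) -> hrel (smap_comp f g) (smap_id Y) -> weq f.
Proof.
move=> gf fg; apply/weqP => Z kZ; split=> [u|v v' hv].
  by exists (smap_comp u g); rewrite -smap_compA -[X in homotopic _ X]smap_comp_id; apply: hrel_kan.
have H (w : smap Y Z) : homotopic w (smap_comp (smap_comp w f) g).
  by rewrite -smap_compA -{1}[w]smap_comp_id; apply/homotopic_sym/hrel_kan.
apply: (homotopic_trans kZ (H v)).
apply: (homotopic_trans kZ _ (homotopic_sym kZ (H v'))).
exact: homotopic_compr.
Qed.

Lemma iso_weq (X Y : sset) (f : smap X Y) (g : smap Y X) :
  (forall n x, g n (f n x) = x) -> (forall n y, f n (g n y) = y) -> weq f.
Proof.
move=> gf fg; apply: (@hequiv_weq _ _ f g).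
  by rewrite (_ : smap_comp g f = smap_id _); [apply: rst_refl|apply: smap_eq].
by rewrite (_ : smap_comp f g = smap_id _); [apply: rst_refl|apply: smap_eq].
Qed.

Lemma bij_weq (X Y : sset) (f : smap X Y) :
  inj f -> (forall n y, exists x, f n x = y) -> weq f.
Proof.
move=> jf sf.
have [g gP] : exists g : smap Y X, forall n y, f n (g n y) = y.
  apply: (@ex_smap Y X (fun n y x => f n x = y)) => //.
    by move=> n y x x' <- /jf.
  by move=> m n d y x <-; rewrite smap_nat.
by apply: (@iso_weq _ _ f g) => // n x; apply: jf; rewrite gP.
Qed.

Definition homotopy_swap (X K : sset) : smap (sprod (sprod X K) unitI) (sprod (sprod X unitI) K).
Proof.
by apply: (@SMap (sprod (sprod X K) unitI) (sprod (sprod X unitI) K)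
  (fun n z => ((z.1.1, z.2), z.1.2))).
Defined.

Definition homotopy_unswap (X K : sset) : smap (sprod (sprod X unitI) K) (sprod (sprod X K) unitI).
Proof.
by apply: (@SMap (sprod (sprod X unitI) K) (sprod (sprod X K) unitI)
  (fun n z => ((z.1.1, z.2), z.1.2))).
Defined.

Lemma homotopic_scurry (X K Z : sset) (f g : smap (sprod X K) Z) :
  homotopic f g <-> homotopic (scurry f) (scurry g).
Proof.
split=> [[H hH]|[H hH]].
- exists (scurry (smap_comp H (homotopy_unswap _ _))) => n x.
  split; apply: smap_eq => m [k d] /=.
    by rewrite [dcomp _ _](vert_act false d) (hH _ _).1.
  by rewrite [dcomp _ _](vert_act true d) (hH _ _).2.
- exists (smap_comp (suncurry H) (homotopy_swap _ _)) => n [x k]; split.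
    rewrite [LHS](_ : _ = mapping_eval (H n (x, vert false n)) n (k, did n)) //.
    by rewrite (hH n x).1 /= sact_id.
  rewrite [LHS](_ : _ = mapping_eval (H n (x, vert true n)) n (k, did n)) //.
  by rewrite (hH n x).2 /= sact_id.
Qed.

Lemma scurry_comp (X Y K Z : sset) (f : smap X Y) (v : smap (sprod Y K) Z) :
  scurry (smap_comp v (sprod_map f (smap_id K))) = smap_comp (scurry v) f.
Proof.
apply: smap_eq => n x; apply: smap_eq => m [k d].
by rewrite scurryE /= smap_nat.
Qed.

(** Maps from a product with [K] into [Z] are maps into the mapping space from [K] to [Z], which is
    again a Kan complex. *)
Lemma weq_prodr (X Y K : sset) (f : smap X Y) : weq f -> weq (sprod_map f (smap_id K)).
Proof.
move=> /weqP wf; apply/weqP => Z kZ.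
have [sf jf] := wf _ (mapping_space_kan (X := K) kZ); split=> [u|v v'].
  have [v hv] := sf (scurry u); exists (suncurry v).
  by apply/homotopic_scurry; rewrite scurry_comp suncurry_scurry.
by move/homotopic_scurry; rewrite !scurry_comp => /jf/homotopic_scurry.
Qed.

Lemma weq_prodl (X Y K : sset) (f : smap X Y) : weq f -> weq (sprod_map (smap_id K) f).
Proof.
move/(weq_prodr K) => w.
have sw (A B : sset) : weq (sswap A B).
  by apply: (@iso_weq _ _ _ (sswap B A)) => n [a b].
apply: (weq_2of3l (sw X K)).
apply: (@weq_eq _ _ (smap_comp (sswap Y K) (sprod_map f (smap_id K)))) => //.
exact: weq_comp w (sw _ _).
Qed.

Lemma weq_prod (X Y X' Y' : sset) (f : smap X Y) (g : smap X' Y') :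
  weq f -> weq g -> weq (sprod_map f g).
Proof.
move=> /(weq_prodr X') wf /(weq_prodl Y) wg.
exact: weq_eq (weq_comp wf wg).
Qed.

(** * Trivial fibrations and trivial cofibrations *)

Definition trivial_fib (X Y : sset) (p : smap X Y) :=
  forall (A B : sset) (i : smap A B), inj i -> lifts i p.

Lemma trivial_fib_kan (X Y : sset) (p : smap X Y) : trivial_fib p -> kan_fibration p.
Proof.
move=> tp n k; apply/lifts_has_lifting/tp => m a b; exact: val_inj.
Qed.

Lemma trivial_fib_section (X Y : sset) (p : smap X Y) : trivial_fib p ->
  exists s : smap Y X, forall n y, p n (s n y) = y.
Proof.
move=> tp; have [|s [_ ps]] := tp _ _ _ (@svoid_inj Y) (svoid_map X) (smap_id Y).
  by move=> n [].
by exists s.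
Qed.

Definition two_ends (X : sset) : smap (sprod X (disc bool)) (sprod X unitI).
Proof.
apply: (@SMap (sprod X (disc bool)) (sprod X unitI) (fun n z => (z.1, vert z.2 n))).
by move=> m n d z; congr pair; symmetry; apply: vert_act.
Defined.

Lemma two_ends_inj (X : sset) : inj (two_ends X).
Proof.
move=> n [t s] [t' s'] e0; have /= e1 := congr1 fst e0; have /= e2 := congr1 snd e0.
congr pair; first exact: e1.
by case: s s' e2 {e0} => [] [] // e2; case: (@vert_neq n).
Qed.

Definition two_maps (X Y : sset) (f g : smap X Y) : smap (sprod X (disc bool)) Y.
Proof.
apply: (@SMap (sprod X (disc bool)) Y (fun n z => if z.2 then g n z.1 else f n z.1)).
by move=> m n d [x [|]] /=; rewrite smap_nat.
Defined.

Lemma trivial_fib_homotopy (X Y T : sset) (p : smap X Y) (f g : smap T X) : trivial_fib p ->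
  (forall n t, p n (f n t) = p n (g n t)) ->
  exists H, homotopy f g H /\ forall n t s, p n (H n (t, s)) = p n (f n t).
Proof.
move=> tp fg.
have [|H [hH pH]] := tp _ _ _ (@two_ends_inj T) (two_maps f g)
    (smap_comp p (smap_comp f (smap_fst _ _))).
  by move=> n [t [|]] /=.
exists H; split=> [n x|n t s]; last by rewrite pH.
by rewrite (hH n (x, false)) (hH n (x, true)).
Qed.

Lemma trivial_fib_weq (X Y : sset) (p : smap X Y) : trivial_fib p -> weq p.
Proof.
move=> tp; have [s ps] := trivial_fib_section tp.
apply: (@hequiv_weq _ _ p s).
  have [|H [hH _]] := @trivial_fib_homotopy _ _ _ p (smap_comp s p) (smap_id X) tp.
    by move=> n x /=; rewrite ps.
  by apply: rst_step; exists H.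
by rewrite (_ : smap_comp p s = smap_id _); [apply: rst_refl|apply: smap_eq].
Qed.

(** The homotopy [g] need not be fibrewise. A box with sides [s q g] and [g], lying over [q g],
    replaces it by a homotopy [g'] from [s q] to the identity that is constant over [U]. Homotopy
    lifting then moves [s v] to a lift that agrees with [u] along [i]. *)
Lemma shrinkable_trivial_fib (V U : sset) (q : smap V U) (s : smap U V)
    (g : smap (sprod V unitI) V) :
  kan_fibration q -> (forall n u, q n (s n u) = u) ->
  homotopy (smap_comp s q) (smap_id V) g -> trivial_fib q.
Proof.
move=> kq qs hg.
have [|||||h [hb hl hr ph]] := @box_lifting false V V U q
    (smap_comp (smap_comp q g) (smap_pair (smap_comp (smap_fst _ _) (smap_fst _ _)) (smap_snd _ _)))
    (smap_comp (smap_comp s q) (smap_fst _ _)) (smap_comp (smap_comp s q) g) g kq.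
- by move=> n v /=; rewrite (hg n v).1 /= qs.
- by move=> n v; rewrite (hg n v).1.
- by move=> n [v t] /=; rewrite (hg n v).1 /=.
- by move=> n v t /=; rewrite qs.
- by [].
have [g' [hg' qg']] : exists g', homotopy (smap_comp s q) (smap_id V) g' /\
    forall n v t, q n (g' n (v, t)) = q n v.
  exists (smap_comp h (at_end _ true)); split=> [n v|n v t]; rewrite !at_end_comp.
    by rewrite hl hr /= (hg n v).2.
  by rewrite ph /= (hg n v).2.
move=> A B i ii u v uv.
have [|||k [kb kl pk]] := @homotopy_lifting false A B V U q i kq ii (smap_comp s v)
    (smap_comp g' (sprod_map u (smap_id _))) (smap_comp v (smap_fst _ _)).
- by move=> n a /=; rewrite (hg' n _).1 /= uv.
- by move=> n b /=; rewrite qs.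
- by move=> n a t /=; rewrite qg' uv.
exists (smap_comp k (at_end _ true)); split=> n b; rewrite at_end_comp.
  by rewrite kl /= (hg' n _).2.
by rewrite pk.
Qed.

(** In adjoint form: restriction along [f] is a trivial fibration between mapping spaces into any
    Kan complex. The extensions are strict, so they can be glued over pushouts and unions. *)
Definition trivial_cof (X Y : sset) (f : smap X Y) :=
  inj f /\ forall Z, kan_complex Z -> forall (A B : sset) (i : smap A B), inj i ->
  forall (u : smap (sprod X B) Z) (v : smap (sprod Y A) Z),
  (forall n x a, u n (x, i n a) = v n (f n x, a)) ->
  exists h : smap (sprod Y B) Z, (forall n x b, h n (f n x, b) = u n (x, b)) /\
                                 (forall n y a, h n (y, i n a) = v n (y, a)).

(** Products with an arbitrary [T] show that the restriction [q] between mapping spaces is bijective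
    on homotopy classes of maps from [T]. Hence [q] has a homotopy inverse, which homotopy lifting
    corrects to a strict section, and [shrinkable_trivial_fib] applies. *)
Lemma weq_trivial_cof (X Y : sset) (f : smap X Y) : inj f -> weq f -> trivial_cof f.
Proof.
move=> jf wf; split=> // Z kZ.
have kV := mapping_space_kan (X := Y) kZ; have kU := mapping_space_kan (X := X) kZ.
pose q := mapping_space_precomp Z f.
have kq : kan_fibration q by apply: mapping_space_precomp_kan.
have transp (T : sset) (a : smap T (mapping_space Y Z)) :
    smap_comp (suncurry a) (sprod_map (smap_id T) f) = suncurry (smap_comp q a).
  by apply: smap_eq.
have bijT (T : sset) : (forall u : smap T (mapping_space X Z), exists v, homotopic (smap_comp q v) u) /\
    (forall v v' : smap T (mapping_space Y Z), homotopic (smap_comp q v) (smap_comp q v') -> homotopic v v').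
  have /weqP/(_ Z kZ)[sf if_] := weq_prodl T wf; split=> [u|v v' hv].
    have [v hv] := sf (suncurry u); exists (scurry v).
    by rewrite -[smap_comp q _]suncurry_scurry -transp scurryK -[u]suncurry_scurry; apply/homotopic_scurry.
  rewrite -[v]suncurry_scurry -[v']suncurry_scurry; apply/homotopic_scurry/if_.
  by rewrite !transp; apply/homotopic_scurry; rewrite !suncurry_scurry.
have [r [R hR]] := (bijT (mapping_space X Z)).1 (smap_id _).
have [|||h [hr _ qh]] := @homotopy_lifting false svoid _ _ _ q (svoid_map _) kq (@svoid_inj _) r
    (smap_comp (svoid_map _) (smap_fst svoid unitI)) R.
- by move=> n [].
- by move=> n u; rewrite (hR n u).1.
- by move=> n [].
pose s := smap_comp h (at_end _ true).
have qs n u : q n (s n u) = u by rewrite at_end_comp qh (hR n u).2.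
have [|g hg] := (bijT (mapping_space Y Z)).2 (smap_comp s q) (smap_id _).
  rewrite (_ : smap_comp q (smap_comp s q) = smap_comp q (smap_id _)).
    exact: homotopic_refl.
  by apply: smap_eq => n y; rewrite -[LHS]/(q n (s n (q n y))) qs.
have tq := shrinkable_trivial_fib kq qs hg.
move=> A B i ii u v uv.
have [|w [wi qw]] := tq A B i ii (scurry (smap_comp v (sswap _ _))) (scurry (smap_comp u (sswap _ _))).
  move=> n a; apply: smap_eq => m [x d]; rewrite -[LHS]/(v m (f m x, sact d a)) scurryE /=.
  by rewrite -smap_nat uv.
exists (smap_comp (suncurry w) (sswap _ _)); split=> [n x b|n y a].
  have := congr1 (fun g => mapping_eval g n (x, did n)) (qw n b).
  by rewrite -[RHS]/(u n (x, sact (did n) b)) sact_id.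
by rewrite /= wi /= sact_id.
Qed.

(** The two clauses of [weqP] are the extension property for the empty subobject of a point and for
    the ends of an interval. *)
Lemma trivial_cof_weq (X Y : sset) (f : smap X Y) : trivial_cof f -> weq f.
Proof.
move=> [jf tf]; apply/weqP => Z kZ; split=> [u|v v' [H hH]].
- have [|h [hf _]] := tf Z kZ svoid pt (svoid_map pt) (@svoid_inj pt)
      (smap_comp u (smap_fst _ _)) (smap_comp (svoid_map _) (smap_snd Y svoid)).
    by move=> n x [].
  exists (smap_comp h (smap_pair (smap_id Y) (bang Y))).
  rewrite (_ : smap_comp _ f = u); first exact: homotopic_refl.
  by apply: smap_eq => n x; rewrite /= hf.
- have [|h [_ hv]] := tf Z kZ (sprod pt (disc bool)) (sprod pt unitI) (two_ends pt) (@two_ends_inj pt)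
      (smap_comp H (sprod_map (smap_id X) (smap_snd pt unitI)))
      (smap_comp (two_maps v v') (sprod_map (smap_id Y) (smap_snd pt (disc bool)))).
    by move=> n x [tt [|]] /=; rewrite ?(hH n x).1 ?(hH n x).2.
  exists (smap_comp h (smap_pair (smap_fst _ _) (smap_pair (bang _) (smap_snd _ _)))) => n y.
  by split; [apply: (hv n y (tt, false))|apply: (hv n y (tt, true))].
Qed.

(** * Cylinders and gluing *)

(** A pushout along an injection in terms of simplices: [C] embeds in [D], and the complement of [A]
    in [B] maps bijectively to the complement of [C]. Products and base changes preserve this form
    by inspection. *)
Record mpush (A B C D : sset) (i : smap A B) (f : smap A C) (g : smap B D) (j : smap C D) : Prop :=
  Mpush {
  mpush_inj : inj i;
  mpush_injr : inj j;
  mpush_comm : forall n a, g n (i n a) = j n (f n a);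
  mpush_cover : forall n d, (exists c, j n c = d) \/ (exists b, g n b = d);
  mpush_sep : forall n b b', g n b = g n b' -> b = b' \/ exists a, i n a = b;
  mpush_meet : forall n b c, g n b = j n c -> exists a, i n a = b }.

Lemma mpush_desc (A B C D Z : sset) (i : smap A B) (f : smap A C) (g : smap B D) (j : smap C D)
    (u : smap B Z) (v : smap C Z) : mpush i f g j ->
  (forall n a, u n (i n a) = v n (f n a)) ->
  exists w : smap D Z, (forall n b, w n (g n b) = u n b) /\ (forall n c, w n (j n c) = v n c).
Proof.
move=> [ii ij cm cv sp mt] uv.
have gb n b b' : g n b = g n b' -> u n b = u n b'.
  move=> e; have [->//|[a ab]] := sp _ _ _ e.
  have e' : g n b' = j n (f n a) by rewrite -e -ab cm.
  have [a' ab'] := mt _ _ _ e'; rewrite -ab -ab' !uv; congr (v n _).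
  by apply: ij; rewrite -!cm ab ab'.
have gc n b c : g n b = j n c -> u n b = v n c.
  move=> e; have [a ab] := mt _ _ _ e; rewrite -ab uv; congr (v n _).
  by apply: ij; rewrite -cm ab.
have [w wP] : exists w : smap D Z, forall n d,
    (exists c, j n c = d /\ w n d = v n c) \/ (exists b, g n b = d /\ w n d = u n b).
  apply: (@ex_smap D Z (fun n d z => (exists c, j n c = d /\ z = v n c) \/ (exists b, g n b = d /\ z = u n b))).
  - move=> n d; have [[c <-]|[b <-]] := cv n d; first by exists (v n c); left; exists c.
    by exists (u n b); right; exists b.
  - move=> n d z z' [[c [<- ->]]|[b [<- ->]]] [[c' [e ->]]|[b' [e ->]]].
    + by rewrite (ij _ _ _ e).
    + by symmetry; apply: gc.
    + exact: gc.
    + exact: gb.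
  - move=> m n d x z [[c [<- ->]]|[b [<- ->]]].
      by left; exists (sact d c); rewrite !smap_nat.
    by right; exists (sact d b); rewrite !smap_nat.
exists w; split=> n b.
  by have [[c [e ->]]|[b' [e ->]]] := wP n (g n b); [symmetry; apply: gc|apply: gb].
have [[c [e ->]]|[b' [e ->]]] := wP n (j n b); first by rewrite (ij _ _ _ e).
exact: gc.
Qed.

Lemma mpush_prodr (A B C D K : sset) (i : smap A B) (f : smap A C) (g : smap B D) (j : smap C D) :
  mpush i f g j -> mpush (sprod_map i (smap_id K)) (sprod_map f (smap_id K))
                         (sprod_map g (smap_id K)) (sprod_map j (smap_id K)).
Proof.
move=> [ii ij cm cv sp mt]; split.
- by move=> n [a k] [a' k'] /= [/ii -> ->].
- by move=> n [a k] [a' k'] /= [/ij -> ->].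
- by move=> n [a k] /=; rewrite cm.
- move=> n [d k]; have [[c <-]|[b <-]] := cv n d; first by left; exists (c, k).
  by right; exists (b, k).
- move=> n [b k] [b' k'] /= [/sp[->|[a <-]] <-]; first by left.
  by right; exists (a, k).
- by move=> n [b k] [c k'] /= [/mt[a <-] _]; exists (a, k).
Qed.

Lemma trivial_cof_mpush (A B C D : sset) (i : smap A B) (f : smap A C) (g : smap B D) (j : smap C D) :
  mpush i f g j -> trivial_cof i -> trivial_cof j.
Proof.
move=> mp [ii ti]; split; first exact: mpush_injr mp.
move=> Z kZ S T k ik u v uv.
have [|h [hu hv]] := ti Z kZ S T k ik (smap_comp u (sprod_map f (smap_id T)))
    (smap_comp v (sprod_map g (smap_id S))).
  by move=> n a s /=; rewrite uv (mpush_comm mp).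
have [|w [wh wu]] := @mpush_desc _ _ _ _ Z _ _ _ _ h u (mpush_prodr T mp).
  by move=> n [a t]; rewrite /= hu.
exists w; split=> [n c t|n d s]; first exact: (wu n (c, t)).
have [[c <-]|[b <-]] := mpush_cover mp d.
  by rewrite (wu n (c, k n s)) uv.
by rewrite (wh n (b, k n s)) hv.
Qed.

Section Cylinder.
Variables (X Y : sset) (f : smap X Y).

(** The mapping cylinder: the end [true] of the cylinder on [X] is replaced by [Y]. As a disjoint
    sum it decides for each simplex whether it lies in [Y]. *)
Definition cyl_simp n : Type := (Y n + {z : X n * unitI n | z.2 <> vert true n})%type.

Definition cyl_in_fun n (z : X n * unitI n) : cyl_simp n :=
  match pselect (z.2 = vert true n) with
  | left _ => inl (f n z.1)
  | right h => inr (exist _ z h)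
  end.

Lemma cyl_in_true n (z : X n * unitI n) : z.2 = vert true n -> cyl_in_fun z = inl (f n z.1).
Proof. by move=> e; rewrite /cyl_in_fun; case: pselect. Qed.

Lemma cyl_in_neq n (z : X n * unitI n) (h : z.2 <> vert true n) :
  cyl_in_fun z = inr (exist _ z h).
Proof.
by rewrite /cyl_in_fun; case: pselect => // h'; congr (inr (exist _ _ _)); apply: Prop_irrelevance.
Qed.

Definition cyl_act m n (d : delta m n) (z : cyl_simp n) : cyl_simp m :=
  match z with
  | inl y => inl (sact d y)
  | inr z => cyl_in_fun (sact d (proj1_sig z : sprod X unitI n))
  end.

Lemma cyl_act_in m n (d : delta m n) (z : sprod X unitI n) :
  cyl_act d (cyl_in_fun z) = cyl_in_fun (sact d z).
Proof.
have [e|ne] := pselect (z.2 = vert true n); last by rewrite (cyl_in_neq ne).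
rewrite (cyl_in_true e) [RHS]cyl_in_true /= ?smap_nat //.
by rewrite e; apply: vert_act.
Qed.

Definition cyl : sset.
Proof.
apply: (@SSet cyl_simp cyl_act).
- move=> n [y|[z h]] /=; first by rewrite sact_id.
  rewrite (_ : (_, _) = z) ?(cyl_in_neq h) //.
  by case: z {h} => x t /=; rewrite sact_id dcomp_idr.
- move=> m n p g d [y|z]; first by rewrite /= sact_comp.
  rewrite -[RHS]/(cyl_act d (cyl_in_fun (sact g (proj1_sig z : sprod X unitI p)))).
  by rewrite cyl_act_in -sact_comp.
Defined.

Definition cyl_in : smap (sprod X unitI) cyl :=
  @SMap (sprod X unitI) cyl cyl_in_fun (fun m n d z => esym (cyl_act_in d z)).

Definition cyl_base : smap Y cyl := @SMap Y cyl (fun n y => inl y) (fun _ _ _ _ => erefl).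

Definition cyl_top : smap X cyl := smap_comp cyl_in (at_end X false).

Lemma vert_ft n : vert false n <> vert true n.
Proof. by move=> e; apply: (@vert_neq n). Qed.

Lemma cyl_topE n (x : X n) :
  cyl_top n x = inr (exist (fun z : X n * unitI n => z.2 <> vert true n) (x, vert false n) (@vert_ft n)).
Proof. by rewrite at_end_comp; apply: cyl_in_neq. Qed.

Lemma cyl_top_inj : inj cyl_top.
Proof. by move=> n x y; rewrite !cyl_topE => -[]. Qed.

Lemma cyl_base_mpush : mpush (at_end X true) f cyl_in cyl_base.
Proof.
split.
- by move=> n x y [].
- by move=> n x y [].
- by move=> n x; rewrite at_endE; apply: cyl_in_true.
- move=> n [y|[z h]]; first by left; exists y.
  by right; exists z; apply: cyl_in_neq.
- move=> n z z'.
  have [e|ne] := pselect (z.2 = vert true n).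
    by right; exists z.1; rewrite at_endE -e; case: (z).
  rewrite [LHS](cyl_in_neq ne); have [e'|ne'] := pselect (z'.2 = vert true n).
    by rewrite [RHS](cyl_in_true e').
  by rewrite [RHS](cyl_in_neq ne') => -[]; left.
- move=> n z y; have [e|ne] := pselect (z.2 = vert true n).
    by exists z.1; rewrite at_endE -e; case: (z).
  by rewrite [LHS](cyl_in_neq ne).
Qed.

Lemma at_end_weq (e : bool) (T : sset) : weq (at_end T e).
Proof.
apply: (@hequiv_weq _ _ _ (smap_fst T unitI)).
  by rewrite (_ : smap_comp _ _ = smap_id _); [apply: rst_refl|apply: smap_eq].
(* With [n] equal to 0, [rtr] is the contraction of the interval to its end [e]. *)
pose k : 'I_2 := if e then ord_max else ord0.
have kE n (t : unitI n) : rtr e k (t, vert e n) = vert e n.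
  apply: delta_inj => i; rewrite rtrE !dcstE /rtr_fun eqxx /k.
  by rewrite [dval t i]ord2E; case: (e); case: (_ == _).
pose r n (z : sprod (sprod T unitI) unitI n) : sprod T unitI n := (z.1.1, rtr e k (z.1.2, z.2)).
have rn m n (d : delta m n) z : r m (sact d z) = sact d (r n z).
  by congr pair; exact: (rtr_nat e k d (z.1.2, z.2)).
have he : forall n z, SMap rn n (z, vert e n) = smap_comp (at_end T e) (smap_fst T unitI) n z.
  move=> n [x t]; rewrite -[RHS]/(at_end T e n x) at_endE /= /r /=; congr pair; exact: kE.
have hi : forall n z, SMap rn n (z, vert (~~ e) n) = z.
  by move=> n [x t]; rewrite /= /r /= rtr_id.
case: (e) he hi => he hi.
  by apply/rst_sym/rst_step; exists (SMap rn) => n z; rewrite he hi.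
by apply/rst_step; exists (SMap rn) => n z; rewrite he hi.
Qed.

Lemma cyl_base_weq : weq cyl_base.
Proof.
apply/trivial_cof_weq/(trivial_cof_mpush cyl_base_mpush)/weq_trivial_cof; last exact: at_end_weq.
by move=> n x y [].
Qed.

(** The projection [p] of the cylinder to [Y] is a weak equivalence, and it carries [cyl_top] to
    [f]. *)
Lemma cyl_top_weq : weq f <-> weq cyl_top.
Proof.
have [|p [pi pb]] := @mpush_desc _ _ _ _ Y _ _ _ _ (smap_comp f (smap_fst X unitI)) (smap_id Y) cyl_base_mpush.
  by [].
have wp : weq p.
  apply: weq_2of3l cyl_base_weq _; apply: weq_eq (weq_id Y) => n y; exact: esym (pb n y).
have pf n x : f n x = smap_comp p cyl_top n x.
  by rewrite -[RHS]/(p n (cyl_top n x)) at_end_comp pi.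
split=> w; first by apply: weq_2of3r wp _; apply: weq_eq pf w.
by apply: weq_eq (weq_comp w wp) => n x; rewrite pf.
Qed.

End Cylinder.

Lemma cyl_top_trivial_cof (X Y : sset) (f : smap X Y) : weq f -> trivial_cof (cyl_top f).
Proof. by move=> w; apply: weq_trivial_cof; [apply: cyl_top_inj|apply: (cyl_top_weq f).1]. Qed.

Section CylMap.
Variables (X Y X' Y' : sset) (f : smap X Y) (f' : smap X' Y') (p : smap X X') (q : smap Y Y').
Hypothesis sq : forall n x, q n (f n x) = f' n (p n x).

Definition cyl_map_fun n (z : cyl f n) : cyl f' n :=
  match z with
  | inl y => inl (q n y)
  | inr z => inr (exist (fun z : X' n * unitI n => z.2 <> vert true n)
                        (p n (proj1_sig z).1, (proj1_sig z).2) (proj2_sig z))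
  end.

Lemma cyl_map_in n (z : sprod X unitI n) :
  cyl_map_fun (cyl_in f n z) = cyl_in f' n (p n z.1, z.2).
Proof.
have [e|ne] := pselect (z.2 = vert true n).
  by rewrite -[cyl_in f n z]/(cyl_in_fun f z) (cyl_in_true _ e) /= cyl_in_true // sq.
rewrite -[cyl_in f n z]/(cyl_in_fun f z) (cyl_in_neq _ ne) /=.
by symmetry; exact: (@cyl_in_neq _ _ f' n (p n z.1, z.2) ne).
Qed.

Lemma cyl_map_nat m n (d : delta m n) z : cyl_map_fun (sact d z) = sact d (cyl_map_fun z : cyl f' n).
Proof.
case: z => [y|[z h]]; first by rewrite /= smap_nat.
have -> : sact d (inr (exist _ z h) : cyl f n) = cyl_in f m (sact d (z : sprod X unitI n)) by [].
rewrite cyl_map_in -[RHS]/(cyl_in f' m (sact d ((p n z.1, z.2) : sprod X' unitI n))).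
by rewrite /= smap_nat.
Qed.

Definition cyl_map : smap (cyl f) (cyl f') := SMap cyl_map_nat.

Lemma cyl_map_top n x : cyl_map n (cyl_top f n x) = cyl_top f' n (p n x).
Proof. by rewrite -[LHS]/(cyl_map_fun (cyl_top f n x)) !at_end_comp cyl_map_in. Qed.

Lemma cyl_map_inj : inj p -> inj q -> inj cyl_map.
Proof.
move=> ip iq n [y|[[x t] h]] [y'|[[x' t'] h']] //=; first by case=> /iq ->.
by case=> /ip ex et; congr inr; apply: eq_exist; rewrite ex et.
Qed.

(* The union of the source of [f'] with the cylinder of [f], inside the cylinder of [f']. *)
Definition cyl_union : subc (cyl f').
Proof.
apply: (@Subc (cyl f') (fun n z => (exists x, cyl_top f' n x = z) \/ exists z', cyl_map n z' = z)).
move=> m n d z [[x <-]|[z' <-]]; first by left; exists (sact d x); rewrite smap_nat.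
by right; exists (sact d z'); rewrite smap_nat.
Defined.

Definition cyl_union_top : smap X' (ssub cyl_union) :=
  scorestr (fun n x => or_introl (ex_intro _ x erefl) : cyl_union n (cyl_top f' n x)).
Definition cyl_union_map : smap (cyl f) (ssub cyl_union) :=
  scorestr (fun n z => or_intror (ex_intro _ z erefl) : cyl_union n (cyl_map n z)).

Hypotheses (ip : inj p) (iq : inj q).

Lemma cyl_union_mpush : mpush (cyl_top f) p cyl_union_map cyl_union_top.
Proof.
split.
- exact: cyl_top_inj.
- by move=> n x y [] /cyl_top_inj.
- by move=> n x; apply: eq_exist; rewrite cyl_map_top.
- move=> n [z [[x e]|[z' e]]]; first by left; exists x; apply: eq_exist.
  by right; exists z'; apply: eq_exist.
- by move=> n z z' [] /(cyl_map_inj ip iq); left.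
- move=> n z x e0; have {e0} : cyl_map n z = cyl_top f' n x := congr1 (@proj1_sig _ _) e0.
  rewrite cyl_topE; case: z => [//|[[a t] h]] /= [ea et]; exists a; apply: etrans (cyl_topE f a) _; congr inr.
  by apply: eq_exist; rewrite et.
Qed.

Hypothesis wf : weq f.

Lemma cyl_union_top_trivial_cof : trivial_cof cyl_union_top.
Proof. exact: trivial_cof_mpush cyl_union_mpush (cyl_top_trivial_cof wf). Qed.

(** The source of [f'] includes in the union by a pushout of the top of the cylinder of [f], and in
    the whole cylinder by the top of the cylinder of [f']. Two-out-of-three gives the remaining
    inclusion. *)
Lemma cyl_union_trivial_cof : weq f' -> trivial_cof (sincl cyl_union).
Proof.
move=> /(cyl_top_weq f').1 wf'; apply: weq_trivial_cof; first exact: sincl_inj.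
apply: weq_2of3l (trivial_cof_weq cyl_union_top_trivial_cof) _.
exact: weq_eq wf'.
Qed.

End CylMap.

(** The inclusion of [D] in the cylinder of [d] factors through the union of [D] with the cylinder
    of [c]. The first factor is a pushout of the top of the cylinder of [c]; the second is a pushout
    of the inclusion, in the cylinder of [b], of the union of [B] with the cylinder of [a]. *)
Theorem gluing (A B C D A' B' C' D' : sset)
    (i : smap A B) (f : smap A C) (g : smap B D) (j : smap C D)
    (i' : smap A' B') (f' : smap A' C') (g' : smap B' D') (j' : smap C' D')
    (a : smap A A') (b : smap B B') (c : smap C C') (d : smap D D') :
  mpush i f g j -> mpush i' f' g' j' ->
  (forall n x, b n (i n x) = i' n (a n x)) -> (forall n x, d n (g n x) = g' n (b n x)) ->
  (forall n x, d n (j n x) = j' n (c n x)) ->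
  weq a -> weq b -> weq c -> weq d.
Proof.
move=> mp mp' bi dg dj wa wb wc; apply/(cyl_top_weq d).2.
have bi' n x : i' n (a n x) = b n (i n x) by rewrite bi.
have dg' n x : g' n (b n x) = d n (g n x) by rewrite dg.
have dj' n x : j' n (c n x) = d n (j n x) by rewrite dj.
have [ii ij ii' ij'] : [/\ inj i, inj j, inj i' & inj j'].
  by split; [case: mp|case: mp|case: mp'|case: mp'].
have t1 := cyl_union_top_trivial_cof dj' ij ij' wc.
pose SB := cyl_union bi'; pose S1 := cyl_union dj'.
have tB : trivial_cof (sincl SB) := cyl_union_trivial_cof bi' ii ii' wa wb.
suff t2 : trivial_cof (sincl S1).
  by apply: weq_eq (weq_comp (trivial_cof_weq t1) (trivial_cof_weq t2)).
have r n z : SB n z -> S1 n (cyl_map dg' n z).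
  case=> [[x <-]|[z' <-]].
    by rewrite cyl_map_top; left; exists (g n x).
  case: z' => [y|[[x t] h]]; right.
    by exists (inl (f' n y)); rewrite /= -(mpush_comm mp').
  exists (inr (exist (fun z : C n * unitI n => z.2 <> vert true n) (f n x, t) h)).
  by congr inr; apply: eq_exist; rewrite /= -(mpush_comm mp).
pose rm : smap (ssub SB) (ssub S1) :=
  @scorestr _ _ S1 (smap_comp (cyl_map dg') (sincl SB)) (fun n z => r n _ (proj2_sig z)).
suff mp2 : mpush (sincl SB) rm (cyl_map dg') (sincl S1) by exact: trivial_cof_mpush mp2 tB.
split.
- exact: sincl_inj.
- exact: sincl_inj.
- by [].
- move=> n [y|[[x t] h]].
    have [[y' <-]|[y' <-]] := mpush_cover mp' y; last by right; exists (inl y').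
    have h : S1 n (inl (j' n y')) by right; exists (inl y').
    by left; exists (exist _ _ h).
  have [[x' e]|[x' e]] := mpush_cover mp x.
    have h' : S1 n (inr (exist _ (x, t) h)).
      right; exists (inr (exist (fun z : C n * unitI n => z.2 <> vert true n) (x', t) h)).
      by congr inr; apply: eq_exist; rewrite /= e.
    by left; exists (exist _ _ h').
  right; exists (inr (exist (fun z : B n * unitI n => z.2 <> vert true n) (x', t) h)).
  by congr inr; apply: eq_exist; rewrite /= e.
- move=> n [y|[[x t] h]] [y'|[[x' t'] h']] //=.
    case=> /(mpush_sep mp')[->|[u e]]; first by left.
    have s : SB n (inl y) by right; exists (inl u); rewrite /= e.
    by right; exists (exist _ _ s).
  case=> /(mpush_sep mp)[ex|[u e]] et.
    by left; congr inr; apply: eq_exist; rewrite ex et.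
  have s : SB n (inr (exist _ (x, t) h)).
    right; exists (inr (exist (fun z : A n * unitI n => z.2 <> vert true n) (u, t) h)).
    by congr inr; apply: eq_exist; rewrite /= e.
  by right; exists (exist _ _ s).
- move=> n z [z1 s1] /= e.
  suff s : SB n z by exists (exist _ _ s).
  rewrite -{}e in s1; case: s1 => [[x]|[z']].
    rewrite cyl_topE; case: z => [//|[[u t] h]] /= [ex et]; left; exists u.
    by apply: etrans (cyl_topE b u) _; congr inr; apply: eq_exist; rewrite et.
  case: z => [y|[[x t] h]]; case: z' => [y'|[[x' t'] h']] //= [].
    move=> e; have [u eu] := mpush_meet mp' (esym e).
    by right; exists (inl u); rewrite /= eu.
  move=> e et; have [u eu] := mpush_meet mp (esym e).
  right; exists (inr (exist (fun z : A n * unitI n => z.2 <> vert true n) (u, t) h)).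
  by congr inr; apply: eq_exist; rewrite /= eu.
Qed.

Definition sub_incl (X : sset) (S T : subc X) (h : forall n x, S n x -> T n x) :
  smap (ssub S) (ssub T) :=
  @scorestr _ _ T (sincl S) (fun n x => h n _ (proj2_sig x)).

Definition sub_map (X Y : sset) (f : smap X Y) (S : subc X) (T : subc Y)
    (h : forall n x, S n x -> T n (f n x)) : smap (ssub S) (ssub T) :=
  @scorestr _ _ T (smap_comp f (sincl S)) (fun n x => h n _ (proj2_sig x)).

Lemma ssub_eq (X : sset) (S : subc X) n (x y : ssub S n) : proj1_sig x = proj1_sig y -> x = y.
Proof. exact: sincl_inj. Qed.

(** * Unions of sequences of subcomplexes *)

Section Tower.
Variables (W : sset) (T : nat -> subc W).
Hypothesis mono : forall k n w, T k n w -> T k.+1 n w.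
Hypothesis cover : forall n w, exists k, T k n w.
Hypothesis step : forall k, trivial_cof (sub_incl (@mono k)).

(** The extension property is strict, so extensions over successive stages agree where both are
    defined and glue over the union. *)
Lemma tower_trivial_cof : trivial_cof (sincl (T 0)).
Proof.
split; first exact: sincl_inj.
move=> Z kZ A B i ii u v uv.
pose st k := {h : smap (sprod (ssub (T k)) B) Z |
  forall n t a, h n (t, i n a) = v n (proj1_sig t, a)}.
have nx k (h : st k) : {h' : st k.+1 | forall n t b,
    proj1_sig h' n (sub_incl (@mono k) n t, b) = proj1_sig h n (t, b)}.
  have [_ tk] := step k; apply: cid.
  have [|h' [hh hv]] := tk Z kZ A B i ii (proj1_sig h) (smap_comp v (sprod_map (sincl (T k.+1)) (smap_id A))).
    by move=> n t a; rewrite (proj2_sig h).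
  by exists (exist _ h' hv).
pose h0 : st 0 := exist _ u uv.
pose h := fix h k : st k := if k is k'.+1 then proj1_sig (nx k' (h k')) else h0.
have hS k n w (tk : T k n w) b : proj1_sig (h k.+1) n (exist _ w (mono tk), b) =
    proj1_sig (h k) n (exist _ w tk, b).
  by have := proj2_sig (nx k (h k)) n (exist _ w tk) b => /= <-.
have hD k l n w (tk : T k n w) (tl : T (l + k) n w) b :
    proj1_sig (h (l + k)) n (exist _ w tl, b) = proj1_sig (h k) n (exist _ w tk, b).
  elim: l tl => [|l IH] tl; first by rewrite (Prop_irrelevance tl tk).
  have tl' : T (l + k) n w.
    by elim: (l) => // l' ?; apply: mono.
  by rewrite (Prop_irrelevance tl (mono tl')) -(IH tl'); apply: hS.
have hE k l n w (tk : T k n w) (tl : T l n w) b :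
    proj1_sig (h k) n (exist _ w tk, b) = proj1_sig (h l) n (exist _ w tl, b).
  wlog kl : k l tk tl / k <= l.
    by move=> H; case: (leqP k l) => [|/ltnW] kl; [|symmetry]; apply: H.
  by move: tl; rewrite -(subnK kl) => tl; rewrite (hD k (l - k) n w tk tl b).
have [g gP] : exists g : smap (sprod W B) Z, forall n z,
    exists k (t : T k n z.1), g n z = proj1_sig (h k) n (exist _ z.1 t, z.2).
  apply: (@ex_smap (sprod W B) Z (fun n z y =>
    exists k (t : T k n z.1), y = proj1_sig (h k) n (exist _ z.1 t, z.2))).
  - move=> n [w b]; have [k t] := cover w.
    by exists (proj1_sig (h k) n (exist _ w t, b)), k, t.
  - by move=> n z y y' [k [t ->]] [l [t' ->]]; apply: hE.
  - move=> m n d z y [k [t ->]]; exists k, (sc_act d t); rewrite -smap_nat.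
    by congr (proj1_sig (h k) m (_, _)); apply: ssub_eq.
exists g; split=> [n t b|n w a].
  have [k [t' ->]] := gP n (sincl (T 0) n t, b).
  case: t t' => w t t'; rewrite (hE k 0 _ _ t' t).
  by [].
have [k [t ->]] := gP n (w, i n a).
by rewrite (proj2_sig (h k)).
Qed.
End Tower.

Section Union.
Variables (X Y : sset) (f : smap X Y) (XS : nat -> subc X) (YS : nat -> subc Y).
Hypothesis Xmono : forall k n x, XS k n x -> XS k.+1 n x.
Hypothesis Ymono : forall k n y, YS k n y -> YS k.+1 n y.
Hypothesis Xcover : forall n x, exists k, XS k n x.
Hypothesis Ycover : forall n y, exists k, YS k n y.
Hypothesis X0 : forall n x, ~ XS 0 n x.
Hypothesis Y0 : forall n y, ~ YS 0 n y.
Hypothesis fS : forall k n x, XS k n x -> YS k n (f n x).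
Hypothesis wf : forall k : nat, weq (sub_map (@fS k)).

(** The source of [f], placed at the end [false], together with the cylinder of the restriction of
    [f] to stage [k]. *)
Definition union_stage (k : nat) : subc (cyl f).
Proof.
apply: (@Subc (cyl f) (fun n z => match z with
   | inl y => YS k n y
   | inr z => XS k n (proj1_sig z).1 \/ (proj1_sig z).2 = vert false n end)).
move=> m n d [y|[[x t] h]] /= H; first exact: sc_act.
have [e|ne] := pselect ((sact d ((x, t) : sprod X unitI n)).2 = vert true m).
  rewrite cyl_in_true //; case: H => [/fS H|H]; first by rewrite /= smap_nat; apply: sc_act.
  by move: e; rewrite /= H -[dcomp _ _]/(sact d (vert false n)) vert_act => /vert_ft.
rewrite (cyl_in_neq _ ne) /=; case: H => H; first by left; apply: sc_act.
by right; rewrite H; apply: vert_act.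
Defined.

Lemma union_stage_mono k n z : union_stage k n z -> union_stage k.+1 n z.
Proof. by case: z => [y|z] /=; [apply: Ymono|case=> h; [left; apply: Xmono|right]]. Qed.

(** The filtrations start empty, so stage 0 is the top of the cylinder. Each passage to the next
    stage is a pushout of an inclusion treated in [cyl_union_trivial_cof]. *)
Lemma weq_union : weq f.
Proof.
apply/(cyl_top_weq f).2.
have tow : trivial_cof (sincl (union_stage 0)).
  apply: (@tower_trivial_cof _ union_stage union_stage_mono).
    move=> n [y|[[x t] h]]; first by have [k] := Ycover y; exists k.
    by have [k] := Xcover x; exists k; left.
  move=> k.
  have sq n (x : ssub (XS k) n) : sub_incl (@Ymono k) n (sub_map (@fS k) n x) =
      sub_map (@fS k.+1) n (sub_incl (@Xmono k) n x).
    exact: ssub_eq.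
  have ii : inj (sub_incl (@Xmono k)) by move=> n x y e; apply: ssub_eq; have := congr1 (@proj1_sig _ _) e.
  have jj : inj (sub_incl (@Ymono k)) by move=> n x y e; apply: ssub_eq; have := congr1 (@proj1_sig _ _) e.
  have tB := cyl_union_trivial_cof sq ii jj (wf k) (wf k.+1).
  pose cm k := @cyl_map _ _ _ _ (sub_map (@fS k)) f (sincl (XS k)) (sincl (YS k)) (fun _ _ => erefl).
  have cmS n z : union_stage k.+1 n (cm k.+1 n z).
    case: z => [[y h]|[[[x h] t] h']] /=; first exact: h.
    by left.
  have cB n z : cyl_union sq n z -> union_stage k n (cm k.+1 n z).
    case=> [[x <-]|[z' <-]]; first by rewrite cyl_map_top cyl_topE; right.
    case: z' => [[y h]|[[[x h] t] h']] /=; first exact: h.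
    by left.
  pose bm : smap (ssub (cyl_union sq)) (ssub (union_stage k)) :=
    @scorestr _ _ (union_stage k) (smap_comp (cm k.+1) (sincl _)) (fun n z => cB n _ (proj2_sig z)).
  pose gm : smap (cyl (sub_map (@fS k.+1))) (ssub (union_stage k.+1)) := scorestr cmS.
  have icm : inj (cm k.+1) by apply: cyl_map_inj; apply: sincl_inj.
  apply: (trivial_cof_mpush (i := sincl (cyl_union sq)) (f := bm) (g := gm)) tB.
  split.
  - exact: sincl_inj.
  - by move=> n x y e; apply: ssub_eq; have := congr1 (@proj1_sig _ _) e.
  - by move=> n z; apply: ssub_eq.
  - move=> n [[y|[[x t] h]] s].
      by right; exists (inl (exist _ y s)); apply: ssub_eq.
    case: (s) => [hx|ht]; last first.
      left; have s' : union_stage k n (inr (exist _ (x, t) h)) by right.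
      by exists (exist _ _ s'); apply: ssub_eq.
    right; exists (inr (exist (fun z : ssub (XS k.+1) n * unitI n => z.2 <> vert true n) (exist _ x hx, t) h)).
    by apply: ssub_eq.
  - move=> n z z' e; left; apply: icm.
    by have {}e : cm k.+1 n z = cm k.+1 n z' := congr1 (@proj1_sig _ _) e.
  - move=> n z [w s] e.
    have {e} e : cm k.+1 n z = w := congr1 (@proj1_sig _ _) e.
    suff s' : cyl_union sq n z by exists (exist _ _ s').
    rewrite -{}e in s; case: z s => [[y h]|[[[x h] t] h']] /= s.
      by right; exists (inl (exist _ y s)); congr inl; apply: ssub_eq.
    case: s => [hx|ht].
      right; exists (inr (exist (fun z : ssub (XS k) n * unitI n => z.2 <> vert true n) (exist _ x hx, t) h')).
      congr inr; apply: eq_exist; congr pair; exact: ssub_eq.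
    left; exists (exist _ x h); apply: etrans (cyl_topE _ _) _; congr inr; apply: eq_exist.
    by rewrite -ht.
have s0 n x : union_stage 0 n (cyl_top f n x) by rewrite cyl_topE; right.
apply: (@weq_eq _ _ (smap_comp (sincl (union_stage 0)) (scorestr s0))) => //.
apply: weq_comp (trivial_cof_weq tow).
apply: bij_weq.
  move=> n x y e; apply: (@cyl_top_inj _ _ f).
  by have {}e : cyl_top f n x = cyl_top f n y := congr1 (@proj1_sig _ _) e.
move=> n [[y|[[x t] h]] s]; first by case: (Y0 s).
exists x; apply: ssub_eq; apply: etrans (cyl_topE _ _) _; congr inr; apply: eq_exist.
by case: s => [/X0//|/= ->].
Qed.
End Union.

(** * Coproducts and sequential colimits *)

Definition fibre (X : sset) (J : Type) (a : smap X (disc J)) (j : J) : subc X.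
Proof.
apply: (@Subc X (fun n x => a n x = j)).
by move=> m n d x <-; rewrite smap_nat.
Defined.

Lemma fibre_glue (X Z : sset) (J : Type) (a : smap X (disc J))
    (v : forall j, smap (ssub (fibre a j)) Z) :
  exists w : smap X Z, forall j n x, w n (proj1_sig x) = v j n x.
Proof.
have [w wP] : exists w : smap X Z, forall n x, exists j (h : fibre a j n x), w n x = v j n (exist _ x h).
  apply: (@ex_smap X Z (fun n x z => exists j (h : fibre a j n x), z = v j n (exist _ x h))).
  - by move=> n x; exists (v (a n x) n (exist _ x erefl)), (a n x), erefl.
  - move=> n x z z' [j [h ->]] [j' [h' ->]].
    have e : j = j' by rewrite -h -h'.
    by subst j'; congr (v j n _); apply: ssub_eq.
  - move=> m n d x z [j [h ->]]; exists j, (sc_act d h); rewrite -smap_nat.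
    by congr (v j m _); apply: ssub_eq.
exists w => j n [x h] /=; have [j' [h' ->]] := wP n x.
have e : j = j' by rewrite -h -h'.
by subst j'; congr (v j n _); apply: ssub_eq.
Qed.

(** Extensions and homotopies are chosen separately over each index and glued by [fibre_glue]. *)
Lemma weq_coprod (X Y : sset) (J : Type) (f : smap X Y) (a : smap Y (disc J)) (b : smap X (disc J))
    (h : forall j n x, fibre b j n x -> fibre a j n (f n x)) :
  (forall j : J, weq (sub_map (@h j))) -> weq f.
Proof.
move=> wf.
have ab n x : a n (f n x) = b n x by exact: (@h (b n x) n x erefl).
apply/weqP => Z kZ; split=> [u|v v' [H hH]].
- have ex j : {v : smap (ssub (fibre a j)) Z |
      homotopic (smap_comp v (sub_map (@h j))) (smap_comp u (sincl _))}.
    by apply: cid; have /weqP/(_ Z kZ)[sf _] := wf j; apply: sf.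
  have [v vP] := @fibre_glue Y Z J a (fun j => proj1_sig (ex j)).
  pose eH j := cid (proj2_sig (ex j)).
  pose b' : smap (sprod X unitI) (disc J) := smap_comp b (smap_fst _ _).
  have hb j n (z : ssub (fibre b' j) n) : fibre b j n (proj1_sig z).1 by exact: (proj2_sig z).
  pose c j : smap (ssub (fibre b' j)) (sprod (ssub (fibre b j)) unitI) :=
    smap_pair (@scorestr _ _ (fibre b j) (smap_comp (smap_fst X unitI) (sincl _)) (hb j))
              (smap_comp (smap_snd X unitI) (sincl _)).
  have [G GP] := @fibre_glue _ Z J b' (fun j => smap_comp (proj1_sig (eH j)) (c j)).
  exists v; exists G => n x.
  have e0 (t : unitI n) : b' n (x, t) = b n x by [].
  have GE t : G n (x, t) = proj1_sig (eH (b n x)) n (exist _ x erefl, t).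
    apply: etrans (GP (b n x) n (exist _ (x, t) (e0 t))) _.
    rewrite -[LHS]/(proj1_sig (eH (b n x)) n (c (b n x) n (exist _ (x, t) (e0 t)))).
    by congr (smap_fun _ n _); congr pair; apply: ssub_eq.
  have HP := proj2_sig (eH (b n x)) n (exist _ x erefl).
  rewrite !GE HP.1 HP.2 /=; split=> //.
  by rewrite -vP.
- have ex j : {G : smap (sprod (ssub (fibre a j)) unitI) Z |
      homotopy (smap_comp v (sincl (fibre a j))) (smap_comp v' (sincl _)) G}.
    apply: cid; have /weqP/(_ Z kZ)[_ jf] := wf j; apply: jf.
    exists (smap_comp H (sprod_map (sincl (fibre b j)) (smap_id _))) => n x /=.
    by rewrite (hH n _).1 (hH n _).2.
  pose a' : smap (sprod Y unitI) (disc J) := smap_comp a (smap_fst _ _).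
  have ha j n (z : ssub (fibre a' j) n) : fibre a j n (proj1_sig z).1 by exact: (proj2_sig z).
  pose c j : smap (ssub (fibre a' j)) (sprod (ssub (fibre a j)) unitI) :=
    smap_pair (@scorestr _ _ (fibre a j) (smap_comp (smap_fst Y unitI) (sincl _)) (ha j))
              (smap_comp (smap_snd Y unitI) (sincl _)).
  have [G GP] := @fibre_glue _ Z J a' (fun j => smap_comp (proj1_sig (ex j)) (c j)).
  exists G => n y.
  have e0 (t : unitI n) : a' n (y, t) = a n y by [].
  have GE t : G n (y, t) = proj1_sig (ex (a n y)) n (exist _ y erefl, t).
    apply: etrans (GP (a n y) n (exist _ (y, t) (e0 t))) _.
    rewrite -[LHS]/(proj1_sig (ex (a n y)) n (c (a n y) n (exist _ (y, t) (e0 t)))).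
    by congr (smap_fun _ n _); congr pair; apply: ssub_eq.
  have HP := proj2_sig (ex (a n y)) n (exist _ y erefl).
  by rewrite !GE HP.1 HP.2.
Qed.

Section Colimit.
Variables (X : nat -> sset) (t : forall k, smap (X k) (X k.+1)).

Definition stage_elt n := {k & X k n}.
Definition stage_step n (u : stage_elt n) : stage_elt n :=
  existT _ (tag u).+1 (t (tag u) n (tagged u)).
Definition stage_act m n (d : delta m n) (u : stage_elt n) : stage_elt m :=
  existT _ (tag u) (sact d (tagged u)).

Lemma stage_step_act m n (d : delta m n) u : stage_step (stage_act d u) = stage_act d (stage_step u).
Proof. by rewrite /stage_step /stage_act /= smap_nat. Qed.

Definition stage_eq n (u v : stage_elt n) :=
  exists k l, iter k (@stage_step n) u = iter l (@stage_step n) v.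

Lemma stage_eq_trans n (u v w : stage_elt n) : stage_eq u v -> stage_eq v w -> stage_eq u w.
Proof.
move=> [k [l e]] [k' [l' e']]; exists (k' + k), (l + l').
by rewrite !iterD e -iterD addnC iterD e'.
Qed.

Lemma stage_eq_sym n (u v : stage_elt n) : stage_eq u v -> stage_eq v u.
Proof. by move=> [k [l e]]; exists l, k. Qed.

Lemma stage_eq_refl n (u : stage_elt n) : stage_eq u u.
Proof. by exists 0, 0. Qed.

Lemma iter_step_act m n (d : delta m n) k u :
  iter k (@stage_step m) (stage_act d u) = stage_act d (iter k (@stage_step n) u).
Proof. by elim: k => //= k ->; rewrite stage_step_act. Qed.

Definition colim_simp n := {P : stage_elt n -> Prop | exists u, P = stage_eq u}.
Definition colim_class n (u : stage_elt n) : colim_simp n := exist _ (stage_eq u) (ex_intro _ u erefl).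

Lemma colim_classP n (u v : stage_elt n) : colim_class u = colim_class v <-> stage_eq u v.
Proof.
split=> [e|h].
  have /= -> := congr1 (@proj1_sig _ _) e; exact: stage_eq_refl.
apply: eq_exist; apply/funext => w; apply/propext; split.
  exact: stage_eq_trans (stage_eq_sym h).
exact: stage_eq_trans h.
Qed.

Definition colim_repr n (c : colim_simp n) : stage_elt n := projT1 (cid (proj2_sig c)).
Lemma colim_reprK n (c : colim_simp n) : colim_class (colim_repr c) = c.
Proof. by case: c => P hP; rewrite /colim_repr; case: cid => /= u e; apply: eq_exist. Qed.

Definition colim_act m n (d : delta m n) (c : colim_simp n) : colim_simp m :=
  colim_class (stage_act d (colim_repr c)).

Lemma colim_act_class m n (d : delta m n) u : colim_act d (colim_class u) = colim_class (stage_act d u).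
Proof.
apply/colim_classP; have [k [l e]] : stage_eq (colim_repr (colim_class u)) u.
  by apply/colim_classP; rewrite colim_reprK.
by exists k, l; rewrite !iter_step_act e.
Qed.

Definition colim : sset.
Proof.
apply: (@SSet colim_simp colim_act).
- move=> n c; rewrite -[c]colim_reprK colim_act_class /stage_act sact_id.
  by case: (colim_repr c).
- move=> m n p g d c; rewrite -[c]colim_reprK !colim_act_class.
  by rewrite /stage_act /= sact_comp.
Defined.

Definition colim_in k : smap (X k) colim.
Proof.
apply: (@SMap (X k) colim (fun n x => colim_class (existT _ k x))).
by move=> m n d x; symmetry; apply: colim_act_class.
Defined.

Lemma colim_in_step k n x : colim_in k.+1 n (t k n x) = colim_in k n x.
Proof. by apply/colim_classP; exists 0, 1. Qed.

Lemma colim_in_late k l n x : k <= l -> exists y, colim_in l n y = colim_in k n x.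
Proof.
move/subnK => <-; elim: (l - k) => [|i [y IH]]; first by exists x.
by exists (t (i + k) n y); apply: etrans IH; apply: colim_in_step.
Qed.

Lemma colim_cover n (c : colim n) : exists k x, colim_in k n x = c.
Proof.
rewrite -[c]colim_reprK; case: (colim_repr c) => k x; by exists k, x.
Qed.

Lemma colim_common n (c : colim n) : exists k, forall l, k <= l -> exists x, colim_in l n x = c.
Proof.
have [k [x <-]] := colim_cover c; exists k => l; exact: colim_in_late.
Qed.

Hypothesis it : forall k, inj (t k).

Lemma stage_step_inj n (u v : stage_elt n) : stage_step u = stage_step v -> u = v.
Proof.
case: u v => [k x] [l y] e.
have ekl : k = l by have := congr1 (fun u => (tag u).-1) e.
subst l; congr (existT _ k _); apply: it.
exact: eq_from_Tagged e.
Qed.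

Lemma colim_in_inj k : inj (colim_in k).
Proof.
move=> n x y /colim_classP[a [b e]].
have iter_tag c (u : stage_elt n) : tag (iter c (@stage_step n) u) = c + tag u.
  by elim: c => //= c ->.
have ab : a = b by have := congr1 (fun u => tag u) e; rewrite !iter_tag /= => /addIn.
subst b; elim: a e => [|a IH] /= e; first exact: eq_from_Tagged e.
by apply: IH; apply: stage_step_inj e.
Qed.

End Colimit.

Lemma colim_desc (X : nat -> sset) (t : forall k, smap (X k) (X k.+1)) (Z : sset)
    (f : forall k, smap (X k) Z) : (forall k n x, f k.+1 n (t k n x) = f k n x) ->
  exists w : smap (colim t) Z, forall k n x, w n (colim_in t k n x) = f k n x.
Proof.
move=> ft.
have itf n c (u : stage_elt X n) : f (tag (iter c (@stage_step X t n) u)) n (tagged (iter c (@stage_step X t n) u)) =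
    f (tag u) n (tagged u).
  by elim: c => //= c <-; rewrite ft.
have fE n k l x y : colim_in t k n x = colim_in t l n y -> f k n x = f l n y.
  move/colim_classP => [a [b e]].
  by rewrite -[LHS](itf n a (existT _ k x)) e itf.
have [w wP] : exists w : smap (colim t) Z, forall n c, exists k x, colim_in t k n x = c /\ w n c = f k n x.
  apply: (@ex_smap (colim t) Z (fun n c z => exists k x, colim_in t k n x = c /\ z = f k n x)).
  - by move=> n c; have [k [x e]] := colim_cover c; exists (f k n x), k, x.
  - by move=> n c z z' [k [x [<- ->]]] [l [y [e ->]]]; apply: fE.
  - by move=> m n d c z [k [x [<- ->]]]; exists k, (sact d x); rewrite !smap_nat.
exists w => k n x; have [l [y [e ->]]] := wP n (colim_in t k n x).
exact: fE e.
Qed.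

(* A horn is generated by finitely many faces. *)
Lemma horn_colim (X : nat -> sset) (t : forall k, smap (X k) (X k.+1)) n (k : 'I_n.+2)
    (u : smap (horn k) (colim t)) : (forall k, inj (t k)) ->
  exists N, forall M, N <= M -> exists v : smap (horn k) (X M), forall m a, u m a = colim_in t M m (v m a).
Proof.
move=> it.
have hf (j : 'I_n.+2) (jk : j != k) : in_horn k (dface j).
  apply/existsP; exists j; rewrite jk; apply/forallP => i.
  by rewrite mkdeltaE eq_sym neq_lift.
have [N NP] : exists N, forall (j : 'I_n.+2) (jk : j != k) M, N <= M ->
    exists x, u n (in_hornE (hf j jk)) = colim_in t M n x.
  have ex (j : 'I_n.+2) : exists N, forall (jk : j != k) M, N <= M ->
      exists x, u n (in_hornE (hf j jk)) = colim_in t M n x.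
    have [jk|nk] := pselect (j != k); last by exists 0 => jk.
    have [N NP] := colim_common (u n (in_hornE (hf j jk))); exists N => jk' M NM.
    have [x e] := NP M NM; exists x; rewrite e; congr (u n _); exact: val_inj.
  have [c cP] := choice ex; exists (\max_j c j) => j jk M NM; apply: cP.
  by apply: leq_trans NM; apply: leq_bigmax.
exists N => M NM.
apply: (@ex_smap (horn k) (X M) (fun m a x => u m a = colim_in t M m x)).
- move=> m a; case/existsP: (valP a) => j /andP[jk /forallP mj].
  have [g ga] := dface_factor mj; have [x e] := NP j jk M NM.
  exists (sact g x); rewrite smap_nat -e -smap_nat; congr (u m _); apply: val_inj.
  exact: ga.
- by move=> m a x y -> /(colim_in_inj it).
- by move=> m p d a x e; rewrite !smap_nat e.
Qed.

(** * Base change along homotopy equivalences *)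

Record pbk (P T G L : sset) (a : smap P T) (b : smap P G) (f : smap T L) (p : smap G L) : Prop := Pbk {
  pbk_comm : forall n x, f n (a n x) = p n (b n x);
  pbk_ex : forall n t g, f n t = p n g -> exists x, a n x = t /\ b n x = g;
  pbk_uniq : forall n x y, a n x = a n y -> b n x = b n y -> x = y }.

Definition spull_sub (T G L : sset) (f : smap T L) (p : smap G L) : subc (sprod T G).
Proof.
apply: (@Subc (sprod T G) (fun n z => f n z.1 = p n z.2)).
by move=> m n d z e; rewrite /= !smap_nat e.
Defined.

Definition spull (T G L : sset) (f : smap T L) (p : smap G L) : sset := ssub (spull_sub f p).
Definition spull_fst (T G L : sset) (f : smap T L) (p : smap G L) : smap (spull f p) T :=
  smap_comp (smap_fst T G) (sincl _).
Definition spull_snd (T G L : sset) (f : smap T L) (p : smap G L) : smap (spull f p) G :=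
  smap_comp (smap_snd T G) (sincl _).

Lemma spull_pbk (T G L : sset) (f : smap T L) (p : smap G L) :
  pbk (spull_fst f p) (spull_snd f p) f p.
Proof.
split.
- by move=> n [z h].
- move=> n t g e; have h : spull_sub f p n (t, g) by [].
  by exists (exist _ _ h).
- by move=> n [[x1 x2] h] [[y1 y2] h'] /= e1 e2; apply: eq_exist; congr pair.
Qed.

Lemma pbk_desc (P T G L Z : sset) (a : smap P T) (b : smap P G) (f : smap T L) (p : smap G L)
    (u : smap Z T) (v : smap Z G) : pbk a b f p ->
  (forall n z, f n (u n z) = p n (v n z)) ->
  exists w : smap Z P, forall n z, a n (w n z) = u n z /\ b n (w n z) = v n z.
Proof.
move=> [cm ex un] uv.
apply: (@ex_smap Z P (fun n z x => a n x = u n z /\ b n x = v n z)).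
- by move=> n z; apply: ex.
- by move=> n z x y [a1 b1] [a2 b2]; apply: un; rewrite ?a1 ?b1.
- by move=> m n d z x [a1 b1]; rewrite !smap_nat a1 b1.
Qed.

Lemma pbk_paste (P Q T S G L : sset) (a' : smap Q S) (b' : smap Q P) (g : smap S T)
    (a : smap P T) (b : smap P G) (f : smap T L) (p : smap G L) :
  pbk a b f p -> pbk a' b' g a -> pbk a' (smap_comp b b') (smap_comp f g) p.
Proof.
move=> [cm ex un] [cm' ex' un']; split.
- by move=> n x /=; rewrite cm' cm.
- move=> n s y /= e; have [x [ax bx]] := ex _ _ _ e.
  have [z [az bz]] := ex' _ _ _ (esym ax).
  by exists z; rewrite bz bx.
- move=> n x y ea /= eb; apply: un' => //; apply: un => //.
  by rewrite -!cm' ea.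
Qed.

Lemma pbk_id (G L : sset) (p : smap G L) : pbk p (smap_id G) (smap_id L) p.
Proof.
split=> // n t g /= e; by exists g; rewrite -e.
Qed.

Lemma pbk_injr (P T G L : sset) (a : smap P T) (b : smap P G) (f : smap T L) (p : smap G L) :
  pbk a b f p -> inj f -> inj b.
Proof. by move=> [cm _ un] jf n x y e; apply: un => //; apply: jf; rewrite !cm e. Qed.

Lemma pbk_lifts (P T G L : sset) (a : smap P T) (b : smap P G) (f : smap T L) (p : smap G L)
    (A B : sset) (i : smap A B) : pbk a b f p -> lifts i p -> lifts i a.
Proof.
move=> pb lp u v uv.
have [|w [wi pw]] := lp (smap_comp b u) (smap_comp f v).
  by move=> n x /=; rewrite -(pbk_comm pb) uv.
have [|x xP] := @pbk_desc _ _ _ _ _ _ _ _ _ v w pb; first by move=> n z; rewrite pw.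
exists x; split=> n z; last exact: (xP n z).1.
by apply: (pbk_uniq pb); rewrite ?(xP n _).1 ?(xP n _).2 ?uv ?wi.
Qed.

Lemma pbk_kan (P T G L : sset) (a : smap P T) (b : smap P G) (f : smap T L) (p : smap G L) :
  pbk a b f p -> kan_fibration p -> kan_fibration a.
Proof.
move=> pb kp n k; apply/lifts_has_lifting; apply: pbk_lifts pb _; exact/lifts_has_lifting.
Qed.

Lemma kan_comp (X Y Z : sset) (p : smap X Y) (q : smap Y Z) :
  kan_fibration p -> kan_fibration q -> kan_fibration (smap_comp q p).
Proof.
move=> kp kq n k; apply/lifts_has_lifting => u v e.
have /lifts_has_lifting/(_ (smap_comp p u) v e)[w [wi qw]] := kq n k.
have [|x [xi px]] := (lifts_has_lifting _ _).2 (kp n k) u w; first by move=> m a; rewrite wi.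
by exists x; split=> // m b; rewrite /= px.
Qed.

(** The base part of a lifting problem against a horn is a single simplex, so the problem can be
    solved after base change to any object containing that simplex. *)
Lemma kan_local (E Y : sset) (p : smap E Y) :
  (forall n (y : Y n), exists (P T : sset) (a : smap P T) (b : smap P E) (f : smap T Y),
    [/\ pbk a b f p, kan_fibration a & exists t, f n t = y]) -> kan_fibration p.
Proof.
move=> loc; apply/kanP => n k u y e.
have [P [T [a [b [f [pb ka [t ft]]]]]]] := loc _ y.
have [|w wP] := @pbk_desc _ _ _ _ _ _ _ _ _ (smap_comp (yoneda t) (horn_incl k)) u pb.
  by move=> m x /=; rewrite e smap_nat ft.
have /kanP/(_ n k w t)[] := ka; first by move=> m x; rewrite (wP m x).1.
move=> z [az zw]; exists (b _ z); split.
  by rewrite -(pbk_comm pb) az.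
by move=> m x; rewrite -smap_nat zw (wP m x).2.
Qed.

Lemma rtr_vert e n (t : unitI n) (k : 'I_2) : k = (if e then ord_max else ord0) ->
  rtr e k (t, vert e n) = vert e n.
Proof.
move=> ->; apply: delta_inj => i; rewrite rtrE !dcstE /rtr_fun eqxx.
by rewrite [dval t i]ord2E; case: (e); case: (_ == _).
Qed.

Lemma rtr_vertl e n (t : unitI n) (k : 'I_2) : k = (if e then ord_max else ord0) ->
  rtr e k (vert e n, t) = vert e n.
Proof.
move=> ->; apply: delta_inj => i; rewrite rtrE !dcstE /rtr_fun.
by case: (e); case: (_ == _).
Qed.

(** The contraction of the interval to [e] lifts to a homotopy of [G] that starts at the identity
    and is constant on [P]. At its other end it is a retraction to [P]. *)
Lemma pull_end_weq (e : bool) (T P G : sset) (p : smap G (sprod T unitI)) (a : smap P T) (b : smap P G) :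
  kan_fibration p -> pbk a b (at_end T e) p -> weq b.
Proof.
move=> kp pb.
have jb : inj b by apply: pbk_injr pb _ => n x y [].
pose k : 'I_2 := if e then ord_max else ord0.
pose w0 n (z : sprod G unitI n) : sprod T unitI n := ((p n z.1).1, rtr e k ((p n z.1).2, z.2)).
have wn m n (d : delta m n) z : w0 m (sact d z) = sact d (w0 n z).
  by rewrite /w0 smap_nat; congr pair; exact: (rtr_nat e k d ((p n z.1).2, z.2)).
have wE n g : w0 n (g, vert (~~ e) n) = p n g by rewrite /w0 /= rtr_id; case: (p n g).
have we n g : w0 n (g, vert e n) = ((p n g).1, vert e n) by rewrite /w0 /= rtr_vert.
have [|||h [hu hv ph]] := @homotopy_lifting (~~ e) P G G _ p b kp jb (smap_id G)
  (smap_comp b (smap_fst _ _)) (SMap wn).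
- by [].
- by move=> n g; rewrite /= wE.
- move=> n x t /=; rewrite /w0 /= -(pbk_comm pb) at_endE /=; congr pair.
  by rewrite rtr_vertl.
have [|r rP] := @pbk_desc _ _ _ _ G _ _ _ _ (smap_comp (smap_fst _ _) p) (smap_comp h (at_end G e)) pb.
  by move=> n g; rewrite at_endE at_end_comp ph /= we.
apply: (@hequiv_weq _ _ b r).
  rewrite (_ : smap_comp r b = smap_id P); first exact: rst_refl.
  by apply: smap_eq => n x; apply: jb; rewrite /= (rP n _).2 at_end_comp hv.
have he n g : h n (g, vert e n) = smap_comp b r n g by rewrite /= (rP n g).2 at_end_comp.
have hi n g : h n (g, vert (~~ e) n) = g by rewrite hu.
case: (e) he hi => he hi.
  by apply/rst_sym/rst_step; exists h => n z; rewrite he hi.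
by apply/rst_step; exists h => n z; rewrite he hi.
Qed.

Lemma pbk_end (e : bool) (T L P G : sset) (p : smap G L) (f : smap T L) (H : smap (sprod T unitI) L)
    (a : smap P T) (b : smap P G) :
  (forall n x, H n (x, vert e n) = f n x) -> pbk a b f p ->
  exists d : smap P (spull H p),
    pbk a d (at_end T e) (spull_fst H p) /\ forall n x, spull_snd H p n (d n x) = b n x.
Proof.
move=> He pb; have pH := spull_pbk H p.
have [|d dP] := @pbk_desc _ _ _ _ P _ _ _ _ (smap_comp (at_end T e) a) b pH.
  by move=> n x; rewrite [smap_comp _ _ _ _]at_endE He (pbk_comm pb).
exists d; split; last by move=> n x; rewrite (dP n x).2.
split.
- by move=> n x; rewrite (dP n x).1.
- move=> n t z tz; have e1 : f n t = p n (spull_snd H p n z).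
    by rewrite -(pbk_comm pH) -tz at_endE He.
  have [x [ax bx]] := pbk_ex pb e1; exists x; split=> //.
  by apply: (pbk_uniq pH); rewrite ?(dP n x).1 ?(dP n x).2 // -tz /= ax.
- move=> n x y ea ed; apply: (pbk_uniq pb) => //.
  by rewrite -(dP n x).2 -(dP n y).2 ed.
Qed.

(* Both base changes are ends of the base change along the homotopy. *)
Lemma pull_homotopic_weq (T L G P0 P1 : sset) (p : smap G L) (f0 f1 : smap T L)
    (a0 : smap P0 T) (b0 : smap P0 G) (a1 : smap P1 T) (b1 : smap P1 G) :
  kan_fibration p -> homotopic f0 f1 -> pbk a0 b0 f0 p -> pbk a1 b1 f1 p ->
  weq b0 <-> weq b1.
Proof.
move=> kp [H hH] pb0 pb1; have kH := pbk_kan (spull_pbk H p) kp.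
have [d0 [/(pull_end_weq kH) w0 e0]] := pbk_end (fun n x => (hH n x).1) pb0.
have [d1 [/(pull_end_weq kH) w1 e1]] := pbk_end (fun n x => (hH n x).2) pb1.
have E0 : weq b0 <-> weq (smap_comp (spull_snd H p) d0).
  by split; apply: weq_eq => n x; rewrite /= -e0.
have E1 : weq b1 <-> weq (smap_comp (spull_snd H p) d1).
  by split; apply: weq_eq => n x; rewrite /= -e1.
rewrite E0 E1; split=> w.
  exact: weq_comp w1 (weq_2of3l w0 w).
exact: weq_comp w0 (weq_2of3l w1 w).
Qed.

Lemma pull_hrel_weq (T L G : sset) (p : smap G L) (f0 f1 : smap T L) :
  kan_fibration p -> hrel f0 f1 -> forall (P0 P1 : sset)
    (a0 : smap P0 T) (b0 : smap P0 G) (a1 : smap P1 T) (b1 : smap P1 G),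
  pbk a0 b0 f0 p -> pbk a1 b1 f1 p -> weq b0 <-> weq b1.
Proof.
move=> kp; elim=> {f0 f1} [f0 f1 h|f|f g _ IH|f g h _ IH _ IH'] P0 P1 a0 b0 a1 b1 pb0 pb1.
- exact: pull_homotopic_weq kp h pb0 pb1.
- apply: pull_homotopic_weq kp _ pb0 pb1.
  by exists (smap_comp f (smap_fst _ _)).
- by symmetry; apply: IH pb1 pb0.
- have pb := spull_pbk g p.
  by rewrite (IH _ _ _ _ _ _ pb0 pb); apply: IH' pb pb1.
Qed.

(* Two-out-of-six reduces the base change along a homotopy equivalence to base change along the
   identity. *)
Lemma pull_hequiv_weq (X Y G P : sset) (h : smap X Y) (g : smap Y X) (p : smap G Y)
    (a : smap P X) (b : smap P G) :
  hrel (smap_comp g h) (smap_id X) -> hrel (smap_comp h g) (smap_id Y) ->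
  kan_fibration p -> pbk a b h p -> weq b.
Proof.
move=> gh hg kp pb.
have pb1 := spull_pbk g a; set b1 := spull_snd g a in pb1; set a1 := spull_fst g a in pb1.
have pb2 := spull_pbk h a1; set b2 := spull_snd h a1 in pb2.
have ka := pbk_kan pb kp.
have w1 : weq (smap_comp b b1).
  apply: (pull_hrel_weq kp hg (pbk_paste pb pb1) (pbk_id p)).2; exact: weq_id.
have w2 : weq (smap_comp b1 b2).
  apply: (pull_hrel_weq ka gh (pbk_paste pb1 pb2) (pbk_id a)).2; exact: weq_id.
exact: weq_2of3l (weq_2of6 w2 w1) w1.
Qed.

(** * Contraction of simplices and horns to a vertex *)

Section Contract.
Variables (n : nat) (k : 'I_n.+2) (T : sset) (i : smap T (stdsimplex n.+1)).
Hypothesis ii : inj i.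
(** The subobject [T] is star-shaped around [k]: vertices of its simplices may be replaced by [k].
    Both the simplex and the horn at [k] are of this kind. *)
Hypothesis ik : forall m t (y : delta m n.+1),
  (forall j, dval y j = k \/ dval y j = dval (i m t : delta m n.+1) j) -> exists t', i m t' = y.
Variable k0 : T 0.
Hypothesis ik0 : i 0 k0 = dcst 0 k.

(* The identity is joined to the constant map at [k] by a zigzag of two homotopies, [rtr] from the
   identity and [contract] from the constant map, with the same end. *)
Definition contract_fun (a : 'I_n.+2) (t : 'I_2) : 'I_n.+2 :=
  if t == ord_max then (if a <= k then k else a) else k.

Lemma contract_subproof m (x : delta m n.+1) (t : delta m 1) (b j : 'I_m.+1) :
  b <= j -> contract_fun (dval x b) (dval t b) <= contract_fun (dval x j) (dval t j).
Proof.
move=> ij; have := monoP x ij; have := monoP t ij; rewrite /contract_fun.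
rewrite [dval t b]ord2E [dval t j]ord2E.
case: (dval t b == ord_max); case: (dval t j == ord_max) => /= hx; do ?case: ifP; lia.
Qed.

Definition contract m (z : sprod (stdsimplex n.+1) unitI m) : delta m n.+1 :=
  mkdelta (@contract_subproof m z.1 z.2).

Lemma contractE m z j : dval (@contract m z) j = contract_fun (dval z.1 j) (dval z.2 j).
Proof. exact: mkdeltaE. Qed.

Lemma contract_nat m p (d : delta m p) z :
  contract (sact d z) = sact d (contract z : stdsimplex n.+1 p).
Proof.
apply: delta_inj => j; rewrite -[RHS]/(dval (dcomp (contract z) d) j).
by rewrite (dcompE (contract z)) !contractE /= !dcompE.
Qed.

Let lift_homotopy (r : forall m, sprod (stdsimplex n.+1) unitI m -> delta m n.+1) :
  (forall m p (d : delta m p) z, r m (sact d z) = sact d (r p z : stdsimplex n.+1 p)) ->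
  (forall m z j, dval (r m z) j = k \/ dval (r m z) j = dval z.1 j) ->
  exists H : smap (sprod T unitI) T, forall m z, i m (H m z) = r m (i m z.1, z.2).
Proof.
move=> rn rk; apply: (@ex_smap (sprod T unitI) T (fun m z t => i m t = r m (i m z.1, z.2))).
- by move=> m [t s]; apply: (@ik m t) => j; apply: rk.
- by move=> m z y y' <- /ii.
- move=> m p d [t s] y e; rewrite smap_nat e -rn; congr (r m (_, _)).
  by rewrite smap_nat.
Qed.

Lemma contract_homotopic : exists m : smap T T,
  homotopic (smap_id T) m /\ homotopic (const_map T k0) m.
Proof.
have [H1 H1P] : exists H : smap (sprod T unitI) T, forall m z, i m (H m z) = rtr true k (i m z.1, z.2).
  apply: lift_homotopy; first by move=> m p d z; exact: rtr_nat.
  move=> m z j; rewrite rtrE /rtr_fun; case: (_ == _); last by right.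
  by case: ifP => _; [left|right].
have [H2 H2P] : exists H : smap (sprod T unitI) T, forall m z, i m (H m z) = contract (i m z.1, z.2).
  apply: lift_homotopy; first exact: contract_nat.
  move=> m z j; rewrite contractE /contract_fun; case: (_ == _); last by left.
  by case: ifP => _; [left|right].
exists (smap_comp H1 (at_end T true)); split.
  exists H1 => m t; rewrite at_end_comp; split=> //; apply: ii.
  by rewrite H1P; exact: (rtr_id true k (i m t)).
exists H2 => m t; rewrite at_end_comp; split; apply: ii.
  rewrite H2P smap_nat ik0; apply: delta_inj => j.
  by rewrite contractE /= dcompE !dcstE /contract_fun.
rewrite H2P H1P; apply: delta_inj => j; rewrite contractE rtrE /= dcstE /rtr_fun.
by rewrite /contract_fun eqxx.
Qed.

Definition const_pt : smap pt T := const_map pt k0.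

Lemma contract_pull_weq (G P : sset) (p : smap G T) (a : smap P pt) (b : smap P G) :
  kan_fibration p -> pbk a b const_pt p -> weq b.
Proof.
move=> kp; have [m [h1 h2]] := contract_homotopic.
apply: (@pull_hequiv_weq _ _ _ _ _ (bang T)) => //.
  by rewrite (_ : smap_comp _ _ = smap_id pt); [apply: rst_refl|apply: smap_eq => q []].
apply: (rst_trans _ _ _ m); last by apply/rst_sym/rst_step.
by apply: rst_step; rewrite (_ : smap_comp _ _ = const_map T k0) //; apply: smap_eq.
Qed.
End Contract.

Lemma horn_closed n (k : 'I_n.+2) m (t : horn k m) (y : delta m n.+1) :
  (forall j, dval y j = k \/ dval y j = dval (val t) j) -> exists t', horn_incl k m t' = y.
Proof.
move=> yk; suff h : in_horn k y by exists (in_hornE h).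
case/existsP: (valP t) => j /andP[jk /forallP h]; apply/existsP; exists j; rewrite jk.
apply/forallP => l; case: (yk l) => -> //; by rewrite eq_sym.
Qed.

Lemma horn_vertex_subproof n (k : 'I_n.+2) : in_horn k (dcst 0 k : delta 0 n.+1).
Proof.
have [j jk] : exists j : 'I_n.+2, j != k.
  have [->|] := eqVneq k ord0; first by exists ord_max.
  by rewrite eq_sym; exists ord0.
by apply/existsP; exists j; rewrite jk; apply/forallP => i; rewrite dcstE eq_sym.
Qed.

Definition horn_vertex n (k : 'I_n.+2) : horn k 0 := in_hornE (horn_vertex_subproof k).

Lemma horn_incl_inj n (k : 'I_n.+1) : inj (horn_incl k).
Proof. by move=> m x y; apply: val_inj. Qed.

(** The fibre over the vertex [k] includes by a weak equivalence in the part over the horn as well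
    as in [G], because the horn and the simplex both contract to [k]. *)
Lemma horn_pull_weq n (k : 'I_n.+2) (G P : sset) (p : smap G (stdsimplex n.+1))
    (a : smap P (horn k)) (b : smap P G) :
  kan_fibration p -> pbk a b (horn_incl k) p -> weq b.
Proof.
move=> kp pb; pose c := const_pt (horn_vertex k).
have pb1 := spull_pbk c a.
have w1 := contract_pull_weq (@horn_incl_inj _ k) (@horn_closed _ k) (k0 := horn_vertex k) erefl (pbk_kan pb kp) pb1.
apply: (weq_2of3l w1).
apply: (@contract_pull_weq n k (stdsimplex n.+1) (smap_id _) _ _ (dcst 0 k) erefl _ _ p _ _ kp).
- by move=> m x y.
- by move=> m t y _; exists y.
- have := pbk_paste pb pb1.
  have -> : smap_comp (horn_incl k) c = const_pt (dcst 0 k : stdsimplex n.+1 0).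
    exact: (@smap_eq pt (stdsimplex n.+1)).
  by apply.
Qed.

(** * Extension of fibrations along horns *)

Section Pushforward.
Variables (A B V : sset) (j : smap A B) (q : smap V A).
Hypotheses (ij : inj j) (tq : trivial_fib q).

(* An element over [b] is a partial section of [q] over the part of the simplex [b] lying in [A],
   encoded by its graph. *)
Definition psec n := (B n * (forall m, delta m n -> V m -> Prop))%type.

Definition psec_ok n (z : psec n) : Prop :=
  [/\ forall m (d : delta m n) v, z.2 m d v -> j m (q m v) = sact d z.1,
      forall m (d : delta m n) v v', z.2 m d v -> z.2 m d v' -> v = v',
      forall m (d : delta m n) a, j m a = sact d z.1 -> exists v, z.2 m d v &
      forall m p (d : delta m n) (e : delta p m) v, z.2 m d v -> z.2 p (dcomp d e) (sact e v)].

Definition psec_act m n (g : delta m n) (z : psec n) : psec m :=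
  (sact g z.1, fun p d v => z.2 p (dcomp g d) v).

Lemma psec_act_ok m n (g : delta m n) (z : psec n) : psec_ok z -> psec_ok (psec_act g z).
Proof.
case: z => b S [/= h1 h2 h3 h4]; split=> /=.
- by move=> p d v /h1 ->; rewrite sact_comp.
- by move=> p d v v'; apply: h2.
- by move=> p d a; rewrite -sact_comp; apply: h3.
- by move=> p r d e v /(h4 _ _ _ e); rewrite dcompA.
Qed.

(* The dependent product of [q] along [j]. *)
Definition pushforward : sset.
Proof.
apply: (@SSet (fun n => {z : psec n | psec_ok z})
  (fun m n g z => exist _ (psec_act g (proj1_sig z)) (psec_act_ok g (proj2_sig z)))).
- move=> n [[b S] h]; apply: eq_exist; rewrite /psec_act /= sact_id; congr pair.
  apply: functional_extensionality_dep => m; apply/funext => d; apply/funext => v.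
  by rewrite dcomp_idl.
- move=> m n p g f [[b S] h]; apply: eq_exist; rewrite /psec_act /= sact_comp; congr pair.
  apply: functional_extensionality_dep => r; apply/funext => d; apply/funext => v.
  by rewrite dcompA.
Defined.

Definition pushforward_map : smap pushforward B :=
  @SMap pushforward B (fun n z => (proj1_sig z).1) (fun _ _ _ _ => erefl).

(** Partial sections over the same simplex have the same domain, so inclusion of their graphs is
    already equality. *)
Lemma pushforward_eq n (z z' : pushforward n) : (proj1_sig z).1 = (proj1_sig z').1 ->
  (forall m d v, (proj1_sig z).2 m d v -> (proj1_sig z').2 m d v) -> z = z'.
Proof.
case: z z' => [[b S] [/= h1 h2 h3 h4]] [[b' S'] [/= h1' h2' h3' h4']] /= e SS; subst b'.
apply: eq_exist; congr pair.
apply: functional_extensionality_dep => m; apply/funext => d; apply/funext => v.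
apply/propext; split=> [|s']; first exact: SS.
have [v0 s0] := h3 _ _ _ (h1' _ _ _ s').
by rewrite (h2' _ _ _ _ s' (SS _ _ _ s0)).
Qed.

Lemma pushforward_incl_ok n (v : V n) :
  psec_ok (j n (q n v), fun m (d : delta m n) v' => v' = sact d v).
Proof.
split=> /=.
- by move=> m d v' ->; rewrite !smap_nat.
- by move=> m d v1 v2 -> ->.
- by move=> m d a _; exists (sact d v).
- by move=> m p d e v' ->; rewrite sact_comp.
Qed.

Definition pushforward_incl : smap V pushforward.
Proof.
apply: (@SMap V pushforward (fun n v => exist _ _ (pushforward_incl_ok v))).
move=> m n d v; apply: pushforward_eq => /=; first by rewrite !smap_nat.
by move=> p e v'; rewrite sact_comp.
Defined.

(** Over a simplex of [A] the partial section is total, and it is determined by its value at the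
    identity. The dependent product therefore restricts to [V] along the injection [j]. *)
Lemma pushforward_pbk : pbk q pushforward_incl j pushforward_map.
Proof.
split=> //.
- move=> n a z /= e; case: (z) (e) => [[b S] [/= h1 h2 h3 h4]] /= e'.
  have [|v Sv] := h3 n (did n) a; first by rewrite sact_id.
  exists v; split; first by apply: ij; rewrite e' (h1 _ _ _ Sv) sact_id.
  apply: pushforward_eq => /=; first by rewrite (h1 _ _ _ Sv) sact_id.
  by move=> m d v' ->; have := h4 _ _ _ d _ Sv; rewrite dcomp_idl.
- move=> n v v' _ /(congr1 (fun z => (proj1_sig z).2 n (did n) v)) /= h.
  have e : v = sact (did n) v' by rewrite -h; symmetry; apply: sact_id.
  by rewrite e; apply: sact_id.
Qed.

(** By adjunction a lifting problem against [i] is one for [q] against the base change [ki] of [i]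
    along [j], again an injection. *)
Lemma pushforward_trivial_fib : trivial_fib pushforward_map.
Proof.
move=> K L i ii u v uv.
pose LA := spull v j; pose KA := spull (smap_comp v i) j.
have hk n (z : KA n) : spull_sub v j n (i n (proj1_sig z).1, (proj1_sig z).2).
  by case: z => [[k a] h].
pose ki : smap KA LA := @scorestr KA _ (spull_sub v j)
   (smap_pair (smap_comp i (spull_fst _ _)) (spull_snd _ _)) hk.
have iki : inj ki.
  move=> n [[k a] h] [[k' a'] h'] /(congr1 (@proj1_sig _ _)) /= [/ii ek ea].
  by apply: eq_exist; rewrite ek ea.
have [x xP] : exists x : smap KA V, forall n z, (proj1_sig (u n (proj1_sig z).1)).2 n (did n) (x n z).
  apply: (@ex_smap KA V (fun n z v => (proj1_sig (u n (proj1_sig z).1)).2 n (did n) v)).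
  - move=> n [[k a] /= h]; have := uv n k; case: (u n k) => [[b S] [/= h1 h2 h3 h4]] /= e.
    by apply: (h3 n (did n) a); rewrite sact_id e -h.
  - by move=> n [[k a] /= h] v1 v2; case: (u n k) => [[b S] [/= h1 h2 h3 h4]]; apply: h2.
  - move=> m n d [[k a] /= h] v1; rewrite smap_nat /=.
    case: (u n k) => [[b S] [/= h1 h2 h3 h4]] /= s.
    by have := h4 _ _ _ d _ s; rewrite dcomp_idl dcomp_idr.
have [|y [yx qy]] := tq iki (u := x) (v := spull_snd v j).
  move=> n z; have := xP n z; case: z => [[k a] /= h]; have := uv n k.
  case: (u n k) => [[b S] [/= h1 h2 h3 h4]] /= e s.
  by apply: ij; rewrite (h1 _ _ _ s) sact_id e -h.
have wok n (l : L n) : psec_ok (v n l, fun m (d : delta m n) x =>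
    exists a (h : spull_sub v j m (sact d l, a)), x = y m (exist _ (sact d l, a) h)).
  split=> /=.
  - by move=> m d v1 [a [h ->]]; rewrite qy /= -smap_nat.
  - move=> m d v1 v2 [a [h ->]] [a' [h' ->]]; congr (y m _); apply: (@ssub_eq _ (spull_sub v j)); congr pair.
    by apply: ij; rewrite -[LHS]h -[RHS]h'.
  - move=> m d a e; have h : spull_sub v j m (sact d l, a) by rewrite /= smap_nat e.
    by exists (y m (exist _ _ h)), a, h.
  - move=> m p d e v1 [a [h ->]].
    have h' : spull_sub v j p (sact (dcomp d e) l, sact e a).
      by have := @sc_act _ (spull_sub v j) _ _ e (sact d l, a) h; rewrite /= sact_comp.
    exists (sact e a), h'; rewrite -smap_nat; congr (y p _); apply: (@ssub_eq _ (spull_sub v j)).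
    by rewrite /= sact_comp.
have wn m n (d : delta m n) (l : L n) :
    (exist _ _ (wok m (sact d l)) : pushforward m) = sact d (exist _ _ (wok n l) : pushforward n).
  apply: pushforward_eq => /=; first by rewrite smap_nat.
  move=> p e v1 [a [h ->]].
  have h' : spull_sub v j p (sact (dcomp d e) l, a) by rewrite sact_comp.
  exists a, h'; congr (y p _); apply: (@ssub_eq _ (spull_sub v j)); by rewrite /= sact_comp.
exists (@SMap L pushforward _ wn); split=> // n k.
apply: pushforward_eq => /=; first by rewrite -uv.
move=> m d v1 [a [h ->]].
have h' : spull_sub (smap_comp v i) j m (sact d k, a) by move: h; rewrite /= !smap_nat.
have -> : exist _ (sact d (i n k), a) h = ki m (exist _ _ h') by apply: (@ssub_eq _ (spull_sub v j)); rewrite /= smap_nat.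
by rewrite yx; have := xP m (exist _ _ h'); rewrite /= smap_nat /= dcomp_idr.
Qed.
End Pushforward.

Definition extends_along (E K L : sset) (p : smap E K) (j : smap K L) : Prop :=
  exists (E' : sset) (p' : smap E' L) (c : smap E E'), kan_fibration p' /\ pbk p c j p'.

(** The dependent product of [q] along the inclusion of [U] in the extension of [p] leaves [q]
    unchanged over [U]. *)
Lemma extends_trivial_fib (U V K L : sset) (q : smap V U) (p : smap U K) (j : smap K L) :
  inj j -> trivial_fib q -> extends_along p j -> extends_along (smap_comp p q) j.
Proof.
move=> ij tq [U' [p' [c [kp pb]]]].
have ic : inj c by apply: pbk_injr pb ij.
exists (pushforward c q), (smap_comp p' (pushforward_map c q)), (pushforward_incl c q).
have pb' := pushforward_pbk q ic.
have kq := trivial_fib_kan (pushforward_trivial_fib ic tq).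
split; first exact: kan_comp kq kp.
split.
- by move=> n v /=; rewrite (pbk_comm pb).
- move=> n k z /= e; have [u [pu cu]] := pbk_ex pb e.
  have [v [qv vz]] := pbk_ex pb' cu; exists v; split=> //.
  by rewrite -pu -qv.
- move=> n v v' _ e; apply: (pbk_uniq pb') => //.
  by apply: ic; rewrite !(pbk_comm pb') e.
Qed.

Lemma trivial_fib_homotopy_rel (X Y K L : sset) (q : smap X Y) (j : smap K L) (f g : smap L X)
    (F : smap (sprod K unitI) X) : trivial_fib q -> inj j ->
  (forall n l, q n (f n l) = q n (g n l)) ->
  homotopy (smap_comp f j) (smap_comp g j) F ->
  (forall n k t, q n (F n (k, t)) = q n (f n (j n k))) ->
  exists H, [/\ homotopy f g H, forall n k t, H n (j n k, t) = F n (k, t) &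
               forall n l t, q n (H n (l, t)) = q n (f n l)].
Proof.
move=> tq ij fg hF qF.
pose R n (z : sprod L unitI n) (x : X n) :=
  [\/ z.2 = vert false n /\ x = f n z.1, z.2 = vert true n /\ x = g n z.1 |
      exists k, j n k = z.1 /\ x = F n (k, z.2)].
have Rf n z x x' : R n z x -> R n z x' -> x = x'.
  have ft : vert false n <> vert true n := @vert_ft n.
  case=> [[a ->]|[a ->]|[k [a ->]]] [[b ->]|[b ->]|[k' [b ->]]] //.
  - by case: ft; rewrite -a.
  - by rewrite a -b (hF n k').1.
  - by case: ft; rewrite -b.
  - by rewrite a -b (hF n k').2.
  - by rewrite b -a (hF n k).1.
  - by rewrite b -a (hF n k).2.
  - by rewrite -b in a; rewrite (ij _ _ _ a).
have Ra m n (d : delta m n) z x : R n z x -> R m (sact d z) (sact d x).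
  case=> [[a ->]|[a ->]|[k [a ->]]].
  - by apply: Or31; rewrite -smap_nat; split=> //; rewrite /= a; apply: vert_act.
  - by apply: Or32; rewrite -smap_nat; split=> //; rewrite /= a; apply: vert_act.
  - by apply: Or33; exists (sact d k); rewrite /= -a -!smap_nat.
have Sa m n (d : delta m n) z : (exists x, R n z x) -> exists x, R m (sact d z) x.
  by case=> x h; exists (sact d x); apply: Ra.
pose S := Subc Sa.
have [u uP] : exists u : smap (ssub S) X, forall n z, R n (proj1_sig z) (u n z).
  apply: (@ex_smap (ssub S) X (fun n z x => R n (proj1_sig z) x)).
  - by move=> n [z h].
  - by move=> n z x x'; apply: Rf.
  - by move=> m n d z x; apply: Ra.
have [|H [Hu qH]] := tq _ _ _ (@sincl_inj _ S) u (smap_comp q (smap_comp f (smap_fst _ _))).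
  move=> n z; have := uP n z; case: z => [[l t] h] /= [[/= _ ->]|[/= _ ->]|[k [/= a ->]]] //.
  by rewrite qF a.
have HR n z x : R n z x -> H n z = x.
  move=> r; apply: etrans (Hu n (exist _ z (ex_intro _ x r))) _.
  exact: Rf (uP n (exist _ z (ex_intro _ x r))) r.
exists H; split.
- by move=> n l; split; apply: HR; [apply: Or31|apply: Or32].
- by move=> n k t; apply: HR; apply: Or33; exists k.
- by move=> n l t; rewrite qH.
Qed.

(** The section [s] makes [U] a fibrewise deformation retract of [V]. Let [U'] consist of the
    simplices of [V'] all of whose restrictions lying in [V] lie in [U]. Homotopy lifting extends
    the deformation to [V'], constantly on [U'], and its end [r] is a retraction to [U'] over [L].
    Hence [U'] inherits the Kan condition from [V'], and it meets [V] exactly in [U]. *)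
Lemma extends_trivial_fib_base (U V K L : sset) (q : smap V U) (p : smap U K) (j : smap K L) :
  inj j -> trivial_fib q -> extends_along (smap_comp p q) j -> extends_along p j.
Proof.
move=> ij tq [V' [p' [c [kp pb]]]].
have ic : inj c by apply: pbk_injr pb ij.
have [s qs] := trivial_fib_section tq.
have js : inj s by move=> n u u' e; rewrite -(qs n u) e qs.
have [|||H [hH Hs qH]] := @trivial_fib_homotopy_rel _ _ _ _ q s (smap_id V) (smap_comp s q)
    (smap_comp s (smap_fst _ _)) tq js.
- by move=> n v; rewrite /= qs.
- by move=> n u; rewrite /= qs.
- by [].
pose P n (z : V' n) := forall m (d : delta m n) x, c m x = sact d z -> exists u, s m u = x.
have Pa m n (d : delta m n) z : P n z -> P m (sact d z).
  by move=> h r e x; rewrite -sact_comp; apply: h.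
pose U' := Subc Pa.
have sU n u : U' n (c n (s n u)).
  by move=> m d x; rewrite -!smap_nat => /ic ->; exists (sact d u).
have Ma m n (d : delta m n) z : (exists v, c n v = z) \/ U' n z ->
    (exists v, c m v = sact d z) \/ U' m (sact d z).
  case=> [[v <-]|h]; last by right; apply: sc_act.
  by left; exists (sact d v); rewrite smap_nat.
pose M := Subc Ma.
have [F FP] : exists F : smap (sprod (ssub M) unitI) V', forall n z,
    (exists v, c n v = proj1_sig z.1 /\ F n z = c n (H n (v, z.2))) \/
    (U' n (proj1_sig z.1) /\ F n z = proj1_sig z.1).
  apply: (@ex_smap (sprod (ssub M) unitI) V' (fun n z y =>
    (exists v, c n v = proj1_sig z.1 /\ y = c n (H n (v, z.2))) \/
    (U' n (proj1_sig z.1) /\ y = proj1_sig z.1))).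
  - move=> n [[z [[v e]|h]] t] /=; last by exists z; right.
    by exists (c n (H n (v, t))); left; exists v.
  - have agree n z v t : c n v = z -> U' n z -> c n (H n (v, t)) = z.
      move=> <- h; have [u <-] := h n (did n) v (esym (sact_id _)).
      by rewrite Hs.
    move=> n [[z hz] t] y y' /= [[v [e ->]]|[h ->]] [[v' [e' ->]]|[h' ->]] //.
    + by rewrite -e' in e; rewrite (ic _ _ _ e).
    + exact: agree.
    + by symmetry; apply: agree.
  - move=> m n d [[z hz] t] y /= [[v [e ->]]|[h ->]].
      by left; exists (sact d v); rewrite smap_nat e -!smap_nat.
    by right; split=> // r e x; rewrite -sact_comp; apply: h.
have [|||h [h0 hF ph]] := @homotopy_lifting false (ssub M) V' V' L p' (sincl M) kp (@sincl_inj _ M)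
    (smap_id V') F (smap_comp p' (smap_fst _ _)).
- move=> n z; case: (FP n (z, vert false n)) => [[v [/= e ->]]|[_ ->]] //.
  by rewrite (hH n v).1 /= e.
- by [].
- move=> n z t; case: (FP n (z, t)) => [[v [/= e ->]]|[_ ->]] //.
  by rewrite -(pbk_comm pb) -e -(pbk_comm pb) /= qH.
pose r := smap_comp h (at_end V' true).
have rU n z : U' n (r n z).
  move=> m d x; rewrite -smap_nat /r at_end_comp => e.
  (* A restriction of [r z] that lies in [V] lies over [K]. The deformation being fibrewise, the
     same restriction of [z] lies over [K], hence in [V], and was moved into [U]. *)
  have e1 : j m (smap_comp p q m x) = p' m (sact d z) by rewrite (pbk_comm pb) e ph.
  have [v [_ cv]] := pbk_ex pb e1.
  have hM : M m (sact d z) by left; exists v.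
  have := hF m (exist _ _ hM) (vert true m); rewrite [sincl M m _]/(sact d z) -e.
  case: (FP m (exist _ _ hM, vert true m)) => [[v' [/= _ ->]]|[hU /= ->]].
    by rewrite (hH m v').2 /= => /ic ->; exists (q m v').
  by move=> e'; apply: (hU m (did m)); rewrite sact_id e'.
have rid n z : U' n z -> r n z = z.
  move=> hz; have hM : M n z by right.
  rewrite /r at_end_comp -[z]/(sincl M n (exist _ z hM)) hF.
  case: (FP n (exist _ _ hM, vert true n)) => [[v [/= cv ->]]|[_ ->]] //.
  rewrite (hH n v).2 /=; have [u su] := hz n (did n) v (etrans cv (esym (sact_id _))).
  by rewrite -cv -su qs.
exists (ssub U'), (smap_comp p' (sincl U')), (@scorestr _ _ U' (smap_comp c s) sU); split.
  move=> n k; apply/lifts_has_lifting => u v uv.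
  have [|w [wu pw]] := (lifts_has_lifting _ _).2 (kp n k) (smap_comp (sincl U') u) v.
    exact: uv.
  exists (@scorestr _ _ U' (smap_comp r w) (fun n x => rU n (w n x))); split=> m x.
    apply: ssub_eq; apply: etrans (congr1 (r m) (wu m x)) _; apply: rid.
    exact: (proj2_sig (u m x)).
  rewrite -[LHS]/(p' m (r m (w m x))) /r at_end_comp ph; exact: pw.
split.
- by move=> n u; rewrite -[RHS]/(p' n (c n (s n u))) -(pbk_comm pb) /= qs.
- move=> n k [z hz] /= e; have [v [pv cv]] := pbk_ex pb e.
  have [u su] := hz n (did n) v (etrans cv (esym (sact_id _))).
  exists u; split; first by rewrite -pv -su /= qs.
  by apply: eq_exist; rewrite su.
- by move=> n u u' _ /(congr1 (@proj1_sig _ _)) /= /ic/js.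
Qed.

Section Sections.
Variables (T G : sset) (p : smap G (sprod T unitI)).

(** The simplices are sections of [p] along the interval: a point of [T] with a path in [G] over its
    segment. *)
Definition path_sub : subc (sprod T (mapping_space unitI G)).
Proof.
apply: (@Subc (sprod T (mapping_space unitI G)) (fun n z => forall m s (d : delta m n),
   p m (mapping_eval z.2 m (s, d)) = (sact d z.1, s))).
by move=> m n g [t f] h r s d; apply: etrans (h r s (dcomp g d)) _; rewrite /= sact_comp.
Defined.

(** Lifting against evaluation at [e] is, by adjunction, homotopy lifting for [p] with the end [e]
    prescribed. *)
Lemma path_ev (e : bool) (P : sset) (a : smap P T) (b : smap P G) :
  kan_fibration p -> pbk a b (at_end T e) p ->
  exists q : smap (ssub path_sub) P, trivial_fib q /\ forall n z, a n (q n z) = (proj1_sig z).1.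
Proof.
move=> kp pb.
pose ev := smap_comp (suncurry (smap_comp (smap_snd _ _) (sincl path_sub))) (at_end _ e).
have evE n z : ev n z = mapping_eval (proj1_sig z).2 n (vert e n, did n).
  by rewrite at_end_comp.
have [|q qP] := @pbk_desc _ _ _ _ _ _ _ _ _ (smap_comp (smap_fst _ _) (sincl path_sub)) ev pb.
  move=> n [[t f] h]; rewrite evE; apply: etrans (at_endE e t) _; symmetry.
  by apply: etrans (h n (vert e n) (did n)) _; rewrite sact_id.
exists q; split; last by move=> n z; rewrite (qP n z).1.
move=> K L i ii u v uv.
pose u2 := smap_comp (smap_snd _ _) (smap_comp (sincl path_sub) u).
have [|||h [hu hv ph]] := @homotopy_lifting e K L G _ p i kp ii (smap_comp b v) (suncurry u2)
    (sprod_map (smap_comp a v) (smap_id _)).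
- by move=> n k; rewrite /= -uv (qP n _).2 evE.
- by move=> n l; rewrite -(pbk_comm pb) at_endE.
- move=> n k s; have := proj2_sig (u n k) n s (did n); rewrite sact_id => {1}->.
  by rewrite /= -uv (qP n _).1.
have hp n l : path_sub n (a n (v n l), scurry h n l).
  by move=> m s d /=; rewrite ph /= !smap_nat.
exists (@scorestr _ _ path_sub (smap_pair (smap_comp a v) (scurry h)) hp); split=> n x.
- apply: ssub_eq; rewrite [LHS](_ : _ = (a n (v n (i n x)), scurry h n (i n x))) //.
  rewrite -uv (qP n _).1 (surjective_pairing (proj1_sig (u n x))); congr pair.
  rewrite -[RHS]/(u2 n x) -(suncurry_scurry u2); apply: smap_eq => m [s d].
  by rewrite -[LHS]/(h m (sact d (i n x), s)) -smap_nat hv.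
- apply: (pbk_uniq pb); first by rewrite (qP n _).1.
  rewrite (qP n _).2 evE -[LHS]/(h n (sact (did n) x, vert e n)) sact_id.
  exact: hu.
Qed.
End Sections.

(** The sections along the homotopy evaluate to both base changes. A span of trivial fibrations,
    rather than a fibre homotopy equivalence, is the comparison along which [extends_along] can be
    transported. *)
Lemma homotopic_span (T L G P0 P1 : sset) (p : smap G L) (f0 f1 : smap T L)
    (a0 : smap P0 T) (b0 : smap P0 G) (a1 : smap P1 T) (b1 : smap P1 G) :
  kan_fibration p -> homotopic f0 f1 -> pbk a0 b0 f0 p -> pbk a1 b1 f1 p ->
  exists (Q : sset) (q0 : smap Q P0) (q1 : smap Q P1),
    [/\ trivial_fib q0, trivial_fib q1 & smap_comp a0 q0 = smap_comp a1 q1].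
Proof.
move=> kp [H hH] pb0 pb1; have kH := pbk_kan (spull_pbk H p) kp.
have [d0 [pd0 _]] := pbk_end (fun n x => (hH n x).1) pb0.
have [d1 [pd1 _]] := pbk_end (fun n x => (hH n x).2) pb1.
have [q0 [t0 e0]] := path_ev kH pd0; have [q1 [t1 e1]] := path_ev kH pd1.
exists _, q0, q1; split=> //.
by apply: smap_eq => n z; rewrite /= e0 e1.
Qed.

(* Over a contractible base a Kan fibration is connected with a product by trivial fibrations, and a
   product extends to any larger base. *)
Theorem horn_extends n (k : 'I_n.+2) (E : sset) (p : smap E (horn k)) :
  kan_fibration p -> extends_along p (horn_incl k).
Proof.
move=> kp; have ij := @horn_incl_inj n.+1 k.
have [m [h1 h2]] := @contract_homotopic n k (horn k) (horn_incl k) ij (@horn_closed n k) (horn_vertex k) erefl.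
have pbm := spull_pbk m p.
(* Base change along a constant map is the product with the fibre over [k], and the constant map of
   the horn extends to the simplex. *)
pose cD := const_map (stdsimplex n.+1) (horn_vertex k).
pose cL := const_map (horn k) (horn_vertex k).
have pbD := spull_pbk cD p.
have pbL := spull_pbk (horn_incl k) (spull_fst cD p).
have pbc : pbk (spull_fst (horn_incl k) (spull_fst cD p))
    (smap_comp (spull_snd cD p) (spull_snd (horn_incl k) (spull_fst cD p))) cL p.
  rewrite (_ : cL = smap_comp cD (horn_incl k)); last exact: smap_eq.
  exact: pbk_paste pbD pbL.
have [Q2 [r0 [r1 [tr0 tr1 er]]]] := homotopic_span kp h2 pbc pbm.
have [Q1 [q0 [q1 [tq0 tq1 eq]]]] := homotopic_span kp h1 (pbk_id p) pbm.
(* The goal moves from [p] through [Q1] to the base change along [m], then through [Q2] to the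
   product, up and down one trivial fibration each time. *)
apply: (extends_trivial_fib_base ij tq0); rewrite eq.
apply: (extends_trivial_fib ij tq1).
apply: (extends_trivial_fib_base ij tr1); rewrite -er.
apply: (extends_trivial_fib ij tr0).
exists (spull cD p), (spull_fst cD p), (spull_snd (horn_incl k) (spull_fst cD p)).
by split=> //; apply: pbk_kan pbD kp.
Qed.

(** * Kan replacement and base change along weak equivalences *)

Section PushoutConstruction.
Variables (A B C : sset) (i : smap A B) (f : smap A C).
Hypothesis ii : inj i.

Let po n : Type := (C n + {b : B n | ~ exists a, i n a = b})%type.

Let po_in n (b : B n) : po n :=
  match pselect (exists a, i n a = b) with
  | left h => inl (f n (projT1 (cid h)))
  | right h => inr (exist _ b h)
  end.

Let po_in_i n a : po_in (i n a) = inl (f n a).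
Proof.
rewrite /po_in; case: pselect => [h|[]]; last by exists a.
by case: cid => a' /= /ii ->.
Qed.

Let po_in_not n b (h : ~ exists a, i n a = b) : po_in b = inr (exist _ b h).
Proof.
rewrite /po_in; case: pselect => // h'; congr (inr (exist _ _ _)); exact: Prop_irrelevance.
Qed.

Let po_act m n (d : delta m n) (z : po n) : po m :=
  match z with inl c => inl (sact d c) | inr z => po_in (sact d (proj1_sig z)) end.

Let po_act_in m n (d : delta m n) b : po_act d (po_in b) = po_in (sact d b).
Proof.
have [[a <-]|h] := pselect (exists a, i n a = b); last by rewrite (po_in_not h).
by rewrite po_in_i -smap_nat po_in_i /= smap_nat.
Qed.

Let po_sset : sset.
Proof.
apply: (@SSet po po_act).
- by move=> n [c|[b h]] /=; rewrite sact_id // (po_in_not h).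
- move=> m n p g d [c|z]; first by rewrite /= sact_comp.
  by rewrite /= po_act_in sact_comp.
Defined.

Lemma ex_mpush : exists (D : sset) (g : smap B D) (j : smap C D), mpush i f g j.
Proof.
exists po_sset, (@SMap B po_sset po_in (fun m n d b => esym (po_act_in d b))),
  (@SMap C po_sset (fun n c => inl c) (fun _ _ _ _ => erefl)).
split=> //.
- by move=> n c c' [].
- move=> n [c|[b h]]; first by left; exists c.
  by right; exists b; apply: po_in_not.
- move=> n b b' /=; have [[a <-]|h] := pselect (exists a, i n a = b); first by right; exists a.
  rewrite (po_in_not h); have [[a <-]|h'] := pselect (exists a, i n a = b').
    by rewrite po_in_i.
  by rewrite (po_in_not h') => -[->]; left.
- move=> n b c /=; have [//|h] := pselect (exists a, i n a = b).
  by rewrite (po_in_not h).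
Qed.
End PushoutConstruction.

Definition scoprod (J : Type) (X : J -> sset) : sset.
Proof.
apply: (@SSet (fun n => {j & X j n}) (fun m n d z => existT _ (projT1 z) (sact d (projT2 z)))).
- by move=> n [j x]; rewrite sact_id.
- by move=> m n p g f [j x]; rewrite sact_comp.
Defined.

Definition scoprod_in (J : Type) (X : J -> sset) (j : J) : smap (X j) (scoprod X) :=
  @SMap (X j) (scoprod X) (fun n x => existT _ j x) (fun _ _ _ _ => erefl).

Definition scoprod_index (J : Type) (X : J -> sset) : smap (scoprod X) (disc J) :=
  @SMap (scoprod X) (disc J) (fun n z => projT1 z) (fun _ _ _ _ => erefl).

Definition scoprod_desc (J : Type) (X : J -> sset) (Y : sset) (f : forall j, smap (X j) Y) :
  smap (scoprod X) Y :=
  @SMap (scoprod X) Y (fun n z => f (projT1 z) n (projT2 z))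
    (fun m n d z => smap_nat (f (projT1 z)) d (projT2 z)).

Definition scoprod_map (J : Type) (X Y : J -> sset) (f : forall j, smap (X j) (Y j)) :
  smap (scoprod X) (scoprod Y) :=
  scoprod_desc (fun j => smap_comp (scoprod_in Y j) (f j)).

Lemma existT_inj (J : Type) (P : J -> Type) (j : J) (x y : P j) :
  existT P j x = existT P j y -> x = y.
Proof.
move=> e; have := projT2_eq e; rewrite /=.
by rewrite (Prop_irrelevance (projT1_eq e) erefl).
Qed.

Lemma scoprod_map_pbk (J : Type) (X Y : J -> sset) (f : forall j, smap (X j) (Y j)) (j : J) :
  pbk (f j) (scoprod_in X j) (scoprod_in Y j) (scoprod_map f).
Proof.
split=> //.
- move=> n y [j' x] /= e; have ej : j = j' by have := projT1_eq e.
  by subst j'; exists x; split=> //; rewrite (existT_inj e).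
- by move=> n x y _ e; exact: (existT_inj e).
Qed.

Lemma scoprod_map_inj (J : Type) (X Y : J -> sset) (f : forall j, smap (X j) (Y j)) :
  (forall j, inj (f j)) -> inj (scoprod_map f).
Proof.
move=> jf n [j x] [j' x'] /= e; have ej : j = j' by have := projT1_eq e.
by subst j'; congr (existT _ j _); apply: jf (existT_inj e).
Qed.

(** * Descent and stability under base change *)

Section Descent.
Variables (A B C D EA EB EC ED : sset).
Variables (i : smap A B) (f : smap A C) (g : smap B D) (j : smap C D).
Variables (i' : smap EA EB) (f' : smap EA EC) (g' : smap EB ED) (j' : smap EC ED).
Variables (pA : smap EA A) (pB : smap EB B) (pC : smap EC C) (pD : smap ED D).
Hypotheses (mp : mpush i f g j) (mp' : mpush i' f' g' j').
Hypotheses (pbi : pbk pA i' i pB) (pbf : pbk pA f' f pC).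
Hypotheses (gD : forall n x, g n (pB n x) = pD n (g' n x)) (jD : forall n x, j n (pC n x) = pD n (j' n x)).

(** Together with [descent_left] this is the van Kampen property of pushouts along injections:
    gluing total spaces over glued bases changes neither of the given pieces. *)
Lemma descent_right : pbk pC j' j pD.
Proof.
have [_ ij cm _ _ mt] := mp; have [_ ij' cm' cv' _ _] := mp'.
split=> //; last by move=> n x y _ /ij'.
move=> n c d e; have [[x xd]|[b bd]] := cv' n d.
  by exists x; split=> //; apply: ij; rewrite jD xd.
have [a ab] : exists a, i n a = pB n b by apply: (mt n _ c); rewrite gD bd.
have [z [za zb]] := pbk_ex pbi ab.
exists (f' n z); split; last by rewrite -cm' zb.
by apply: ij; rewrite jD -cm' zb bd.
Qed.

Lemma descent_left : pbk pB g' g pD.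
Proof.
have [ii ij cm cv sp mt] := mp; have [ii' ij' cm' cv' sp' mt'] := mp'.
split=> //.
- have key n a z : j n (f n a) = pD n (j' n z) ->
      exists x, pB n x = i n a /\ g' n x = j' n z.
    rewrite -jD => /ij e; have [x [xa xz]] := pbk_ex pbf e.
    by exists (i' n x); rewrite cm' xz -(pbk_comm pbi) xa.
  move=> n b d e; have [[x xd]|[b' bd]] := cv' n d.
    have [a ab] : exists a, i n a = b by apply: (mt n b (pC n x)); rewrite jD xd.
    by rewrite -ab -xd; apply: key; rewrite -cm ab xd.
  have [<-|[a ab]] := sp n (pB n b') b (etrans (gD _) (etrans (congr1 (pD n) bd) (esym e))).
    by exists b'.
  have [z [za zb]] := pbk_ex pbi ab.
  have d2 : d = j' n (f' n z) by rewrite -cm' zb.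
  have [a' ab'] : exists a', i n a' = b.
    by apply: (mt n b (pC n (f' n z))); rewrite jD -d2.
  by rewrite -ab' d2; apply: key; rewrite -cm ab' -d2.
- move=> n b b' eb eg; have [//|[z zb]] := sp' _ _ _ eg.
  have [z' zb'] : exists z', i' n z' = b' by apply: (mt' n b' (f' n z)); rewrite -eg -zb cm'.
  rewrite -zb -zb'; congr (i' n _); apply: (pbk_uniq pbf).
    by apply: ii; rewrite !(pbk_comm pbi) zb zb'.
  by apply: ij'; rewrite -!cm' zb zb'.
Qed.
End Descent.

Lemma pull_mpush (A B C D EA EB EC ED : sset)
  (i : smap A B) (f : smap A C) (g : smap B D) (j : smap C D)
  (i' : smap EA EB) (f' : smap EA EC) (g' : smap EB ED) (j' : smap EC ED)
  (pA : smap EA A) (pB : smap EB B) (pC : smap EC C) (pD : smap ED D) :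
  mpush i f g j -> pbk pB g' g pD -> pbk pC j' j pD -> pbk pA i' i pB ->
  (forall n x, pC n (f' n x) = f n (pA n x)) -> (forall n x, j' n (f' n x) = g' n (i' n x)) ->
  mpush i' f' g' j'.
Proof.
move=> [ii ij cm cv sp mt] pg pj pi cf cg.
split=> //; try exact: pbk_injr pj ij.
- exact: pbk_injr pi ii.
- move=> n d; have [[c e]|[b e]] := cv n (pD n d).
    by have [x [_ xd]] := pbk_ex pj e; left; exists x.
  by have [x [_ xd]] := pbk_ex pg e; right; exists x.
- move=> n b b' e.
  have e2 : g n (pB n b) = g n (pB n b') by rewrite !(pbk_comm pg) e.
  have [e3|[a ab]] := sp _ _ _ e2; first by left; apply: (pbk_uniq pg).
  by have [x [_ xb]] := pbk_ex pi ab; right; exists x.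
- move=> n b c e; have [a ab] : exists a, i n a = pB n b.
    by apply: (mt n _ (pC n c)); rewrite (pbk_comm pg) (pbk_comm pj) e.
  by have [x [_ xb]] := pbk_ex pi ab; exists x.
Qed.

(** Right properness is built into this notion, which is then checked for horn inclusions,
    coproducts, pushouts and sequential unions: all that a Kan replacement is made of. *)
Definition stable_cof (X Y : sset) (f : smap X Y) : Prop :=
  inj f /\ forall (G P : sset) (p : smap G Y) (a : smap P X) (b : smap P G),
    kan_fibration p -> pbk a b f p -> trivial_cof b.

Lemma horn_stable_cof n (k : 'I_n.+2) : stable_cof (horn_incl k).
Proof.
split=> [|G P p a b kp pb]; first exact: horn_incl_inj.
by apply: weq_trivial_cof; [apply: pbk_injr pb (@horn_incl_inj _ k)|apply: horn_pull_weq kp pb].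
Qed.

(** Base change preserves pushouts along injections, by [pull_mpush], so the base change of [j] is a
    pushout of a base change of [i]. *)
Lemma stable_cof_mpush (A B C D : sset) (i : smap A B) (f : smap A C) (g : smap B D) (j : smap C D) :
  mpush i f g j -> stable_cof i -> stable_cof j.
Proof.
move=> mp [ii si]; split=> [|G P p a b kp pb]; first exact: mpush_injr mp.
have pg := spull_pbk g p; have pi := spull_pbk i (spull_fst g p).
have [|f' f'P] := @pbk_desc _ _ _ _ _ _ _ _ _ (smap_comp f (spull_fst i (spull_fst g p)))
    (smap_comp (spull_snd g p) (spull_snd i (spull_fst g p))) pb.
  by move=> n z; rewrite /= -(mpush_comm mp) (pbk_comm pi) (pbk_comm pg).
have mp' : mpush (spull_snd i (spull_fst g p)) f' (spull_snd g p) b.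
  apply: pull_mpush mp pg pb pi _ _ => n z; first by rewrite (f'P n z).1.
  by rewrite (f'P n z).2.
apply: trivial_cof_mpush mp' _; exact: si _ _ _ _ _ (pbk_kan pg kp) pi.
Qed.

Lemma stable_cof_coprod (J : Type) (X Y : J -> sset) (f : forall j, smap (X j) (Y j)) :
  (forall j, stable_cof (f j)) -> stable_cof (scoprod_map f).
Proof.
move=> sf; have jf : inj (scoprod_map f) by apply: scoprod_map_inj => j; case: (sf j).
split=> // G P p a b kp pb; apply: weq_trivial_cof; first exact: pbk_injr pb jf.
pose aG := smap_comp (scoprod_index Y) p; pose aP := smap_comp (scoprod_index X) a.
have h j n x : fibre aP j n x -> fibre aG j n (b n x).
  by rewrite /= -(pbk_comm pb).
apply: (@weq_coprod _ _ J b aG aP h) => j.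
have [q qP] : exists q : smap (ssub (fibre aG j)) (Y j), forall n z, scoprod_in Y j n (q n z) = p n (proj1_sig z).
  apply: (@ex_smap (ssub (fibre aG j)) (Y j) (fun n z y => scoprod_in Y j n y = p n (proj1_sig z))).
  - move=> n [g /= e]; case: (p n g) e => [j' y] /= e; subst j'; by exists y.
  - by move=> n z y y' <- e; exact: esym (existT_inj e).
  - by move=> m n d z y e; rewrite /= !smap_nat -e.
have pq : pbk q (sincl (fibre aG j)) (scoprod_in Y j) p.
  split=> //.
  - move=> n y g e; have hg : fibre aG j n g by rewrite /= -e.
    exists (exist _ g hg); split=> //.
    by apply: (@existT_inj _ (fun j => Y j n) j); exact: etrans (qP n (exist _ g hg)) (esym e).
  - by move=> n x y _; apply: ssub_eq.
have [r rP] : exists r : smap (ssub (fibre aP j)) (X j), forall n z, scoprod_in X j n (r n z) = a n (proj1_sig z).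
  apply: (@ex_smap (ssub (fibre aP j)) (X j) (fun n z y => scoprod_in X j n y = a n (proj1_sig z))).
  - move=> n [g /= e]; case: (a n g) e => [j' y] /= e; subst j'; by exists y.
  - by move=> n z y y' <- e; exact: esym (existT_inj e).
  - by move=> m n d z y e; rewrite /= !smap_nat -e.
have pr : pbk r (sub_map (@h j)) (f j) q.
  split.
  - move=> n x; apply: (@existT_inj _ (fun j => Y j n) j); apply: etrans (esym (qP n (sub_map (@h j) n x))).
    by rewrite /= -(pbk_comm pb) -rP.
  - move=> n x [g hg] /= e.
    have e2 : scoprod_map f n (existT _ j x) = p n g.
      by apply: etrans (qP n (exist _ g hg)); rewrite /= -e.
    have [y [ya yb]] := pbk_ex pb e2.
    have hy : fibre aP j n y by rewrite /= ya.
    exists (exist _ y hy); split; last by apply: eq_exist.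
    by apply: (@existT_inj _ (fun j => X j n) j); exact: etrans (rP n (exist _ y hy)) ya.
  - move=> n x y er e; apply: ssub_eq; apply: (pbk_uniq pb); first by rewrite -!rP er.
    by have {}e : b n (proj1_sig x) = b n (proj1_sig y) := congr1 (@proj1_sig _ _) e.
apply: trivial_cof_weq; have [_ s] := sf j.
exact: s _ _ _ _ _ (pbk_kan pq kp) pr.
Qed.

Lemma stable_cof_weq (X Y : sset) (f : smap X Y) : stable_cof f -> weq f.
Proof.
move=> [_ s]; apply: trivial_cof_weq; apply: (s _ _ (smap_id Y) (smap_id X)).
  by apply: trivial_fib_kan => A B i _ u v uv; exists v; split=> n a //; rewrite -uv.
by split=> // n t g e; exists t.
Qed.

Record fib := Fib { fib_base : sset; fib_total : sset; fib_map : smap fib_total fib_base;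
                    fib_kan : kan_fibration fib_map }.

(* A fibration is replaced together with its base: it is extended over a Kan complex without changing
   it over the original base. *)
Record fib_ext (F F' : fib) := FibExt {
  fib_ext_base : smap (fib_base F) (fib_base F');
  fib_ext_total : smap (fib_total F) (fib_total F');
  fib_ext_pbk : pbk (fib_map F) fib_ext_total fib_ext_base (fib_map F');
  fib_ext_stable : stable_cof fib_ext_base }.

Definition fills (X Y : sset) (f : smap X Y) : Prop :=
  forall n (k : 'I_n.+2) (u : smap (horn k) X), exists v : smap (stdsimplex n.+1) Y,
    forall m a, v m (horn_incl k m a) = f m (u m a).

(** A simplex is attached to [Y] along every horn in it, and to [E] an extension over that simplex
    of the base change of [p] to the horn. By descent the new map restricts to [p] over [Y] and to
    the chosen extensions over the simplices, so it is a Kan fibration by [kan_local]. *)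
Lemma fib_step (F : fib) : {F' : fib & {e : fib_ext F F' | fills (fib_ext_base e)}}.
Proof.
suff : exists F' : fib, exists e : fib_ext F F', fills (fib_ext_base e).
  by move=> /cid[F' /cid[e h]]; exists F', e.
case: F => Y E p kp.
pose J := {n : nat & {k : 'I_n.+2 & smap (horn k) Y}}.
pose L (j : J) := horn (projT1 (projT2 j)); pose D (j : J) := stdsimplex (projT1 j).+1.
pose u (j : J) : smap (L j) Y := projT2 (projT2 j).
pose hi (j : J) : smap (L j) (D j) := horn_incl (projT1 (projT2 j)).
have si : stable_cof (scoprod_map hi) by apply: stable_cof_coprod => j; exact: horn_stable_cof.
have [Y1 [g [y mp]]] := ex_mpush (scoprod_desc u) si.1.
have ext j : {E' : sset & {p' : smap E' (D j) & {c : smap (spull (u j) p) E' |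
    kan_fibration p' /\ pbk (spull_fst (u j) p) c (hi j) p'}}}.
  have kj : kan_fibration (spull_fst (u j) p) := pbk_kan (spull_pbk (u j) p) kp.
  by have /cid[E' /cid[p' /cid[c h]]] := horn_extends kj; exists E', p', c.
pose E' j := projT1 (ext j); pose p' j : smap (E' j) (D j) := projT1 (projT2 (ext j)).
pose c j : smap (spull (u j) p) (E' j) := proj1_sig (projT2 (projT2 (ext j))).
have kp' j : kan_fibration (p' j) := (proj2_sig (projT2 (projT2 (ext j)))).1.
have pc j : pbk (spull_fst (u j) p) (c j) (hi j) (p' j) := (proj2_sig (projT2 (projT2 (ext j)))).2.
have ic j : inj (c j) by apply: pbk_injr (pc j) _; apply: horn_incl_inj.
have [E1 [eg [e mpE]]] := ex_mpush (scoprod_desc (fun j => spull_snd (u j) p)) (scoprod_map_inj ic).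
have [|p1 [p1g p1e]] := @mpush_desc _ _ _ _ Y1 _ _ _ _ (smap_comp g (scoprod_map p')) (smap_comp y p) mpE.
  move=> n [j z] /=.
  rewrite -(pbk_comm (spull_pbk (u j) p)) -(pbk_comm (pc j)).
  exact: (mpush_comm mp (existT (fun j => L j n) j (spull_fst (u j) p n z))).
pose pA := scoprod_map (fun j => spull_fst (u j) p).
have pbi : pbk pA (scoprod_map c) (scoprod_map hi) (scoprod_map p').
  split.
  - by move=> n [j z] /=; congr existT; exact: pbk_comm (pc j) n z.
  - move=> n [j t] [j' z] /= e0; have ej : j = j' by have := projT1_eq e0.
    subst j'; have [x [xt xz]] := pbk_ex (pc j) (existT_inj e0).
    by exists (existT _ j x); rewrite -xt -xz.
  - move=> n [j x] [j' x'] /= e0 e1; have ej : j = j' by have := projT1_eq e0.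
    subst j'; congr (existT _ j _); apply: (pbk_uniq (pc j)).
      exact: (@existT_inj J (fun j => L j n) j _ _ e0).
    exact: (@existT_inj J (fun j => E' j n) j _ _ e1).
have pbf : pbk pA (scoprod_desc (fun j => spull_snd (u j) p)) (scoprod_desc u) p.
  split.
  - by move=> n [j z] /=; exact: pbk_comm (spull_pbk (u j) p) n z.
  - move=> n [j t] z /= e0.
    have [x [xt xz]] := pbk_ex (spull_pbk (u j) p) e0.
    by exists (existT _ j x); rewrite -xt -xz.
  - move=> n [j x] [j' x'] /= e0 e1; have ej : j = j' by have := projT1_eq e0.
    subst j'; congr (existT _ j _); apply: (pbk_uniq (spull_pbk (u j) p)) => //.
    exact: (@existT_inj J (fun j => L j n) j _ _ e0).
have dl := descent_left mp mpE pbi pbf (fun n x => esym (p1g n x)) (fun n x => esym (p1e n x)).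
have dr := descent_right mp mpE pbi (fun n x => esym (p1g n x)) (fun n x => esym (p1e n x)).
have kp1 : kan_fibration p1.
  apply: kan_local => n y1; have [[y0 <-]|[[j x] <-]] := mpush_cover mp y1.
    by exists E, Y, p, e, y; split=> //; exists y0.
  exists (E' j), (D j), (p' j), (smap_comp eg (scoprod_in E' j)), (smap_comp g (scoprod_in D j)).
  split=> //; last by exists x.
  exact: pbk_paste dl (scoprod_map_pbk p' j).
exists (Fib kp1); exists (@FibExt (Fib kp) (Fib kp1) y e dr (stable_cof_mpush mp si)).
move=> n k w; pose j : J := existT _ n (existT _ k w).
exists (smap_comp g (scoprod_in D j)) => m a /=.
exact: (mpush_comm mp (existT (fun j => L j m) j a)).
Qed.

Section Replacement.
Variable F0 : fib.
Definition fib_seq : nat -> fib := fix s k := if k is k'.+1 then projT1 (fib_step (s k')) else F0.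
Definition fib_seq_ext k : fib_ext (fib_seq k) (fib_seq k.+1) := proj1_sig (projT2 (fib_step (fib_seq k))).
Lemma fib_seq_fills k : fills (fib_ext_base (fib_seq_ext k)).
Proof. exact: proj2_sig (projT2 (fib_step (fib_seq k))). Qed.

Let Y k := fib_base (fib_seq k).
Let E k := fib_total (fib_seq k).
Let p k : smap (E k) (Y k) := fib_map (fib_seq k).
Let y k : smap (Y k) (Y k.+1) := fib_ext_base (fib_seq_ext k).
Let e k : smap (E k) (E k.+1) := fib_ext_total (fib_seq_ext k).
Let pb k : pbk (p k) (e k) (y k) (p k.+1) := fib_ext_pbk (fib_seq_ext k).
Let sy k : stable_cof (y k) := fib_ext_stable (fib_seq_ext k).
Let iy k : inj (y k) := (sy k).1.
Let ie k : inj (e k) := pbk_injr (pb k) (@iy k).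

(** A horn in the colimit of the bases comes from some stage and is filled in the next. The squares
    remain Cartesian and the limit map remains a Kan fibration, as both are checked on one simplex
    at a time. *)
Lemma kan_replacement : exists (F : fib) (x : fib_ext F0 F), kan_complex (fib_base F).
Proof.
pose Y' := colim y; pose E' := colim e.
have [p' p'P] : exists p' : smap E' Y', forall k n x, p' n (colim_in e k n x) = colim_in y k n (p k n x).
  have [|p' p'P] := @colim_desc E e Y' (fun k => smap_comp (colim_in y k) (p k)).
    by move=> k n x; rewrite /= -(pbk_comm (pb k)) [LHS]colim_in_step.
  by exists p'.
have pbw k : pbk (p k) (colim_in e k) (colim_in y k) p'.
  split.
  - by move=> n x; rewrite p'P.
  (* A simplex over stage [k] that is represented at stage [i + k] is brought down one stage at a
     time through the Cartesian squares. *)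
  - have key i : forall n t z, colim_in y k n t = colim_in y (i + k) n (p (i + k) n z) ->
        exists x, p k n x = t /\ colim_in e k n x = colim_in e (i + k) n z.
      elim: i => [|i IH] n t z; first by move/(colim_in_inj iy) => ->; exists z.
      have [t' tt'] := colim_in_late y t (leq_addl i k).
      rewrite -tt' -(colim_in_step y) => /(colim_in_inj iy) e1.
      have [z' [pz' ez']] := pbk_ex (pb (i + k)) e1.
      have [|x [px ex]] := IH n t z'; first by rewrite -tt' pz'.
      by exists x; rewrite ex -[colim_in e (i.+1 + k) n z](_ : colim_in e (i + k).+1 n (e (i + k) n z') = _) ?ez' // -colim_in_step ez'.
    move=> n t z ez; have [k' H] := colim_common z.
    have [z' zz'] := H (k' + k) (leq_addr _ _).
    have [|x [px ex]] := key k' n t z'; first by rewrite ez -zz' p'P.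
    by exists x; rewrite ex zz'.
  - by move=> n x x' _ /(colim_in_inj ie).
have kp' : kan_fibration p'.
  apply: kan_local => n t; have [k [x ex]] := colim_cover t.
  exists (E k), (Y k), (p k), (colim_in e k), (colim_in y k); split=> //.
    exact: fib_kan (fib_seq k).
  by exists x.
have kY : kan_complex Y'.
  move=> n k u; have [N NP] := horn_colim u iy; have [v vP] := NP N (leqnn N).
  have [w wP] := fib_seq_fills v; exists (smap_comp (colim_in y N.+1) w).
  by apply: smap_eq => m a; rewrite /= vP -[RHS](colim_in_step y) -[y N]/(fib_ext_base (fib_seq_ext N)) -wP.
have sY : stable_cof (colim_in y 0).
  split=> [|G P q a b kq pq]; first exact: (@colim_in_inj _ _ iy 0).
  (* The total space [G] is filtered by its parts over the stages; each inclusion is a base change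
     of [y k]. *)
  have Ta k m n (d : delta m n) (z : G n) : (exists t, colim_in y k n t = q n z) ->
      exists t, colim_in y k m t = q m (sact d z).
    by case=> t et; exists (sact d t); rewrite !smap_nat et.
  pose T k : subc G := Subc (Ta k).
  have Tm k n z : T k n z -> T k.+1 n z.
    by case=> t et; exists (y k n t); rewrite colim_in_step.
  have rT k : exists r : smap (ssub (T k)) (Y k), forall n z, colim_in y k n (r n z) = q n (proj1_sig z).
    apply: (@ex_smap (ssub (T k)) (Y k) (fun n z t => colim_in y k n t = q n (proj1_sig z))).
    - by move=> n [z].
    - by move=> n z t t' <- /(colim_in_inj iy).
    - by move=> m n d z t et; rewrite smap_nat et -smap_nat.
  have tow : trivial_cof (sincl (T 0)).
    apply: (@tower_trivial_cof _ T Tm).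
      by move=> n z; have [k [t et]] := colim_cover (q n z); exists k, t.
    move=> k; have [r rP] := rT k; have [r' r'P] := rT k.+1.
    have pr' : pbk r' (sincl (T k.+1)) (colim_in y k.+1) q.
      split=> // [n t z et|n z z' _]; last exact: ssub_eq.
      have hz : T k.+1 n z by exists t.
      by exists (exist _ z hz); split=> //; apply: (colim_in_inj iy); rewrite r'P.
    apply: (sy k).2 (pbk_kan pr' kq) (_ : pbk r _ _ _).
    split.
    - by move=> n z; apply: (colim_in_inj iy); rewrite colim_in_step rP r'P.
    - move=> n t z et; have hz : T k n (proj1_sig z).
        by exists t; rewrite -r'P -et colim_in_step.
      exists (exist _ _ hz); split; last exact: ssub_eq.
      by apply: (colim_in_inj iy); rewrite rP -r'P -et colim_in_step.
    - move=> n z z' _ ez; apply: ssub_eq.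
      by have {}ez : proj1_sig z = proj1_sig z' := congr1 (@proj1_sig _ _) ez.
  have bT n x : T 0 n (b n x) by exists (a n x); rewrite (pbk_comm pq).
  apply: weq_trivial_cof; first exact: pbk_injr pq (@colim_in_inj _ _ iy 0).
  apply: (@weq_eq _ _ (smap_comp (sincl (T 0)) (@scorestr _ _ (T 0) b bT))) => //.
  apply: weq_comp (trivial_cof_weq tow); apply: bij_weq.
    move=> n x x' ex; apply: (pbk_injr pq (@colim_in_inj _ _ iy 0)).
    by have {}ex : b n x = b n x' := congr1 (@proj1_sig _ _) ex.
  move=> n [z [t et]]; have [x [_ xz]] := pbk_ex pq et; exists x; exact: ssub_eq.
exists (Fib kp'), (@FibExt F0 (Fib kp') (colim_in y 0) (colim_in e 0) (pbw 0) sY).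
exact: kY.
Qed.
End Replacement.

Lemma trivial_cof_extend (X Y Z : sset) (f : smap X Y) (u : smap X Z) :
  trivial_cof f -> kan_complex Z -> exists v : smap Y Z, forall n x, v n (f n x) = u n x.
Proof.
move=> [_ tf] kZ.
have [|h [hf _]] := tf Z kZ svoid pt (svoid_map pt) (@svoid_inj pt)
    (smap_comp u (smap_fst _ _)) (smap_comp (svoid_map _) (smap_snd Y svoid)).
  by move=> n x [].
by exists (smap_comp h (smap_pair (smap_id Y) (bang Y))) => n x; rewrite /= hf.
Qed.

(** Between Kan replacements of [X] and [Y] the map [w] becomes a homotopy equivalence [w'], along
    which base change is already understood. The comparison [m] of the two base changes is a base
    change of the stable inclusion [x], and two-out-of-three leads back to [b]. *)
Theorem weq_pullback (X Y E P : sset) (p : smap E Y) (w : smap X Y) (a : smap P X) (b : smap P E) :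
  kan_fibration p -> weq w -> pbk a b w p -> weq b.
Proof.
move=> kp ww pb.
have kid : kan_fibration (smap_id X).
  by apply: trivial_fib_kan => A B i _ u v uv; exists v; split=> n c //; rewrite -uv.
have [[Y' E' p' kp'] [[/= y e py sy] /= kY]] := kan_replacement (Fib kp).
(* The identity fibration is used to obtain a Kan replacement of [X] alone. *)
have [[X' X'' i' ki'] [[/= x x2 px sx] /= kX]] := kan_replacement (Fib kid).
have tx : trivial_cof x by apply: weq_trivial_cof; [case: sx|apply: stable_cof_weq].
have [w' w'P] := trivial_cof_extend (smap_comp y w) tx kY.
have ww' : weq w'.
  apply: weq_2of3l (stable_cof_weq sx) _.
  apply: weq_eq (weq_comp ww (stable_cof_weq sy)) => n z; by rewrite /= w'P.
have pw := spull_pbk w' p'.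
have wb : weq (spull_snd w' p').
  have /weqP hw := ww'.
  (* Testing [w'] on [X'] produces a left homotopy inverse, and testing it on [Y'] shows that this
     is also a right inverse. *)
  have [g gw] := (hw X' kX).1 (smap_id X').
  apply: pull_hequiv_weq (rst_step _ _ _ _ gw) _ kp' pw.
  apply: rst_step; apply: (hw Y' kY).2.
  have := homotopic_compl w' gw; rewrite smap_comp_id.
  by rewrite (_ : smap_comp (smap_id Y') w' = w') //; apply: smap_eq.
have [|m mP] := @pbk_desc _ _ _ _ _ _ _ _ _ (smap_comp x a) (smap_comp e b) pw.
  by move=> n z; rewrite /= w'P /= (pbk_comm pb) (pbk_comm py).
have pm : pbk a m x (spull_fst w' p').
  split.
  - by move=> n z; rewrite (mP n z).1.
  - move=> n t z e0.
    have e1 : y n (w n t) = p' n (spull_snd w' p' n z) by rewrite -(pbk_comm pw) -e0 w'P.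
    have [z1 [pz ez]] := pbk_ex py e1.
    have [z2 [az bz]] := pbk_ex pb (esym pz).
    exists z2; split=> //; apply: (pbk_uniq pw); rewrite ?(mP n z2).1 ?(mP n z2).2 /=.
      by rewrite az e0.
    by rewrite bz ez.
  - move=> n z z' ea em; apply: (pbk_uniq pb) => //; apply: (pbk_injr py sy.1).
    by have := (mP n z).2; rewrite em (mP n z').2.
have wm : weq m by apply: trivial_cof_weq; apply: sx.2 (pbk_kan pw kp') pm.
have we : weq e by apply: trivial_cof_weq; apply: sy.2 kp' py.
apply: weq_2of3r we _; apply: weq_eq (weq_comp wm wb) => n z.
exact: (mP n z).2.
Qed.

(** * Right properness *)

(** Equal functors have object maps that are only propositionally equal, so their actions on
    hom-objects are compared after transport of both ends. *)
Definition hcast (A : scat) (x x' y y' : A) (e : x = x') (e' : y = y') :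
  smap (shom x y) (shom x' y') :=
  match e in _ = a, e' in _ = b return smap (shom x y) (shom a b) with
  | erefl, erefl => smap_id _
  end.

Lemma hcast_irr (A : scat) (x x' y y' : A) (e1 e2 : x = x') (e1' e2' : y = y') n u :
  hcast e1 e1' n u = hcast e2 e2' n u.
Proof. by rewrite (Prop_irrelevance e1 e2) (Prop_irrelevance e1' e2'). Qed.

Lemma hcast_id (A : scat) (x y : A) (e : x = x) (e' : y = y) n u : hcast e e' n u = u.
Proof. by rewrite (hcast_irr e erefl e' erefl). Qed.

Lemma hcast_trans (A : scat) (x x' x'' y y' y'' : A) (e1 : x = x') (e2 : x' = x'')
    (e1' : y = y') (e2' : y' = y'') n u :
  hcast e2 e2' n (hcast e1 e1' n u) = hcast (etrans e1 e2) (etrans e1' e2') n u.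
Proof. by subst. Qed.

Lemma hcast_map (A B : scat) (F : sfunctor A B) (x x' y y' : A) (e : x = x') (e' : y = y') n u :
  sfmap F x' y' n (hcast e e' n u) = hcast (congr1 F e) (congr1 F e') n (sfmap F x y n u).
Proof. by subst. Qed.

Lemma hcast_sid (A : scat) (x x' : A) (e e' : x = x') : hcast e e' 0 (sid x) = sid x'.
Proof. by rewrite (Prop_irrelevance e' e); subst. Qed.

Lemma hcast_cmp (A : scat) (x x' y y' z z' : A) (e : x = x') (e' : y = y') (e'' : z = z') n g f :
  hcast e e'' n (scmp x y z n (g, f)) = scmp x' y' z' n (hcast e' e'' n g, hcast e e' n f).
Proof. by subst. Qed.

Lemma smap_id_kan (X : sset) : kan_fibration (smap_id X).
Proof.
by apply: trivial_fib_kan => A B i _ u v uv; exists v; split=> n a //; rewrite -uv.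
Qed.

Lemma hcast_kan (A : scat) (x x' y y' : A) (e : x = x') (e' : y = y') : kan_fibration (hcast e e').
Proof. by subst; exact: smap_id_kan. Qed.

Lemma sfunctor_ext (A B : scat) (F G : sfunctor A B) (e : forall x, F x = G x) :
  (forall x y n u, hcast (e x) (e y) n (sfmap F x y n u) = sfmap G x y n u) -> F = G.
Proof.
case: F G e => [o m i c] [o' m' i' c'] /= e.
have eo : o = o' by apply/funext.
subst o' => h; apply: sfunctor_eq => x y; apply: smap_eq => n u.
by have := h x y n u; rewrite hcast_id.
Qed.

Lemma sfunctor_extE (A B : scat) (F G : sfunctor A B) : F = G ->
  exists e : forall x, F x = G x,
  forall x y n u, hcast (e x) (e y) n (sfmap F x y n u) = sfmap G x y n u.
Proof. by move=> <-; exists (fun _ => erefl). Qed.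

Lemma is_iso_inv (C : category) (x y : C) (f : hom x y) : is_iso f ->
  exists g : hom y x, is_iso g.
Proof. by move=> [g [gf fg]]; exists g, f. Qed.

Lemma is_iso_map (C D : category) (F : functor C D) (x y : C) (f : hom x y) :
  is_iso f -> is_iso (fmap F f).
Proof. by move=> [g [gf fg]]; exists (fmap F g); rewrite -!fmap_cmp gf fg !fmap_id. Qed.

Definition isomorphic (C : category) (x y : C) := exists f : hom x y, is_iso f.

Lemma isomorphic_refl (C : category) (x : C) : isomorphic x x.
Proof. by exists (idm x), (idm x); rewrite cmp_idl. Qed.

Lemma isomorphic_sym (C : category) (x y : C) : isomorphic x y -> isomorphic y x.
Proof. by move=> [f /is_iso_inv]. Qed.

Lemma isomorphic_map (C D : category) (F : functor C D) (x y : C) :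
  isomorphic x y -> isomorphic (F x) (F y).
Proof. by move=> [f /(is_iso_map F)]; exists (fmap F f). Qed.

Lemma bergner_weqP (A B : scat) (F : sfunctor A B) : bergner_weq F <->
  (forall x y, weq (sfmap F x y)) /\
  (forall y : B, exists x : A, @isomorphic (pi0_cat B) (F x) y).
Proof. by split=> -[h1 h2]; split=> // y; have [x h] := h2 y; exists x. Qed.

Lemma bergner_weq_retract (A B A' B' : scat) (F : sfunctor A B) (G : sfunctor A' B')
    (s : sfunctor A A') (r : sfunctor A' A) (s' : sfunctor B B') (r' : sfunctor B' B) :
  sfunctor_comp r s = sfunctor_id A -> sfunctor_comp r' s' = sfunctor_id B ->
  sfunctor_comp s' F = sfunctor_comp G s -> sfunctor_comp F r = sfunctor_comp r' G ->
  bergner_weq G -> bergner_weq F.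
Proof.
move=> /sfunctor_extE[/= ers rs] /sfunctor_extE[/= ers' rs'].
move=> /sfunctor_extE[/= esF sF] /sfunctor_extE[/= eFr Fr].
move=> /bergner_weqP[wG oG]; apply/bergner_weqP; split.
- move=> x y.
  have e2 z : r' (G (s z)) = F z by rewrite -eFr ers.
  apply: (@weq_retract _ _ _ _ (sfmap F x y) (sfmap G (s x) (s y)) (sfmap s x y)
    (smap_comp (hcast (ers x) (ers y)) (sfmap r (s x) (s y)))
    (smap_comp (hcast (esF x) (esF y)) (sfmap s' (F x) (F y)))
    (smap_comp (hcast (e2 x) (e2 y)) (sfmap r' (G (s x)) (G (s y))))) => //.
  + by move=> n u; exact: rs.
  + move=> n v /=; rewrite hcast_map hcast_trans.
    by rewrite -[RHS](rs' _ _ n v); apply: hcast_irr.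
  + by move=> n u; exact: sF.
  + move=> n u /=; rewrite -(Fr _ _ n u) hcast_map !hcast_trans; exact: hcast_irr.
- move=> y; have [x hx] := oG (s' y); exists (r x).
  have := isomorphic_map (pi0_functor r') hx; rewrite /= -eFr.
  by rewrite ers'.
Qed.

Section PullbackCat.
Variables (B C D : scat) (f : sfunctor B D) (p : sfunctor C D).

Definition pb_ob := {z : B * C | f z.1 = p z.2}.
Definition pb_right (z z' : pb_ob) : smap (shom (proj1_sig z).2 (proj1_sig z').2)
    (shom (f (proj1_sig z).1) (f (proj1_sig z').1)) :=
  smap_comp (hcast (esym (proj2_sig z)) (esym (proj2_sig z'))) (sfmap p _ _).
Definition pb_hom (z z' : pb_ob) : sset :=
  spull (sfmap f (proj1_sig z).1 (proj1_sig z').1) (pb_right z z').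

Lemma pb_sid_ok (z : pb_ob) : spull_sub (sfmap f _ _) (pb_right z z) 0 (sid (proj1_sig z).1, sid (proj1_sig z).2).
Proof. by rewrite /= !sfmap_id hcast_sid. Qed.

Lemma pb_cmp_ok (x y z : pb_ob) n (t : sprod (pb_hom y z) (pb_hom x y) n) :
  spull_sub (sfmap f _ _) (pb_right x z) n
   (scmp _ _ _ n ((proj1_sig t.1).1, (proj1_sig t.2).1), scmp _ _ _ n ((proj1_sig t.1).2, (proj1_sig t.2).2)).
Proof.
case: t => [[[g1 g2] hg] [[f1 f2] hf]] /=.
rewrite !sfmap_cmp (hcast_cmp _ (esym (proj2_sig y))).
by congr (scmp _ _ _ n (_, _)).
Qed.

Definition pb_cmp (x y z : pb_ob) : smap (sprod (pb_hom y z) (pb_hom x y)) (pb_hom x z).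
Proof.
apply: (@SMap (sprod (pb_hom y z) (pb_hom x y)) (pb_hom x z)
  (fun n t => exist (spull_sub (sfmap f _ _) (pb_right x z) n) _ (pb_cmp_ok t))).
by move=> m n d [[[g1 g2] hg] [[f1 f2] hf]]; apply: eq_exist; rewrite /= -!smap_nat.
Defined.

Definition pb_cat : scat.
Proof.
apply: (@SCat pb_ob pb_hom (fun z => exist _ _ (pb_sid_ok z)) pb_cmp).
- move=> x y n [[g1 g2] hg]; apply: eq_exist; congr pair; exact: scmp_idl.
- move=> x y n [[g1 g2] hg]; apply: eq_exist; congr pair; exact: scmp_idr.
- move=> x y z t n [[h1 h2] hh] [[g1 g2] hg] [[f1 f2] hf]; apply: eq_exist.
  by rewrite /= !scmpA.
Defined.

Definition pb_fst : sfunctor pb_cat B :=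
  @SFunctor pb_cat B (fun z => (proj1_sig z).1) (fun x y => spull_fst _ _)
    (fun _ => erefl) (fun _ _ _ _ _ _ => erefl).
Definition pb_snd : sfunctor pb_cat C :=
  @SFunctor pb_cat C (fun z => (proj1_sig z).2) (fun x y => spull_snd _ _)
    (fun _ => erefl) (fun _ _ _ _ _ _ => erefl).

Lemma pb_comm : sfunctor_comp f pb_fst = sfunctor_comp p pb_snd.
Proof.
have e (z : pb_cat) : sfunctor_comp f pb_fst z = sfunctor_comp p pb_snd z := proj2_sig z.
apply: (sfunctor_ext (e := e)) => x y n u /=.
have := proj2_sig u; rewrite /= => ->.
by rewrite hcast_trans hcast_id.
Qed.

Lemma pb_factor (A : scat) (h : sfunctor A B) (k : sfunctor A C) :
  sfunctor_comp f h = sfunctor_comp p k ->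
  exists t : sfunctor A pb_cat, sfunctor_comp pb_fst t = h /\ sfunctor_comp pb_snd t = k.
Proof.
move=> /sfunctor_extE[/= e eh].
pose o x : pb_ob := exist (fun z : B * C => f z.1 = p z.2) (h x, k x) (e x).
have hk x y n (u : shom x y n) : spull_sub (sfmap f _ _) (pb_right (o x) (o y)) n (sfmap h x y n u, sfmap k x y n u).
  by rewrite /= -eh hcast_trans hcast_id.
pose m x y : smap (shom x y) (pb_hom (o x) (o y)) :=
  @scorestr _ _ (spull_sub _ _) (smap_pair (sfmap h x y) (sfmap k x y)) (@hk x y).
have mi x : m x x 0 (sid x) = @sid pb_cat (o x) by apply: eq_exist; rewrite /= !sfmap_id.
have mc x y z n (v : shom y z n) (u : shom x y n) :
    m x z n (scmp x y z n (v, u)) = @scmp pb_cat (o x) (o y) (o z) n (m y z n v, m x y n u).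
  by apply: eq_exist; rewrite /= !sfmap_cmp.
pose t := @SFunctor A pb_cat o m mi mc; exists t; split.
  by apply: (@sfunctor_ext _ _ (sfunctor_comp pb_fst t) h (fun _ => erefl)).
by apply: (@sfunctor_ext _ _ (sfunctor_comp pb_snd t) k (fun _ => erefl)).
Qed.

(** On hom-objects this is [weq_pullback]. For essential surjectivity an isomorphism from [p c] to
    some [f b] is lifted to one starting at [c]; its other end lies strictly over [f b] and gives an
    object of the pullback. *)
Lemma pb_snd_weq : bergner_weq f -> bergner_fib p -> bergner_weq pb_snd.
Proof.
move=> /bergner_weqP[wf of_] [kp ip]; apply/bergner_weqP; split=> [z z'|c].
  apply: (weq_pullback _ (wf _ _) (spull_pbk _ _)); apply: kan_comp (kp _ _) _; exact: hcast_kan.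
have [b /isomorphic_sym[g ig]] := of_ (p c).
have [c' [h [ih e]]] := ip c (f b) g ig.
have e' : f b = p c' by have := projT1_eq e.
exists (exist _ (b, c') e'); apply: isomorphic_sym; by exists h.
Qed.
End PullbackCat.

(** The given pullback is compared with [pb_cat] only as a retract, which suffices since weak
    equivalences are stable under retracts. *)
Theorem bergner_right_proper : right_proper bergner_weq bergner_fib.
Proof.
move=> A B C D p' f' f p [cm univ] fp wf.
have [t [tB tC]] := pb_factor cm.
have [r [[rB rC] _]] := univ _ (pb_fst f p) (pb_snd f p) (pb_comm f p).
have [i [_ uni]] := univ A p' f' cm.
apply: (@bergner_weq_retract _ _ _ _ f' (pb_snd f p) t r (sfunctor_id C) (sfunctor_id C)).
- have e1 := uni (idm (A : SCAT)) (conj (cmp_idr (c := SCAT) p') (cmp_idr (c := SCAT) f')).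
  rewrite -[RHS]/(idm (A : SCAT)) -e1; symmetry.
  apply: (uni (cmp (c := SCAT) r t)); split.
    by apply: etrans (cmpA (c := SCAT) p' r t) _; rewrite rB; exact: tB.
  by apply: etrans (cmpA (c := SCAT) f' r t) _; rewrite rC; exact: tC.
- exact: (cmp_idl (c := SCAT) (sfunctor_id C)).
- by rewrite tC; exact: (cmp_idl (c := SCAT) f').
- apply: etrans rC _; symmetry; exact: (cmp_idl (c := SCAT) (pb_snd f p)).
- exact: pb_snd_weq.
Qed.

(** * Free extensions of simplicial categories *)

(** The type of objects is an index, so constructions that keep or prescribe the objects involve no
    transport. Composition is curried, with its naturality as a separate law. *)
Record fcat (O : Type) := FCat {
  fh : O -> O -> sset;
  fid : forall x, fh x x 0;
  fc : forall x y z n, fh y z n -> fh x y n -> fh x z n;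
  fc_nat : forall x y z m n (d : delta m n) (g : fh y z n) (f : fh x y n),
    fc (sact d g) (sact d f) = sact d (fc g f);
  fc_idl : forall x y n (f : fh x y n), fc (degen n (fid y)) f = f;
  fc_idr : forall x y n (f : fh x y n), fc f (degen n (fid x)) = f;
  fcA : forall x y z t n (h : fh z t n) (g : fh y z n) (f : fh x y n),
    fc h (fc g f) = fc (fc h g) f }.

Arguments fid {O} f x : rename.
Arguments fc {O f x y z n} g h : rename.

Record fmorph (O O' : Type) (q : O -> O') (A : fcat O) (B : fcat O') := FMorph {
  fm : forall x y, smap (fh A x y) (fh B (q x) (q y));
  fm_id : forall x, fm x x 0 (fid A x) = fid B (q x);
  fm_c : forall x y z n (g : fh A y z n) (f : fh A x y n),
    fm x z n (fc g f) = fc (fm y z n g) (fm x y n f) }.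

Lemma degen_smap (X Y : sset) (f : smap X Y) n (x : X 0) : f n (degen n x) = degen n (f 0 x).
Proof. by rewrite smap_nat. Qed.

Section Words.
Variables (O O' : Type) (o : O -> O') (C : fcat O') (K M : O -> O -> sset).
Variables (j : forall a b, smap (K a b) (M a b)) (g : forall a b, smap (K a b) (fh C (o a) (o b))).

(* [wcons c m w] is the formal composite [c m w]. *)
Inductive word (n : nat) (x y : O') : Type :=
| wnil (c : fh C x y n)
| wcons (a b : O) (c : fh C (o b) y n) (m : M a b n) (w : word n x (o a)).

Definition lact n x y z (c : fh C y z n) (w : word n x y) : word n x z :=
  match w with
  | wnil c' => wnil (fc c c')
  | wcons a b c' m w => wcons (fc c c') m w
  end.

Definition in_K a b n (m : M a b n) := exists k, j a b n k = m.

(** A letter from [K] is replaced by its image in [C] and merged with the coefficients on its two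
    sides. The words without such letters are the normal forms. *)
Fixpoint rd n x y (w : word n x y) : word n x y :=
  match w with
  | wnil c => wnil c
  | wcons a b c m w =>
    match pselect (in_K m) with
    | left e => lact (fc c (g a b n (projT1 (cid e)))) (rd w)
    | right _ => wcons c m (rd w)
    end
  end.

Fixpoint reduced n x y (w : word n x y) : Prop :=
  match w with
  | wnil _ => True
  | wcons a b c m w => ~ in_K m /\ reduced w
  end.

Fixpoint wact m n (d : delta m n) x y (w : word n x y) : word m x y :=
  match w with
  | wnil c => wnil (sact d c)
  | wcons a b c k w => wcons (sact d c) (sact d k) (wact d w)
  end.

Fixpoint wcat n x y z (w : word n y z) (v : word n x y) : word n x z :=
  match w with
  | wnil c => lact c v
  | wcons a b c m w => wcons c m (wcat w v)
  end.

Fixpoint wlen n x y (w : word n x y) : nat :=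
  match w with wnil _ => 0 | wcons _ _ _ _ w => (wlen w).+1 end.

Lemma lact_lact n x y z t (c : fh C z t n) (c' : fh C y z n) (w : word n x y) :
  lact c (lact c' w) = lact (fc c c') w.
Proof. by case: w => [c0|a b c0 m w] /=; rewrite fcA. Qed.

Lemma lact_id n x y (w : word n x y) : lact (degen n (fid C y)) w = w.
Proof. by case: w => [c0|a b c0 m w] /=; rewrite fc_idl. Qed.

Lemma reduced_lact n x y z (c : fh C y z n) (w : word n x y) : reduced w -> reduced (lact c w).
Proof. by case: w. Qed.

Lemma reduced_rd n x y (w : word n x y) : reduced (rd w).
Proof.
elim: y / w => //= y a b c m w IH.
by case: pselect => [e|ne] //; apply: reduced_lact.
Qed.

Lemma rd_reduced n x y (w : word n x y) : reduced w -> rd w = w.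
Proof.
by elim: y / w => //= y a b c m w IH [ne /IH ->]; case: pselect.
Qed.

Lemma wlen_lact n x y z (c : fh C y z n) (w : word n x y) : wlen (lact c w) = wlen w.
Proof. by case: w. Qed.

Lemma wlen_rd n x y (w : word n x y) : wlen (rd w) <= wlen w.
Proof.
elim: y / w => //= y a b c m w IH; case: pselect => [e|ne] //=.
by rewrite wlen_lact; apply: leqW.
Qed.

Lemma wlen_wact m n (d : delta m n) x y (w : word n x y) : wlen (wact d w) = wlen w.
Proof. by elim: y / w => //= y a b c k w ->. Qed.

Lemma wact_lact m n (d : delta m n) x y z (c : fh C y z n) (w : word n x y) :
  wact d (lact c w) = lact (sact d c) (wact d w).
Proof. by case: w => [c0|a b c0 k w] /=; rewrite fc_nat. Qed.

Lemma wact_id n x y (w : word n x y) : wact (did n) w = w.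
Proof. by elim: y / w => [y c|y a b c m w IH] /=; rewrite ?IH !sact_id. Qed.

Lemma wact_comp m n p (e : delta n p) (d : delta m n) x y (w : word p x y) :
  wact (dcomp e d) w = wact d (wact e w).
Proof. by elim: y / w => [y c|y a b c k w IH] /=; rewrite ?IH !sact_comp. Qed.

Lemma wcat_lact n x y z t (c : fh C z t n) (w : word n y z) (v : word n x y) :
  wcat (lact c w) v = lact c (wcat w v).
Proof. by case: w => [c0|a b c0 m w] //=; rewrite lact_lact. Qed.

Lemma wcatA n x y z t (u : word n z t) (w : word n y z) (v : word n x y) :
  wcat u (wcat w v) = wcat (wcat u w) v.
Proof.
by elim: t / u => [t c|t a b c m u IH] /=; [rewrite wcat_lact|rewrite IH].
Qed.

Lemma wcat_id n x y (w : word n x y) : wcat w (wnil (degen n (fid C x))) = w.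
Proof. by elim: y / w => [y c|y a b c m w IH] /=; rewrite ?fc_idr ?IH. Qed.

Lemma wact_wcat m n (d : delta m n) x y z (w : word n y z) (v : word n x y) :
  wact d (wcat w v) = wcat (wact d w) (wact d v).
Proof. by elim: z / w => [z c|z a b c k w IH] /=; [rewrite wact_lact|rewrite IH]. Qed.

Hypothesis ij : forall a b, inj (j a b).

Lemma rd_j n x y a b (c : fh C (o b) y n) (k : K a b n) (w : word n x (o a)) :
  rd (wcons c (j a b n k) w) = lact (fc c (g a b n k)) (rd w).
Proof.
rewrite /=; case: pselect => [e|[]]; last by exists k.
by case: cid => k' /= /ij ->.
Qed.

Lemma rd_notin n x y a b (c : fh C (o b) y n) (m : M a b n) (w : word n x (o a)) :
  ~ in_K m -> rd (wcons c m w) = wcons c m (rd w).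
Proof. by rewrite /=; case: pselect. Qed.

Lemma rd_wcons n x y a b (c : fh C (o b) y n) (m : M a b n) (w w' : word n x (o a)) :
  rd w = rd w' -> rd (wcons c m w) = rd (wcons c m w').
Proof. by move=> e; rewrite /= e. Qed.

Lemma rd_rd n x y (w : word n x y) : rd (rd w) = rd w.
Proof. by rewrite rd_reduced //; apply: reduced_rd. Qed.

Lemma rd_lact n x y z (c : fh C y z n) (w : word n x y) : rd (lact c w) = lact c (rd w).
Proof.
case: w => [//|a b c0 m w] /=; case: pselect => [e|ne] //.
by rewrite lact_lact fcA.
Qed.

(** A simplicial operator can move a letter into [K], so operators on reduced words have to reduce
    again. Reducing beforehand does not affect the result, which gives functoriality. *)
Lemma rd_wact m n (d : delta m n) x y (w : word n x y) : rd (wact d (rd w)) = rd (wact d w).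
Proof.
elim: y / w => [//|y a b c k w IH].
have [[k0 <-]|ne] := pselect (in_K k).
  rewrite rd_j wact_lact rd_lact IH.
  rewrite -[RHS]/(rd (wcons (sact d c) (sact d (j a b n k0)) (wact d w))) -smap_nat rd_j smap_nat.
  by rewrite fc_nat.
by rewrite rd_notin //=; apply: rd_wcons.
Qed.

Lemma rd_wcatl n x y z (w : word n y z) (v : word n x y) : rd (wcat (rd w) v) = rd (wcat w v).
Proof.
elim: z / w => [//|z a b c m w IH].
have [[k <-]|ne] := pselect (in_K m); last by rewrite rd_notin //=; apply: rd_wcons.
by rewrite rd_j wcat_lact rd_lact IH [wcat _ _]/= rd_j.
Qed.

Lemma rd_wcatr n x y z (w : word n y z) (v : word n x y) : rd (wcat w (rd v)) = rd (wcat w v).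
Proof.
elim: z / w => [z c|z a b c m w IH]; first by rewrite /= !rd_lact rd_rd.
exact: rd_wcons.
Qed.

(* The free extension of [C] by the arrows [M], with those of [K] identified through [g]. *)
Definition ext_simp n x y := {w : word n x y | reduced w}.
Definition ext_of n x y (w : word n x y) : ext_simp n x y := exist _ (rd w) (reduced_rd w).

Lemma ext_of_eq n x y (w w' : word n x y) : rd w = rd w' -> ext_of w = ext_of w'.
Proof. by move=> e; apply: eq_exist. Qed.

Lemma ext_ofK n x y (w : ext_simp n x y) : ext_of (proj1_sig w) = w.
Proof. by case: w => w h; apply: eq_exist; apply: rd_reduced. Qed.

Definition ext_hom (x y : O') : sset.
Proof.
apply: (@SSet (fun n => ext_simp n x y) (fun m n d w => ext_of (wact d (proj1_sig w)))).
- by move=> n [w h]; rewrite wact_id ext_ofK.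
- by move=> m n p e d [w h]; apply: ext_of_eq; rewrite /= wact_comp rd_wact.
Defined.

Lemma ext_act m n (d : delta m n) x y (w : word n x y) :
  sact d (ext_of w : ext_hom x y n) = ext_of (wact d w).
Proof. by apply: ext_of_eq; rewrite /= rd_wact. Qed.

Definition ext_cmp n x y z (w : ext_hom y z n) (v : ext_hom x y n) : ext_hom x z n :=
  ext_of (wcat (proj1_sig w) (proj1_sig v)).

Lemma ext_cmpE n x y z (w : word n y z) (v : word n x y) :
  ext_cmp (ext_of w : ext_hom y z n) (ext_of v : ext_hom x y n) = ext_of (wcat w v).
Proof. by apply: ext_of_eq; rewrite /= rd_wcatl rd_wcatr. Qed.

Lemma ext_ind n x y (P : ext_hom x y n -> Prop) : (forall w, P (ext_of w)) -> forall u, P u.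
Proof. by move=> h u; rewrite -(ext_ofK u). Qed.

Definition ext_id (x : O') : ext_hom x x 0 := ext_of (wnil (fid C x)).

Lemma degen_ext_id n x : degen n (ext_id x) = ext_of (wnil (degen n (fid C x))).
Proof. by rewrite /degen ext_act. Qed.

Lemma ext_cmp_nat x y z m n (d : delta m n) (u : ext_hom y z n) (v : ext_hom x y n) :
  ext_cmp (sact d u) (sact d v) = sact d (ext_cmp u v).
Proof.
elim/ext_ind: u => u; elim/ext_ind: v => v.
by rewrite (ext_act d u) (ext_act d v) (ext_cmpE u v) ext_act ext_cmpE wact_wcat.
Qed.

Lemma ext_idl x y n (u : ext_hom x y n) : ext_cmp (degen n (ext_id y)) u = u.
Proof. by elim/ext_ind: u => u; rewrite degen_ext_id ext_cmpE /= lact_id. Qed.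

Lemma ext_idr x y n (u : ext_hom x y n) : ext_cmp u (degen n (ext_id x)) = u.
Proof. by elim/ext_ind: u => u; rewrite degen_ext_id ext_cmpE wcat_id. Qed.

Lemma ext_cmpA x y z t n (u : ext_hom z t n) (v : ext_hom y z n) (w : ext_hom x y n) :
  ext_cmp u (ext_cmp v w) = ext_cmp (ext_cmp u v) w.
Proof.
by elim/ext_ind: u => u; elim/ext_ind: v => v; elim/ext_ind: w => w; rewrite !ext_cmpE wcatA.
Qed.

Definition ext : fcat O' := FCat ext_cmp_nat ext_idl ext_idr ext_cmpA.

Definition ext_in_map (x y : O') : smap (fh C x y) (ext_hom x y) :=
  @SMap (fh C x y) (ext_hom x y) (fun n c => ext_of (wnil c))
    (fun m n d c => esym (ext_act d (wnil c))).

Definition ext_in : fmorph (fun x => x) C ext.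
Proof.
by apply: (@FMorph _ _ (fun x => x) C ext ext_in_map).
Defined.

Definition ext_gen_fun a b n (m : M a b n) : ext_hom (o a) (o b) n :=
  ext_of (wcons (degen n (fid C _)) m (wnil (degen n (fid C _)))).

Definition ext_gen (a b : O) : smap (M a b) (ext_hom (o a) (o b)).
Proof.
apply: (@SMap (M a b) (ext_hom (o a) (o b)) (@ext_gen_fun a b)).
by move=> m n d c; rewrite /ext_gen_fun ext_act /= !sact_degen.
Defined.

Lemma ext_gen_j a b n (k : K a b n) : ext_gen a b n (j a b n k) = ext_in_map (o a) (o b) n (g a b n k).
Proof. by apply: ext_of_eq; rewrite rd_j /= fc_idl fc_idr. Qed.

Lemma ext_in_inj x y : inj (ext_in_map x y).
Proof. by move=> n c c' /(congr1 (@proj1_sig _ _)) /= []. Qed.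

Lemma ext_gen_inj a b : (inj (g a b)) -> inj (ext_gen a b).
Proof.
move=> ig n m m' /(congr1 (@proj1_sig _ _)).
have [[k <-]|h] := pselect (in_K m); have [[k' <-]|h'] := pselect (in_K m').
- by rewrite [LHS]rd_j [RHS]rd_j /= !fc_idl !fc_idr => -[/ig ->].
- by rewrite [LHS]rd_j [RHS]rd_notin.
- by rewrite [RHS]rd_j [LHS]rd_notin.
- rewrite [LHS]rd_notin // [RHS]rd_notin //=.
  (* This reads off the outermost letter with its indices; the value on [wnil] is a default, as only
     words with a letter are compared. *)
  pose f (w : word n (o a) (o b)) : {ab : O * O & M ab.1 ab.2 n} :=
    if w is wcons a' b' _ m0 _ then existT _ (a', b') m0 else existT _ (a, b) m.
  move=> /(congr1 f) /= e.
  exact: (@existT_inj _ (fun ab : O * O => M ab.1 ab.2 n) (a, b) _ _ e).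
Qed.

Section Universal.
Variables (O2 : Type) (q : O' -> O2) (T : fcat O2) (phi : fmorph q C T).
Variable mu : forall a b, smap (M a b) (fh T (q (o a)) (q (o b))).
Hypothesis mu_j : forall a b n k, mu a b n (j a b n k) = fm phi (o a) (o b) n (g a b n k).

Fixpoint wev n x y (w : word n x y) : fh T (q x) (q y) n :=
  match w with
  | wnil c => fm phi x _ n c
  | wcons a b c m w => fc (fm phi _ _ n c) (fc (mu a b n m) (wev w))
  end.

Lemma wev_lact n x y z (c : fh C y z n) (w : word n x y) : wev (lact c w) = fc (fm phi _ _ n c) (wev w).
Proof. by case: w => [c0|a b c0 m w] /=; rewrite fm_c -?fcA. Qed.

Lemma wev_rd n x y (w : word n x y) : wev (rd w) = wev w.
Proof.
elim: y / w => [//|y a b c m w IH].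
have [[k <-]|ne] := pselect (in_K m); last by rewrite rd_notin //= IH.
by rewrite rd_j wev_lact IH /= mu_j fm_c fcA.
Qed.

Lemma wev_wact m n (d : delta m n) x y (w : word n x y) : wev (wact d w) = sact d (wev w).
Proof.
elim: y / w => [y c|y a b c k w IH] /=; first exact: smap_nat.
by rewrite IH !smap_nat -!fc_nat.
Qed.

Lemma wev_wcat n x y z (w : word n y z) (v : word n x y) : wev (wcat w v) = fc (wev w) (wev v).
Proof. by elim: z / w => [z c|z a b c m w IH] /=; rewrite ?wev_lact ?IH // !fcA. Qed.

Lemma wev_nat x y m n (d : delta m n) (u : ext_hom x y n) :
  wev (proj1_sig (sact d u)) = sact d (wev (proj1_sig u)).
Proof. by rewrite /= wev_rd wev_wact. Qed.

Definition ext_desc : fmorph q ext T.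
Proof.
apply: (@FMorph _ _ q ext T (fun x y => @SMap (ext_hom x y) _ (fun n u => wev (proj1_sig u)) (@wev_nat x y))).
- by move=> x /=; rewrite fm_id.
- by move=> x y z n u v /=; rewrite wev_rd wev_wcat.
Defined.

Lemma ext_desc_gen a b n m : fm ext_desc (o a) (o b) n (ext_gen a b n m) = mu a b n m.
Proof.
rewrite -[LHS]/(wev (rd _)) wev_rd /= !degen_smap !fm_id.
by rewrite fc_idl fc_idr.
Qed.
End Universal.

(** The inequality is strict so that stage 0 is empty, as [weq_union] requires; stage 1 is [C]. *)
Definition ext_filt (k : nat) (x y : O') : subc (ext_hom x y).
Proof.
apply: (@Subc (ext_hom x y) (fun n w => wlen (proj1_sig w) < k)).
move=> m n d w /= h; apply: leq_ltn_trans (wlen_rd _) _.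
by rewrite wlen_wact.
Defined.

Lemma ext_filt_mono k x y n w : ext_filt k x y n w -> ext_filt k.+1 x y n w.
Proof. exact: leqW. Qed.

Section Attach.
Variables (k : nat) (x y : O').
Let F k y := ssub (ext_filt k x y).
(** A coefficient, an outermost letter, and a reduced tail of length at most [k]: together a word of
    length at most [k.+1]. *)
Definition att_B (ab : O * O) : sset :=
  sprod (fh C (o ab.2) y) (sprod (M ab.1 ab.2) (F k.+1 (o ab.1))).
(** These words already belong to the previous stage, because the outermost letter gets absorbed or
    because the tail is shorter than [k]. *)
Definition att_A_sub (ab : O * O) : subc (att_B ab).
Proof.
apply: (@Subc (att_B ab) (fun n z => in_K z.2.1 \/ ext_filt k x (o ab.1) n (proj1_sig z.2.2))).
move=> m n d [c [m0 u]] /= [[k0 <-]|h]; first by left; exists (sact d k0); rewrite smap_nat.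
by right; apply: (@sc_act _ (ext_filt k x (o ab.1)) _ _ d _ h).
Defined.
Definition att_A (ab : O * O) : sset := ssub (att_A_sub ab).

Definition att_word n (z : scoprod att_B n) : word n x y :=
  let: existT ab (c, (m, u)) := z in wcons c m (proj1_sig (proj1_sig u)).

Lemma att_word_len n z : wlen (@att_word n z) < k.+2.
Proof. by case: z => ab [c [m [u h]]]. Qed.

Lemma att_g_ok n z : ext_filt k.+2 x y n (ext_of (@att_word n z)).
Proof. exact: leq_ltn_trans (wlen_rd _) (att_word_len z). Qed.

Definition att_g : smap (scoprod att_B) (F k.+2 y).
Proof.
apply: (@SMap (scoprod att_B) (F k.+2 y) (fun n z => exist (ext_filt k.+2 x y n) _ (att_g_ok z))).
move=> m n d [ab [c [m0 [u hu]]]]; apply: eq_exist.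
apply: etrans (esym (ext_act d (wcons c m0 (proj1_sig u)))); apply: ext_of_eq.
by apply: rd_wcons; rewrite /= rd_rd.
Defined.

Definition att_i : smap (scoprod att_A) (scoprod att_B) := scoprod_map (fun ab => sincl (att_A_sub ab)).

Lemma att_f_ok n (z : scoprod att_A n) : ext_filt k.+1 x y n (proj1_sig (att_g n (att_i n z))).
Proof.
case: z => ab [[c [m u]] /= [[k0 <-]|h]] /=.
  rewrite -/(rd (wcons c (j ab.1 ab.2 n k0) (proj1_sig (proj1_sig u)))) rd_j wlen_lact.
  exact: leq_ltn_trans (wlen_rd _) (proj2_sig u).
exact: leq_ltn_trans (wlen_rd (wcons c m (proj1_sig (proj1_sig u)))) _.
Qed.

Definition att_f : smap (scoprod att_A) (F k.+1 y) :=
  @scorestr _ _ (ext_filt k.+1 x y) (smap_comp (sincl _) (smap_comp att_g att_i)) att_f_ok.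

Definition att_j : smap (F k.+1 y) (F k.+2 y) := sub_incl (@ext_filt_mono k.+1 x y).

Lemma att_notin n (z : scoprod att_B n) : ~ (exists z', att_i n z' = z) ->
  reduced (att_word z) /\ wlen (att_word z) = k.+1.
Proof.
case: z => ab [c [m u]] h; have nK : ~ in_K m.
  move=> hm; apply: h.
  have hA : att_A_sub ab n (c, (m, u)) by left.
  by exists (existT (fun ab => att_A ab n) ab (exist _ _ hA)).
split; first by split=> //; exact: (proj2_sig (proj1_sig u)).
have hu : wlen (proj1_sig (proj1_sig u)) < k.+1 := proj2_sig u.
congr S; apply/anti_leq; rewrite -ltnS hu /= leqNgt; apply/negP => hl; apply: h.
have hA : att_A_sub ab n (c, (m, u)) by right.
by exists (existT (fun ab => att_A ab n) ab (exist _ _ hA)).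
Qed.

Lemma att_word_inj n (z z' : scoprod att_B n) : att_word z = att_word z' -> z = z'.
Proof.
pose f (w : word n x y) : option {ab : O * O & (fh C (o ab.2) y n * (M ab.1 ab.2 n * word n x (o ab.1)))%type} :=
  if w is wcons a b c m w then Some (existT _ (a, b) (c, (m, w))) else None.
case: z => -[a b] [c [m u]]; case: z' => -[a' b'] [c' [m' u']] e0.
have e := Some_inj (congr1 f e0).
have eab : (a, b) = (a', b') := projT1_eq e.
have ea : a = a' := congr1 fst eab.
have eb : b = b' := congr1 snd eab.
subst a' b'.
have {}e := @existT_inj _ (fun ab : O * O => (fh C (o ab.2) y n * (M ab.1 ab.2 n * word n x (o ab.1)))%type) _ _ _ e.
have ec : c = c' := congr1 fst e.
have em : m = m' := congr1 (fun t => t.2.1) e.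
have eu : proj1_sig (proj1_sig u) = proj1_sig (proj1_sig u') := congr1 (fun t => t.2.2) e.
subst c' m'; suff -> : u = u' by [].
by case: u eu {e e0} => [[w r] h]; case: u' => [[w' r'] h'] /= eu; apply: eq_exist; apply: eq_exist.
Qed.

(** Outside [att_A] the word is already reduced and has length exactly [k.+1], so it is recovered
    from its value and is not in the previous stage. *)
Lemma att_mpush : mpush att_i att_f att_g att_j.
Proof.
have gE n z : ~ (exists z', att_i n z' = z) -> proj1_sig (proj1_sig (att_g n z)) = att_word z.
  by move=> /att_notin[r _]; rewrite -[LHS]/(rd (att_word z)) rd_reduced.
split.
- by apply: scoprod_map_inj => ab; apply: sincl_inj.
- by move=> n u v e; apply: ssub_eq; have := congr1 (@proj1_sig _ _) e.
- by move=> n z; apply: ssub_eq.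
- move=> n [[w r] h]; case: w r h => [c|a b c m w] r h.
    have h' : ext_filt k.+1 x y n (exist _ (wnil c) r) by [].
    by left; exists (exist _ _ h'); apply: ssub_eq.
  right; case: (r) => nm rw.
  have hw : ext_filt k.+1 x (o a) n (exist _ w rw) by [].
  exists (existT (fun ab => att_B ab n) (a, b) (c, (m, exist _ _ hw))).
  apply: ssub_eq; apply: eq_exist; rewrite /= -/(rd (wcons c m w)) rd_notin //.
  by rewrite rd_reduced.
- move=> n z z' e; have [h|h] := pselect (exists a, att_i n a = z); first by right.
  left; have {}e : att_g n z = att_g n z' by [].
  have [h'|h'] := pselect (exists a, att_i n a = z').
    case: h' => a za; have [_ hk] := att_notin h.
    have hl : wlen (proj1_sig (proj1_sig (att_g n z))) < k.+1 by rewrite e -za; exact: att_f_ok.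
    by move: hl; rewrite gE // hk ltnn.
  by apply: att_word_inj; rewrite -!gE // e.
- move=> n z u e; apply: contrapT => h.
  have [_ hk] := att_notin h; have hu := proj2_sig u.
  have hl : wlen (proj1_sig (proj1_sig (att_g n z))) < k.+1 by rewrite e.
  by move: hl; rewrite gE // hk ltnn.
Qed.
End Attach.
End Words.

Lemma weq_scoprod (J : Type) (X Y : J -> sset) (f : forall j, smap (X j) (Y j)) :
  (forall j, weq (f j)) -> weq (scoprod_map f).
Proof.
move=> wf.
have h j n x : fibre (scoprod_index X) j n x -> fibre (scoprod_index Y) j n (scoprod_map f n x) by [].
apply: (@weq_coprod _ _ J _ (scoprod_index Y) (scoprod_index X) h) => j.
have iso (Z : J -> sset) : weq (@scorestr _ _ (fibre (scoprod_index Z) j) (scoprod_in Z j) (fun _ _ => erefl)).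
  apply: bij_weq.
    move=> n x y e; apply: (@existT_inj J (fun j => Z j n) j).
    by have {}e : existT (fun j => Z j n) j x = existT _ j y := congr1 (@proj1_sig _ _) e.
  by move=> n [[j' x] /= e]; subst j'; exists x; apply: eq_exist.
apply: weq_2of3l (iso X) _.
by apply: weq_eq (weq_comp (wf j) (iso Y)) => n x; apply: eq_exist.
Qed.

(** The union of two subobjects of a product is their pushout over the intersection. The embedding
    [e] reduces each clause to coordinates. *)
Lemma corner_mpush (X K M S F U : sset) (jK : smap K M) (s : smap S F) (e : smap U (sprod X (sprod M F)))
    (g : smap (sprod X (sprod K F)) U) (h : smap (sprod X (sprod M S)) U) :
  inj jK -> inj s -> inj e ->
  (forall n z, (exists u, e n u = z) -> (exists k, jK n k = z.2.1) \/ (exists t, s n t = z.2.2)) ->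
  (forall n x k f, e n (g n (x, (k, f))) = (x, (jK n k, f))) ->
  (forall n x m t, e n (h n (x, (m, t))) = (x, (m, s n t))) ->
  mpush (sprod_map (smap_id X) (sprod_map (smap_id K) s))
        (sprod_map (smap_id X) (sprod_map jK (smap_id S))) g h.
Proof.
move=> ij is_ ie eim eg eh; split.
- by move=> n [x [k t]] [x' [k' t']] /= [-> -> /is_ ->].
- move=> n [x [m t]] [x' [m' t']] /(congr1 (e n)); rewrite !eh.
  by case=> -> -> /is_ ->.
- by move=> n [x [k t]]; apply: ie; rewrite /= eg eh.
- move=> n u; case E: (e n u) => [x [m f]].
  have [[k /= km]|[t /= tf]] := eim n (e n u) (ex_intro _ u erefl).
    by rewrite E /= in km; right; exists (x, (k, f)); apply: ie; rewrite eg E km.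
  by rewrite E /= in tf; left; exists (x, (m, t)); apply: ie; rewrite eh E tf.
- move=> n [x [k f]] [x' [k' f']] /(congr1 (e n)); rewrite !eg.
  by case=> -> /ij -> ->; left.
- move=> n [x [k f]] [x' [m t]] /(congr1 (e n)); rewrite eg eh.
  by case=> -> _ ->; exists (x', (k, t)).
Qed.

Section ExtMap.
Variables (O O' O2 : Type) (o : O -> O') (q : O' -> O2) (C : fcat O') (C' : fcat O2).
Variables (phi : fmorph q C C') (K M : O -> O -> sset).
Variables (j : forall a b, smap (K a b) (M a b)) (g : forall a b, smap (K a b) (fh C (o a) (o b))).
Hypothesis ij : forall a b, inj (j a b).
Let o' a := q (o a).
Let g' a b : smap (K a b) (fh C' (o' a) (o' b)) := smap_comp (fm phi (o a) (o b)) (g a b).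

Fixpoint mapw n x y (w : word o C M n x y) : word o' C' M n (q x) (q y) :=
  match w with
  | wnil c => wnil o' M (fm phi _ _ n c)
  | wcons a b c m w => @wcons _ _ o' C' M n (q x) (q y) a b (fm phi _ _ n c) m (mapw w)
  end.

Lemma mapw_lact n x y z (c : fh C y z n) (w : word o C M n x y) :
  mapw (lact c w) = lact (fm phi _ _ n c) (mapw w).
Proof. by case: w => [c0|a b c0 m w] /=; rewrite fm_c. Qed.

Lemma mapw_rd n x y (w : word o C M n x y) : mapw (rd j g w) = rd j g' (mapw w).
Proof.
elim: y / w => [//|y a b c m w IH].
have [[k <-]|ne] := pselect (in_K j m); last by rewrite rd_notin //= -IH -/(rd j g' (wcons _ _ _)); case: pselect.
rewrite (rd_j g ij) mapw_lact IH fm_c.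
exact: esym (rd_j g' ij _ _ _).
Qed.

Lemma mapw_wact m n (d : delta m n) x y (w : word o C M n x y) : mapw (wact d w) = wact d (mapw w).
Proof. by elim: y / w => [y c|y a b c k w IH] /=; rewrite ?IH smap_nat. Qed.

Lemma mapw_wcat n x y z (w : word o C M n y z) (v : word o C M n x y) :
  mapw (wcat w v) = wcat (mapw w) (mapw v).
Proof. by elim: z / w => [z c|z a b c m w IH] /=; rewrite ?mapw_lact ?IH. Qed.

Lemma wlen_mapw n x y (w : word o C M n x y) : wlen (mapw w) = wlen w.
Proof. by elim: y / w => [//|y a b c m w IH] /=; rewrite IH. Qed.

Let E := ext g ij.
Let E' := ext g' ij.

Definition ext_map_fun x y n (u : fh E x y n) : fh E' (q x) (q y) n := ext_of j g' (mapw (proj1_sig u)).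

Lemma ext_map_of x y n (w : word o C M n x y) :
  ext_map_fun (ext_of j g w : fh E x y n) = ext_of j g' (mapw w).
Proof. by apply: ext_of_eq; rewrite /= mapw_rd rd_rd. Qed.

Lemma ext_map_nat x y m n (d : delta m n) (u : fh E x y n) :
  ext_map_fun (sact d u) = sact d (ext_map_fun u).
Proof.
elim/(@ext_ind _ _ _ _ _ _ _ g ij): u => w.
apply: etrans (congr1 _ (ext_act g ij d w)) _.
by rewrite !ext_map_of mapw_wact; symmetry; exact: (ext_act g' ij).
Qed.

Definition ext_map_smap x y : smap (fh E x y) (fh E' (q x) (q y)) := SMap (@ext_map_nat x y).

Lemma ext_map_cmp x y z n (u : fh E y z n) (v : fh E x y n) :
  ext_map_fun (fc u v) = fc (ext_map_fun u) (ext_map_fun v).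
Proof.
elim/(@ext_ind _ _ _ _ _ _ _ g ij): u => u; elim/(@ext_ind _ _ _ _ _ _ _ g ij): v => v.
apply: etrans (congr1 _ (ext_cmpE g ij u v)) _.
by rewrite !ext_map_of mapw_wcat; symmetry; exact: (ext_cmpE g' ij).
Qed.

Definition ext_map : fmorph q E E'.
Proof.
apply: (@FMorph _ _ q E E' ext_map_smap _ ext_map_cmp) => x.
by apply: ext_of_eq; rewrite /= fm_id.
Defined.

Lemma ext_map_in x y n c : fm ext_map x y n (fm (ext_in g ij) x y n c) = fm (ext_in g' ij) _ _ n (fm phi x y n c).
Proof. exact: ext_map_of. Qed.

Lemma ext_map_gen a b n m : fm ext_map (o a) (o b) n (ext_gen g ij a b n m) = ext_gen g' ij a b n m.
Proof. by apply: etrans (ext_map_of _) _; congr ext_of; rewrite /= !degen_smap !fm_id. Qed.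

(** Only coefficients change under [mapw], so a reduced word stays reduced and keeps its length. *)
Lemma ext_map_val x y n (u : fh E x y n) : proj1_sig (fm ext_map x y n u) = mapw (proj1_sig u).
Proof. by case: u => w r; rewrite /= -mapw_rd rd_reduced. Qed.

Hypothesis wphi : forall x y, weq (fm phi x y).

Lemma filt_map_ok k x y n (u : fh E x y n) :
  ext_filt g ij k x y n u -> ext_filt g' ij k (q x) (q y) n (fm ext_map x y n u).
Proof.
move=> h; suff : wlen (proj1_sig (fm ext_map x y n u)) < k by [].
by rewrite ext_map_val wlen_mapw.
Qed.

Definition filt_map k x y := sub_map (@filt_map_ok k x y).

Lemma filt_map0 x y : weq (filt_map 0 x y).
Proof. by apply: bij_weq => n [u h]. Qed.

Lemma filt_map1 x y : weq (filt_map 1 x y).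
Proof.
have h1 n (c : fh C x y n) : ext_filt g ij 1 x y n (ext_in_map g ij x y n c) by [].
have h2 n (c : fh C' (q x) (q y) n) : ext_filt g' ij 1 (q x) (q y) n (ext_in_map g' ij _ _ n c) by [].
have w1 : weq (scorestr h1).
  apply: bij_weq => [n c c' /(congr1 (@proj1_sig _ _))|n [[w r] h]]; first exact: ext_in_inj.
  by case: w r h => // c r h; exists c; apply: ssub_eq; apply: eq_exist.
have w2 : weq (scorestr h2).
  apply: bij_weq => [n c c' /(congr1 (@proj1_sig _ _))|n [[w r] h]]; first exact: ext_in_inj.
  by case: w r h => // c r h; exists c; apply: ssub_eq; apply: eq_exist.
apply: weq_2of3l w1 _; apply: weq_eq (weq_comp (wphi x y) w2) => n c.
by apply: ssub_eq; symmetry; exact: ext_map_in.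
Qed.

Section Step.
Variables (k : nat) (x : O').
Hypothesis wk : forall y, weq (filt_map k x y).
Hypothesis wk1 : forall y, weq (filt_map k.+1 x y).

Definition att_B_map y (ab : O * O) : smap (att_B g ij k x y ab) (att_B g' ij k (q x) (q y) ab) :=
  sprod_map (fm phi (o ab.2) y) (sprod_map (smap_id _) (filt_map k.+1 x (o ab.1))).

Lemma att_A_map_ok y ab n z : att_A_sub g ij k x y ab n z ->
  att_A_sub g' ij k (q x) (q y) ab n (att_B_map y ab n z).
Proof. by case=> h; [left|right; exact: filt_map_ok]. Qed.

Definition att_A_map y ab := sub_map (@att_A_map_ok y ab).

Lemma att_B_map_weq y ab : weq (att_B_map y ab).
Proof. exact: weq_prod (wphi _ _) (weq_prod (weq_id _) (wk1 _)). Qed.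

(* The attached cells form a corner [K x F_(k+1) U M x F_k] of [M x F_(k+1)]. *)
Lemma att_A_map_weq y ab : weq (att_A_map y ab).
Proof.
pose F l := ext_filt g ij l x (o ab.1); pose F' l := ext_filt g' ij l (q x) (q (o ab.1)).
pose s := sub_incl (@ext_filt_mono _ _ o C K M j g ij k x (o ab.1)).
pose s' := sub_incl (@ext_filt_mono _ _ o' C' K M j g' ij k (q x) (q (o ab.1))).
pose c := fm phi (o ab.2) y.
have is_ : inj s by move=> n u v e; apply: ssub_eq; have := congr1 (@proj1_sig _ _) e.
have is' : inj s' by move=> n u v e; apply: ssub_eq; have := congr1 (@proj1_sig _ _) e.
have g1 n (z : sprod (fh C (o ab.2) y) (sprod (K ab.1 ab.2) (ssub (F k.+1))) n) :
    att_A_sub g ij k x y ab n (z.1, (j ab.1 ab.2 n z.2.1, z.2.2)).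
  by left; exists z.2.1.
have h1 n (z : sprod (fh C (o ab.2) y) (sprod (M ab.1 ab.2) (ssub (F k))) n) :
    att_A_sub g ij k x y ab n (z.1, (z.2.1, s n z.2.2)).
  by right; exact: (proj2_sig z.2.2).
have g2 n (z : sprod (fh C' (q (o ab.2)) (q y)) (sprod (K ab.1 ab.2) (ssub (F' k.+1))) n) :
    att_A_sub g' ij k (q x) (q y) ab n (z.1, (j ab.1 ab.2 n z.2.1, z.2.2)).
  by left; exists z.2.1.
have h2 n (z : sprod (fh C' (q (o ab.2)) (q y)) (sprod (M ab.1 ab.2) (ssub (F' k))) n) :
    att_A_sub g' ij k (q x) (q y) ab n (z.1, (z.2.1, s' n z.2.2)).
  by right; exact: (proj2_sig z.2.2).
pose gm1 := @scorestr _ _ (att_A_sub g ij k x y ab) (sprod_map (smap_id _) (sprod_map (j ab.1 ab.2) (smap_id _))) g1.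
pose hm1 := @scorestr _ _ (att_A_sub g ij k x y ab) (sprod_map (smap_id _) (sprod_map (smap_id _) s)) h1.
pose gm2 := @scorestr _ _ (att_A_sub g' ij k (q x) (q y) ab) (sprod_map (smap_id _) (sprod_map (j ab.1 ab.2) (smap_id _))) g2.
pose hm2 := @scorestr _ _ (att_A_sub g' ij k (q x) (q y) ab) (sprod_map (smap_id _) (sprod_map (smap_id _) s')) h2.
have mp1 := @corner_mpush _ _ _ _ _ _ (j ab.1 ab.2) s (sincl (att_A_sub g ij k x y ab)) gm1 hm1
  (@ij _ _) is_ (@sincl_inj _ _).
have mp2 := @corner_mpush _ _ _ _ _ _ (j ab.1 ab.2) s' (sincl (att_A_sub g' ij k (q x) (q y) ab)) gm2 hm2
  (@ij _ _) is' (@sincl_inj _ _).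
apply: (gluing (a := sprod_map c (sprod_map (smap_id _) (filt_map k x (o ab.1))))
  (b := sprod_map c (sprod_map (smap_id _) (filt_map k.+1 x (o ab.1))))
  (c := sprod_map c (sprod_map (smap_id _) (filt_map k x (o ab.1)))) (mp1 _ _ _) (mp2 _ _ _)) => //.
- move=> n z [[z1 hz] <-]; case: (hz) => [hm|hu]; first by left.
  by right; exists (exist _ _ hu); apply: ssub_eq.
- move=> n z [[z1 hz] <-]; case: (hz) => [hm|hu]; first by left.
  by right; exists (exist _ _ hu); apply: ssub_eq.
- by move=> n [c0 [m u]]; congr (_, _); congr (_, _); apply: ssub_eq.
- by move=> n [c0 [m u]]; apply: ssub_eq.
- by move=> n [c0 [m u]]; apply: ssub_eq; congr (_, (_, _)); apply: ssub_eq.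
- exact: weq_prod (wphi _ _) (weq_prod (weq_id _) (wk _)).
- exact: weq_prod (wphi _ _) (weq_prod (weq_id _) (wk1 _)).
- exact: weq_prod (wphi _ _) (weq_prod (weq_id _) (wk _)).
Qed.

Lemma filt_map_step y : weq (filt_map k.+2 x y).
Proof.
apply: (gluing (att_mpush g ij k x y) (att_mpush g' ij k (q x) (q y))
  (a := scoprod_map (att_A_map y)) (b := scoprod_map (att_B_map y)) (c := filt_map k.+1 x y)).
- by move=> n [ab z].
- move=> n [ab [c0 [m u]]]; apply: ssub_eq.
  apply: etrans (ext_map_of _) _; congr ext_of.
  by rewrite /=; congr wcons; symmetry; exact: (ext_map_val (proj1_sig u)).
- by move=> n u; apply: ssub_eq.
- exact: weq_scoprod (att_A_map_weq y).
- exact: weq_scoprod (att_B_map_weq y).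
- exact: wk1.
Qed.
End Step.

Theorem ext_map_weq x y : weq (fm ext_map x y).
Proof.
(* Two consecutive stages are carried along because the corner attached for stage [k.+2] involves
   both. *)
have W k : (forall y, weq (filt_map k x y)) /\ (forall y, weq (filt_map k.+1 x y)).
  elim: k => [|k [IH IH1]]; first by split=> z; [apply: filt_map0|apply: filt_map1].
  by split=> // z; apply: filt_map_step.
apply: (@weq_union _ _ _ (fun k => ext_filt g ij k x y) (fun k => ext_filt g' ij k (q x) (q y))).
- by move=> k n u; apply: ext_filt_mono.
- by move=> k n u; apply: ext_filt_mono.
- by move=> n u; exists (wlen (proj1_sig u)).+1; apply: ltnSn.
- by move=> n u; exists (wlen (proj1_sig u)).+1; apply: ltnSn.
- by [].
- by [].
- by move=> k n u; apply: filt_map_ok.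
- by move=> h k; apply: weq_eq ((W k).1 y) => n u; apply: ssub_eq.
Qed.
End ExtMap.

(** * Passage between [scat] and [fcat] *)

Lemma scmp_nat (A : scat) (x y z : A) m n (d : delta m n) (g : shom y z n) (f : shom x y n) :
  scmp x y z m (sact d g, sact d f) = sact d (scmp x y z n (g, f)).
Proof. by rewrite -smap_nat. Qed.

Definition fcat_of (A : scat) : fcat A :=
  @FCat A (@shom A) (@sid A) (fun x y z n g f => scmp x y z n (g, f))
    (@scmp_nat A) (@scmp_idl A) (@scmp_idr A) (@scmpA A).

Definition fcmp (O : Type) (A : fcat O) x y z : smap (sprod (fh A y z) (fh A x y)) (fh A x z) :=
  @SMap (sprod (fh A y z) (fh A x y)) (fh A x z) (fun n gf => fc gf.1 gf.2)
    (fun m n d gf => fc_nat d gf.1 gf.2).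

Definition scat_of (O : Type) (A : fcat O) : scat :=
  @SCat O (fh A) (fid A) (@fcmp O A) (@fc_idl O A) (@fc_idr O A) (@fcA O A).

Definition fmorph_of (A B : scat) (F : sfunctor A B) : fmorph F (fcat_of A) (fcat_of B) :=
  @FMorph A B F (fcat_of A) (fcat_of B) (sfmap F) (sfmap_id F) (@sfmap_cmp A B F).

Definition sfunctor_out (O : Type) (A : fcat O) (B : scat) (q : O -> B) (F : fmorph q A (fcat_of B)) :
  sfunctor (scat_of A) B := @SFunctor (scat_of A) B q (fm F) (fm_id F) (@fm_c _ _ _ _ _ F).

Definition sfunctor_in (O : Type) (A : scat) (B : fcat O) (q : A -> O) (F : fmorph q (fcat_of A) B) :
  sfunctor A (scat_of B) := @SFunctor A (scat_of B) q (fm F) (fm_id F) (@fm_c _ _ _ _ _ F).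

Definition sfunctor_btw (O O' : Type) (A : fcat O) (B : fcat O') (q : O -> O') (F : fmorph q A B) :
  sfunctor (scat_of A) (scat_of B) :=
  @SFunctor (scat_of A) (scat_of B) q (fm F) (fm_id F) (@fm_c _ _ _ _ _ F).

Definition fmorph_comp (O O' O2 : Type) (q : O -> O') (r : O' -> O2) (A : fcat O) (B : fcat O') (C : fcat O2)
  (G : fmorph r B C) (F : fmorph q A B) : fmorph (fun x => r (q x)) A C.
Proof.
apply: (@FMorph _ _ (fun x => r (q x)) A C (fun x y => smap_comp (fm G _ _) (fm F x y))).
- by move=> x; rewrite /= !fm_id.
- by move=> x y z n g f; rewrite /= !fm_c.
Defined.

(** Makes the object map literally the prescribed one, so that the functor becomes an [fmorph] over
    it. *)
Lemma sfunctor_change_ob (O : Type) (A : fcat O) (B : scat) (H : sfunctor (scat_of A) B) (q : O -> B) :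
  (forall x, H x = q x) -> exists F : fmorph q A (fcat_of B), sfunctor_out F = H.
Proof.
case: H => o m i c /= e; have eo : o = q by apply/funext.
subst q; exists (@FMorph _ _ o A (fcat_of B) m i c); exact: sfunctor_eq.
Qed.

Lemma sfunctor_eqE (A B : scat) (o : A -> B) m i c m' i' c' :
  @SFunctor A B o m i c = @SFunctor A B o m' i' c' -> forall x y n u, m x y n u = m' x y n u.
Proof.
by move=> /sfunctor_extE[/= e h] x y n u; rewrite -h hcast_id.
Qed.

(** * Factorizations and left properness *)

(** The right adjoint of the functor that forgets the simplicial operators: a map into it is an
    arbitrary family of functions, one in each degree. *)
Definition cofree (S : nat -> Type) : sset.
Proof.
apply: (@SSet (fun m => forall n, delta n m -> S n) (fun m p d phi n e => phi n (dcomp d e))).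
- move=> n phi; apply: functional_extensionality_dep => p; apply/funext => e.
  by rewrite dcomp_idl.
- move=> m n p g d phi; apply: functional_extensionality_dep => q; apply/funext => e.
  by rewrite dcompA.
Defined.

(* The added point is the value of an extended map outside the original domain. *)
Definition injective_hull (X : sset) : sset := cofree (fun n => option (X n)).

Definition hull_in (X : sset) : smap X (injective_hull X).
Proof.
apply: (@SMap X (injective_hull X) (fun m x n e => Some (sact e x))).
move=> m n d x; apply: functional_extensionality_dep => q; apply/funext => e.
by rewrite /= sact_comp.
Defined.

Lemma hull_in_inj (X : sset) : inj (hull_in X).
Proof.
move=> n x y /(congr1 (fun phi : injective_hull X n => phi n (did n))) /= [].
by rewrite !sact_id.
Qed.

Lemma hull_extend (X A B : sset) (i : smap A B) (u : smap A (injective_hull X)) : inj i ->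
  exists v : smap B (injective_hull X), forall n a, v n (i n a) = u n a.
Proof.
move=> ii.
pose s n (b : B n) : option (X n) :=
  match pselect (exists a, i n a = b) with
  | left h => u n (projT1 (cid h)) n (did n)
  | right _ => None
  end.
have si n a : s n (i n a) = u n a n (did n).
  by rewrite /s; case: pselect => [h|[]]; [case: cid => a' /= /ii ->|exists a].
have sn m n (d : delta m n) b :
    (fun q e => s q (sact e (sact d b))) = sact d ((fun q e => s q (sact e b)) : injective_hull X n).
  apply: functional_extensionality_dep => q; apply/funext => e.
  by rewrite /= sact_comp.
exists (@SMap B (injective_hull X) (fun m b q e => s q (sact e b)) sn) => n a.
apply: functional_extensionality_dep => q; apply/funext => e.
by rewrite /= -smap_nat si smap_nat /= dcomp_idr.
Qed.

Lemma hull_fst_trivial_fib (X Y : sset) : trivial_fib (smap_fst Y (injective_hull X)).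
Proof.
move=> A B i ii u v uv; have [w wi] := hull_extend (smap_comp (smap_snd _ _) u) ii.
exists (smap_pair v w); split=> // n a; rewrite /= wi -uv /=.
by case: (u n a).
Qed.

Lemma weq_colim (X Y : nat -> sset) (t : forall k, smap (X k) (X k.+1)) (s : forall k, smap (Y k) (Y k.+1))
    (f : forall k, smap (X k) (Y k)) (F : smap (colim t) (colim s)) :
  (forall k, inj (t k)) -> (forall k, inj (s k)) -> (forall k, weq (f k)) ->
  (forall k n x, F n (colim_in t k n x) = colim_in s k n (f k n x)) -> weq F.
Proof.
move=> it is_ wf Ff.
(* The stages are shifted by one so that both filtrations start empty. *)
pose XS k : subc (colim t) := if k is k'.+1 then simage (colim_in t k') else @Subc (colim t) (fun _ _ => False) (fun _ _ _ _ h => h).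
pose YS k : subc (colim s) := if k is k'.+1 then simage (colim_in s k') else @Subc (colim s) (fun _ _ => False) (fun _ _ _ _ h => h).
have FS k n x : XS k n x -> YS k n (F n x).
  by case: k => // k [x' <-]; exists (f k n x'); rewrite Ff.
apply: (@weq_union _ _ F XS YS _ _ _ _ _ _ FS) => //.
- by case=> // k n x [x' <-]; exists (t k n x'); rewrite colim_in_step.
- by case=> // k n x [x' <-]; exists (s k n x'); rewrite colim_in_step.
- by move=> n x; have [k [x' <-]] := colim_cover x; exists k.+1, x'.
- by move=> n x; have [k [x' <-]] := colim_cover x; exists k.+1, x'.
- by move=> n x [].
- by move=> n x [].
- case=> [|k]; first by apply: bij_weq => n [x []].
  have iso (Z : nat -> sset) (r : forall k, smap (Z k) (Z k.+1)) : (forall k, inj (r k)) ->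
      weq (@scorestr _ _ (simage (colim_in r k)) (colim_in r k) (fun n x => ex_intro _ x erefl)).
    move=> ir; apply: bij_weq => [n x y /(congr1 (@proj1_sig _ _)) /= h|n [z [x e]]].
      exact: (@colim_in_inj Z r ir k).
    by exists x; apply: ssub_eq.
  apply: weq_2of3l (iso X t it) _; apply: weq_eq (weq_comp (wf k) (iso Y s is_)) => n x.
  by apply: ssub_eq; rewrite /= Ff.
Qed.

Section FColim.
Variables (O : Type) (A : nat -> fcat O) (t : forall k, fmorph (fun x => x) (A k) (A k.+1)).
Hypothesis it : forall k x y, inj (fm (t k) x y).

Definition fcolim_hom x y : sset := colim (fun k => fm (t k) x y).
Let inn x y k : smap (fh (A k) x y) (fcolim_hom x y) := colim_in (fun k => fm (t k) x y) k.

Let inn_inj x y k : inj (@inn x y k).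
Proof. by apply: colim_in_inj => l; apply: it. Qed.

Let inn_step x y k n u : inn x y k.+1 n (fm (t k) x y n u) = inn x y k n u.
Proof. exact: (colim_in_step (fun k => fm (t k) x y)). Qed.

Let late2 x y z k l n (g : fh (A k) y z n) (f : fh (A k) x y n) : k <= l ->
  exists g' f', [/\ inn y z l n g' = inn y z k n g, inn x y l n f' = inn x y k n f &
                    inn x z l n (fc g' f') = inn x z k n (fc g f)].
Proof.
move/subnK => <-; elim: (l - k) => [|i [g' [f' [eg ef egf]]]]; first by exists g, f.
exists (fm (t (i + k)) y z n g'), (fm (t (i + k)) x y n f'); split.
- by rewrite -eg -(inn_step g').
- by rewrite -ef -(inn_step f').
- by rewrite -egf -(inn_step (fc g' f')) fm_c.
Qed.

Let common2 x y z n (u : fcolim_hom y z n) (v : fcolim_hom x y n) :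
  exists k, forall l, k <= l -> exists g f, inn y z l n g = u /\ inn x y l n f = v.
Proof.
have [k1 h1] := colim_common u; have [k2 h2] := colim_common v; exists (maxn k1 k2) => l.
rewrite geq_max => /andP[/h1[g eg] /h2[f ef]]; by exists g, f.
Qed.

Let cmp_ex x y z n (u : fcolim_hom y z n) (v : fcolim_hom x y n) :
  exists w, exists k g f, [/\ inn y z k n g = u, inn x y k n f = v & w = inn x z k n (fc g f)].
Proof.
have [k h] := common2 u v; have [g [f [eg ef]]] := h k (leqnn k).
by exists (inn x z k n (fc g f)), k, g, f.
Qed.

Definition fcolim_cmp x y z n (u : fcolim_hom y z n) (v : fcolim_hom x y n) : fcolim_hom x z n :=
  projT1 (cid (cmp_ex u v)).

(** Two computations of the composite, at stages [k] and [l], are compared at stage [k + l], where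
    injectivity identifies the representatives. *)
Let cmpE x y z k n (g : fh (A k) y z n) (f : fh (A k) x y n) :
  fcolim_cmp (inn y z k n g) (inn x y k n f) = inn x z k n (fc g f).
Proof.
rewrite /fcolim_cmp; case: cid => w [l [g1 [f1 [eg ef ew]]]].
rewrite -[LHS]/w ew.
have [g2 [f2 [e1 e2 e3]]] := late2 g1 f1 (leq_addr k l).
have [g3 [f3 [e4 e5 e6]]] := late2 g f (leq_addl l k).
rewrite -e3 -e6; congr (inn x z (l + k) n (fc _ _)); apply: inn_inj.
  by rewrite e1 e4 eg.
by rewrite e2 e5 ef.
Qed.

Let cmp_nat x y z m n (d : delta m n) (u : fcolim_hom y z n) (v : fcolim_hom x y n) :
  fcolim_cmp (sact d u) (sact d v) = sact d (fcolim_cmp u v).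
Proof.
have [k h] := common2 u v; have [g [f [<- <-]]] := h k (leqnn k).
by rewrite -!smap_nat !cmpE fc_nat smap_nat.
Qed.

Definition fcolim_id x : fcolim_hom x x 0 := inn x x 0 0 (fid (A 0) x).

Let idE k n x : degen n (fcolim_id x) = inn x x k n (degen n (fid (A k) x)).
Proof.
elim: k => [|k IH]; first by rewrite degen_smap.
by rewrite IH -inn_step degen_smap fm_id.
Qed.

Let idl x y n (u : fcolim_hom x y n) : fcolim_cmp (degen n (fcolim_id y)) u = u.
Proof. by have [k [f <-]] := colim_cover u; rewrite (idE k) cmpE fc_idl. Qed.

Let idr x y n (u : fcolim_hom x y n) : fcolim_cmp u (degen n (fcolim_id x)) = u.
Proof. by have [k [f <-]] := colim_cover u; rewrite (idE k) cmpE fc_idr. Qed.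

Let cmpA x y z w n (a : fcolim_hom z w n) (b : fcolim_hom y z n) (c : fcolim_hom x y n) :
  fcolim_cmp a (fcolim_cmp b c) = fcolim_cmp (fcolim_cmp a b) c.
Proof.
have [k1 h1] := common2 a b; have [k2 h2] := common2 b c.
have [h [g [eh eg]]] := h1 (maxn k1 k2) (leq_maxl _ _).
have [g' [f [eg' ef]]] := h2 (maxn k1 k2) (leq_maxr _ _).
by rewrite -eh -eg -ef !cmpE fcA.
Qed.

Definition fcolim : fcat O := FCat cmp_nat idl idr cmpA.

Definition fcolim_in k : fmorph (fun x => x) (A k) fcolim.
Proof.
apply: (@FMorph _ _ (fun x => x) (A k) fcolim (fun x y => inn x y k)).
- by move=> x; rewrite -[fid fcolim x]degen0 (idE k) degen0.
- by move=> x y z n g f; symmetry; apply: cmpE.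
Defined.

Lemma fcolim_in_step k x y n u : fm (fcolim_in k.+1) x y n (fm (t k) x y n u) = fm (fcolim_in k) x y n u.
Proof. exact: inn_step. Qed.

Lemma fcolim_in_inj k x y : inj (fm (fcolim_in k) x y).
Proof. exact: inn_inj. Qed.

Lemma fcolim_cover x y n (u : fh fcolim x y n) : exists k v, fm (fcolim_in k) x y n v = u.
Proof. by have [k [v e]] := colim_cover u; exists k, v. Qed.

Lemma fcolim_desc (O' : Type) (q : O -> O') (T : fcat O') (F : forall k, fmorph q (A k) T) :
  (forall k x y n u, fm (F k.+1) x y n (fm (t k) x y n u) = fm (F k) x y n u) ->
  exists G : fmorph q fcolim T, forall k x y n u, fm G x y n (fm (fcolim_in k) x y n u) = fm (F k) x y n u.
Proof.
move=> Ft.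
have ex x y : {G : smap (fcolim_hom x y) (fh T (q x) (q y)) |
    forall k n u, G n (inn x y k n u) = fm (F k) x y n u}.
  by apply: cid; apply: (@colim_desc _ _ _ (fun k => fm (F k) x y)).
pose G x y := proj1_sig (ex x y).
have GE x y k n u : G x y n (inn x y k n u) = fm (F k) x y n u := proj2_sig (ex x y) k n u.
have Gi x : G x x 0 (fid fcolim x) = fid T (q x) by rewrite GE fm_id.
have Gc x y z n (u : fh fcolim y z n) (v : fh fcolim x y n) :
    G x z n (fc u v) = fc (G y z n u) (G x y n v).
  have [k h] := common2 u v; have [g [f [<- <-]]] := h k (leqnn k).
  by rewrite -[X in G _ _ _ X]/(fcolim_cmp (inn y z k n g) (inn x y k n f)) cmpE !GE fm_c.
by exists (@FMorph _ _ q fcolim T G Gi Gc).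
Qed.

End FColim.

Section ExtUnique.
Variables (O O' O2 : Type) (o : O -> O') (C : fcat O') (K M : O -> O -> sset).
Variables (j : forall a b, smap (K a b) (M a b)) (g : forall a b, smap (K a b) (fh C (o a) (o b))).
Variables (ij : forall a b, inj (j a b)) (q : O' -> O2) (T : fcat O2) (F G : fmorph q (ext g ij) T).

Lemma ext_unique :
  (forall x y n c, fm F x y n (fm (ext_in g ij) x y n c) = fm G x y n (fm (ext_in g ij) x y n c)) ->
  (forall a b n m, fm F (o a) (o b) n (ext_gen g ij a b n m) = fm G (o a) (o b) n (ext_gen g ij a b n m)) ->
  forall x y n u, fm F x y n u = fm G x y n u.
Proof.
move=> hin hgen x y n u; rewrite -(ext_ofK g u); move: (proj1_sig u) => {u} w.
elim: y / w => [y c|y a b c m w IH]; first exact: hin.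
pose E := ext g ij; pose gm : fh E (o a) (o b) n := ext_gen g ij a b n m.
pose cm : fh E (o b) y n := fm (ext_in g ij) (o b) y n c.
pose wm : fh E x (o a) n := ext_of j g w.
have -> : ext_of j g (wcons c m w) = fc cm (fc gm wm) :> fh E x y n.
  symmetry; apply: etrans (congr1 (fun v : fh E x (o b) n => fc cm v) (ext_cmpE g ij _ _)) _.
  apply: etrans (ext_cmpE g ij _ _) _; apply: ext_of_eq.
  by rewrite [wcat _ _]/= lact_id fc_idr.
have hc : fm F _ _ n cm = fm G _ _ n cm := hin _ _ _ c.
have hm : fm F _ _ n gm = fm G _ _ n gm := hgen _ _ _ m.
have hw : fm F _ _ n wm = fm G _ _ n wm := IH.
by rewrite !fm_c hc hm hw.
Qed.
End ExtUnique.

(** Any two vertices of the hull are the ends of an edge, by extension along the ends of the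
    interval. Each edge in [Y] can thus be paired with an edge between arbitrary vertices of the
    hull. *)
Lemma hull_connected (X Y : sset) (b b' : Y 0) : connected b b' ->
  forall r r' : injective_hull X 0, @connected (sprod Y (injective_hull X)) (b, r) (b', r').
Proof.
pose pts (r r' : injective_hull X 0) : smap (sprod pt (disc bool)) (injective_hull X) :=
  two_maps (const_map pt r) (const_map pt r').
have path (r r' : injective_hull X 0) : exists f : injective_hull X 1,
    sact (dcst 0 (ord0 : 'I_2)) f = r /\ sact (dcst 0 (ord_max : 'I_2)) f = r'.
  have [w wP] := hull_extend (pts r r') (@two_ends_inj pt).
  exists (w 1 (tt, did 1)); rewrite -!smap_nat; split.
    apply: etrans (_ : w 0 (two_ends pt 0 (tt, false)) = r); last by rewrite wP; exact: degen0.
    by congr (w 0 (_, _)); apply: delta_inj => i; rewrite dcompE didE !dcstE.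
  apply: etrans (_ : w 0 (two_ends pt 0 (tt, true)) = r'); last by rewrite wP; exact: degen0.
  by congr (w 0 (_, _)); apply: delta_inj => i; rewrite dcompE didE !dcstE.
elim=> {b b'} [b b' [e [<- <-]]|b|b b' _ IH|b c d _ IH _ IH'] r r'.
- have [f [<- <-]] := path r r'; apply: rst_step; by exists (e, f).
- have [f [<- <-]] := path r r'; apply: rst_step; exists (degen 1 b, f).
  by rewrite /= !sact_degen degen0.
- by apply: rst_sym; apply: IH.
- exact: rst_trans (IH r r) (IH' r r').
Qed.

Section Resolution.
Variables (O O' OB : Type) (f0 : O -> O') (pO : O -> OB) (B : fcat OB).

(* [sP] is the current factor over [B], [sD] is the other corner of the pushout square with the same
   generators freely adjoined, and [sF] compares the two.  The hom-objects [adj_hom]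
   adjoined at each step factor [sP] into an injection and a trivial fibration. *)
Record stage := Stage {
  sE : fcat O; sP : fmorph pO sE B; sD : fcat O'; sF : fmorph f0 sE sD;
  sW : forall x y, weq (fm sF x y) }.

Section Next.
Variable S : stage.
Definition adj_hom (a b : O) : sset := sprod (fh B (pO a) (pO b)) (injective_hull (fh (sE S) a b)).
Definition adj_incl (a b : O) : smap (fh (sE S) a b) (adj_hom a b) := smap_pair (fm (sP S) a b) (hull_in _).
Lemma adj_incl_inj a b : inj (adj_incl a b).
Proof. by move=> n u v /(congr1 snd) /= /hull_in_inj. Qed.
(** The old arrows are themselves the part [K] along which [adj_hom] is adjoined. *)
Definition adj_glue (a b : O) : smap (fh (sE S) a b) (fh (sE S) a b) := smap_id _.
Definition adj_proj (a b : O) : smap (adj_hom a b) (fh B (pO a) (pO b)) := smap_fst _ _.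
Lemma adj_proj_incl a b n k : adj_proj a b n (adj_incl a b n k) = fm (sP S) a b n (adj_glue a b n k).
Proof. by []. Qed.
Definition next : stage :=
  Stage (@ext_desc _ _ _ _ _ _ _ adj_glue adj_incl_inj _ _ _ _ adj_proj adj_proj_incl)
        (ext_map_weq adj_glue adj_incl_inj (@sW S)).
Definition stage_inE : fmorph (fun x => x) (sE S) (sE next) := ext_in adj_glue adj_incl_inj.
Definition stage_inD : fmorph (fun x => x) (sD S) (sD next) := ext_in _ adj_incl_inj.
Definition adj_gen (a b : O) : smap (adj_hom a b) (fh (sE next) a b) := ext_gen adj_glue adj_incl_inj a b.
End Next.

Variable S0 : stage.
Definition stage_seq (k : nat) : stage := iter k next S0.
Let E k := sE (stage_seq k).
Let D k := sD (stage_seq k).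
Let tE k : fmorph (fun x => x) (E k) (E k.+1) := stage_inE (stage_seq k).
Let tD k : fmorph (fun x => x) (D k) (D k.+1) := stage_inD (stage_seq k).
Let gen k a b : smap (adj_hom (stage_seq k) a b) (fh (E k.+1) a b) := adj_gen (stage_seq k) a b.

Let tE_inj k x y : inj (fm (tE k) x y).
Proof. exact: ext_in_inj. Qed.
Let tD_inj k x y : inj (fm (tD k) x y).
Proof. exact: ext_in_inj. Qed.
Let gen_inj k a b : inj (gen k a b).
Proof. by apply: ext_gen_inj => n u v. Qed.
Let gen_j k a b n u : gen k a b n (adj_incl (stage_seq k) a b n u) = fm (tE k) a b n u.
Proof. exact: ext_gen_j. Qed.
Let P_gen k a b n m : fm (sP (stage_seq k.+1)) a b n (gen k a b n m) = m.1.
Proof. exact: (ext_desc_gen (adj_incl_inj (S := stage_seq k)) (mu := adj_proj (stage_seq k))). Qed.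

(** Each step factors on hom-objects through [adj_hom], so in the colimit every hom-object is also
    the union of the adjoined objects, which project to [B] by trivial fibrations. This yields the
    properties of [P]. The last clause is the existence half of the universal property of [D'] as a
    pushout of [E']. *)
Lemma resolution : exists (E' : fcat O) (D' : fcat O') (P : fmorph pO E' B) (F : fmorph f0 E' D')
    (e : fmorph (fun x => x) (sE S0) E') (d : fmorph (fun x => x) (sD S0) D'),
  [/\ [/\ forall x y n u, fm P x y n (fm e x y n u) = fm (sP S0) x y n u,
          forall x y n u, fm F x y n (fm e x y n u) = fm d _ _ n (fm (sF S0) x y n u) &
          forall x y, weq (fm F x y)],
      [/\ forall x y, kan_fibration (fm P x y),
          forall x y, weq (fm P x y),
          forall x y (b : fh B (pO x) (pO y) 0), exists u, fm P x y 0 u = b &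
          forall x y (u v : fh E' x y 0), connected (fm P x y 0 u) (fm P x y 0 v) -> connected u v] &
      forall (O2 : Type) (r : O' -> O2) (T : fcat O2) (psi : fmorph (fun x => r (f0 x)) E' T)
          (psi0 : fmorph r (sD S0) T),
        (forall x y n u, fm psi0 _ _ n (fm (sF S0) x y n u) = fm psi x y n (fm e x y n u)) ->
        exists G : fmorph r D' T,
          (forall x y n u, fm G x y n (fm d x y n u) = fm psi0 x y n u) /\
          (forall x y n u, fm G _ _ n (fm F x y n u) = fm psi x y n u)].
Proof.
pose E' := fcolim tE_inj; pose D' := fcolim tD_inj.
pose eE k := fcolim_in tE_inj k; pose eD k := fcolim_in tD_inj k.
have [P PE] : exists P : fmorph pO E' B, forall k x y n u,
    fm P x y n (fm (eE k) x y n u) = fm (sP (stage_seq k)) x y n u.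
  by apply: (@fcolim_desc _ _ _ tE_inj _ _ _ (fun k => sP (stage_seq k))).
have [F FE] : exists F : fmorph f0 E' D', forall k x y n u,
    fm F x y n (fm (eE k) x y n u) = fm (eD k) _ _ n (fm (sF (stage_seq k)) x y n u).
  apply: (@fcolim_desc _ _ _ tE_inj _ _ _ (fun k => fmorph_comp (eD k) (sF (stage_seq k)))).
  move=> k x y n u; rewrite -[RHS]/(fm (eD k) _ _ n (fm (sF (stage_seq k)) x y n u)).
  rewrite -(fcolim_in_step tD_inj); apply: (congr1 (fm (eD k.+1) _ _ n)).
  exact: (ext_map_in (sF (stage_seq k)) (adj_glue (stage_seq k)) (adj_incl_inj (S := stage_seq k)) u).
have eE_gen k x y n u : fm (eE k) x y n u = fm (eE k.+1) x y n (gen k x y n (adj_incl (stage_seq k) x y n u)).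
  by rewrite gen_j; symmetry; exact: (fcolim_in_step tE_inj).
have P_eE k x y n m : fm P x y n (fm (eE k.+1) x y n (gen k x y n m)) = m.1.
  by rewrite PE P_gen.
exists E', D', P, F, (eE 0), (eD 0); split; first split.
- exact: PE 0.
- exact: FE 0.
- move=> x y; apply: (@weq_colim _ _ _ _ (fun k => fm (sF (stage_seq k)) x y)).
  + by move=> k; apply: tE_inj.
  + by move=> k; apply: tD_inj.
  + by move=> k; apply: sW.
  + by move=> k n u; apply: FE.
- split.
  + move=> x y; apply/kanP => n k u b ub.
    have [N NP] := horn_colim u (fun k => @tE_inj k x y).
    have {NP}[v vP] := NP N (leqnn N).
    have [|w [wv pw]] := @hull_fst_trivial_fib (fh (E N) x y) (fh B (pO x) (pO y)) _ _ (horn_incl k)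
        (@horn_incl_inj _ k) (smap_comp (adj_incl (stage_seq N) x y) v) (yoneda b).
      move=> m a; rewrite -[RHS]ub -[LHS]/(fm (sP (stage_seq N)) x y m (v m a)) -(PE N).
      by rewrite vP.
    exists (fm (eE N.+1) x y n.+1 (gen N x y n.+1 (w n.+1 (did n.+1)))); split.
      by rewrite P_eE -[LHS]/(smap_fst _ _ _ _) pw /= sact_id.
    move=> m a; rewrite -!smap_nat vP.
    have e : w m (dcomp (did n.+1) (val a)) = adj_incl (stage_seq N) x y m (v m a).
      by rewrite dcomp_idl; exact: wv.
    apply: etrans (congr1 (fun z => fm (eE N.+1) x y m (gen N x y m z)) e) _.
    by symmetry; exact: eE_gen.
  + move=> x y.
    pose em k := smap_comp (fm (eE k.+1) x y) (gen k x y).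
    pose XS k : subc (fh E' x y) := if k is k'.+1 then simage (em k') else @Subc (fh E' x y) (fun _ _ => False) (fun _ _ _ _ h => h).
    (* The target has the constant filtration, except that stage 0 is empty. *)
    pose YS k : subc (fh B (pO x) (pO y)) := @Subc (fh B (pO x) (pO y)) (fun _ _ => 0 < k) (fun _ _ _ _ h => h).
    have FS k n u : XS k n u -> YS k n (fm P x y n u) by case: k.
    apply: (@weq_union _ _ _ XS YS _ _ _ _ _ _ FS) => //.
    * case=> // k n u [m <-]; exists (adj_incl (stage_seq k.+1) x y n (gen k x y n m)).
      by symmetry; exact: eE_gen.
    * move=> n u; have [k [v <-]] := fcolim_cover u.
      by exists k.+1, (adj_incl (stage_seq k) x y n v); symmetry; exact: eE_gen.
    * by move=> n b; exists 1.
    * by move=> n u [].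
    * case=> [|k]; first by apply: bij_weq => n [u []].
      have iso : weq (@scorestr _ _ (simage (em k)) (em k) (fun n x => ex_intro _ x erefl)).
        apply: bij_weq => [n u v /(congr1 (@proj1_sig _ _)) /= h|n [z [u e]]].
          by apply: (gen_inj (k := k)); apply: (@fcolim_in_inj _ _ _ tE_inj k.+1 x y).
        by exists u; apply: ssub_eq.
      have isoB : weq (sincl (YS k.+1)).
        apply: bij_weq; first exact: sincl_inj.
        by move=> n b; exists (exist _ b isT).
      apply: weq_2of3l iso _; apply: weq_2of3r isoB _.
      apply: weq_eq (trivial_fib_weq (@hull_fst_trivial_fib (fh (E k) x y) (fh B (pO x) (pO y)))) => n m.
      by symmetry; exact: P_eE.
  + move=> x y b; pose r : injective_hull (fh (E 0) x y) 0 := fun _ _ => None.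
    by exists (fm (eE 1) x y 0 (gen 0 x y 0 (b, r))); rewrite P_eE.
  + move=> x y u v c.
    have [k1 h1] := colim_common u; have [k2 h2] := colim_common v.
    have [u' eu] := h1 (k1 + k2) (leq_addr _ _); have [v' ev] := h2 (k1 + k2) (leq_addl _ _).
    have {}eu : fm (eE (k1 + k2)) x y 0 u' = u by [].
    have {}ev : fm (eE (k1 + k2)) x y 0 v' = v by [].
    rewrite -eu -ev (eE_gen _ x y 0 u') (eE_gen _ x y 0 v'); apply: connected_smap; apply: connected_smap.
    by apply: hull_connected; move: c; rewrite -eu -ev !PE.
- move=> O2 r T psi psi0 h0.
  (* The extension is built by recursion over the stages, each term carrying its compatibility with
     [psi]; that compatibility is what defines it on the next generators. *)
  pose st k := {G : fmorph r (D k) T | forall x y n u,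
    fm G _ _ n (fm (sF (stage_seq k)) x y n u) = fm psi x y n (fm (eE k) x y n u)}.
  have nx k (G : st k) : {G' : st k.+1 | forall x y n u,
      fm (proj1_sig G') x y n (fm (tD k) x y n u) = fm (proj1_sig G) x y n u}.
    apply: cid; case: G => G GP.
    pose mu a b : smap (adj_hom (stage_seq k) a b) (fh T (r (f0 a)) (r (f0 b))) :=
      smap_comp (fm psi a b) (smap_comp (fm (eE k.+1) a b) (gen k a b)).
    have mu_j a b n u : mu a b n (adj_incl (stage_seq k) a b n u) =
        fm G (f0 a) (f0 b) n (fm (sF (stage_seq k)) a b n u).
      by rewrite GP eE_gen.
    pose sg a b := smap_comp (fm (sF (stage_seq k)) a b) (adj_glue (stage_seq k) a b).
    pose G' : fmorph r (D k.+1) T := @ext_desc _ _ _ _ _ _ _ sg (adj_incl_inj (S := stage_seq k)) _ _ _ G mu mu_j.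
    have GP' x y n u : fm G' _ _ n (fm (sF (stage_seq k.+1)) x y n u) = fm psi x y n (fm (eE k.+1) x y n u).
      apply: (@ext_unique _ _ _ _ _ _ _ _ (adj_glue (stage_seq k)) (adj_incl_inj (S := stage_seq k)) _ T
        (fmorph_comp G' (sF (stage_seq k.+1))) (fmorph_comp psi (eE k.+1))) => {x y n u}.
      - move=> x y n u; apply: etrans (congr1 (fm G' _ _ n) (ext_map_in (sF (stage_seq k)) _ _ u)) _.
        apply: etrans (GP x y n u) _; congr (fm psi x y n _).
        by symmetry; exact: (fcolim_in_step tE_inj).
      - move=> a b n m; apply: etrans (congr1 (fm G' _ _ n) (ext_map_gen (sF (stage_seq k)) _ _ m)) _.
        exact: ext_desc_gen.
    by exists (exist _ G' GP').
  pose G0 : st 0 := exist _ psi0 h0.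
  pose G := fix G k : st k := if k is k'.+1 then proj1_sig (nx k' (G k')) else G0.
  have GS k x y n u : fm (proj1_sig (G k.+1)) x y n (fm (tD k) x y n u) = fm (proj1_sig (G k)) x y n u.
    exact: (proj2_sig (nx k (G k))).
  have [H HE] := @fcolim_desc _ _ _ tD_inj _ _ _ _ GS.
  exists H; split=> [x y n u|x y n u]; first exact: HE 0 x y n u.
  have [k [v <-]] := fcolim_cover u.
  by rewrite FE HE (proj2_sig (G k)).
Qed.
End Resolution.

(** * Adjoining objects *)

Section AddObjects.
Variables (O S : Type) (A : fcat O).

(** The added objects form a discrete category: a hom-object between two of them is their equality
    type, a point or empty. *)
Definition fsum_h (x y : O + S) : sset :=
  match x, y with
  | inl a, inl b => fh A a b
  | inr s, inr s' => disc (s = s')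
  | _, _ => svoid
  end.

Definition fsum_id (x : O + S) : fsum_h x x 0 :=
  match x with inl a => fid A a | inr s => erefl end.

Definition fsum_c (x y z : O + S) n : fsum_h y z n -> fsum_h x y n -> fsum_h x z n.
Proof.
case: x y z => [x|x] [y|y] [z|z] //=; first exact: fc.
by move=> e e'; exact: etrans e' e.
Defined.

Definition fsum : fcat (O + S).
Proof.
apply: (@FCat _ fsum_h fsum_id fsum_c).
- move=> [x|x] [y|y] [z|z] m n d //=; exact: fc_nat.
- move=> [x|x] [y|y] n //= f; exact: fc_idl.
- move=> [x|x] [y|y] n //= f; exact: fc_idr.
- move=> [x|x] [y|y] [z|z] [t|t] n //= h g f; exact: fcA.
Defined.
End AddObjects.

Definition fsum_inl (O S : Type) (A : fcat O) : fmorph (@inl O S) A (fsum S A) :=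
  @FMorph _ _ (@inl O S) A (fsum S A) (fun x y => smap_id _) (fun _ => erefl) (fun _ _ _ _ _ _ => erefl).

Definition fsum_ob (O O' S : Type) (q : O -> O') (x : O + S) : O' + S :=
  match x with inl a => inl (q a) | inr s => inr s end.

Definition fsum_map_hom (O O' S : Type) (q : O -> O') (A : fcat O) (A' : fcat O') (F : fmorph q A A')
    (x y : O + S) : smap (fsum_h A x y) (fsum_h A' (fsum_ob q x) (fsum_ob q y)) :=
  match x, y with
  | inl a, inl b => fm F a b
  | inl _, inr _ => smap_id svoid
  | inr _, inl _ => smap_id svoid
  | inr s, inr s' => smap_id (disc (s = s'))
  end.

Definition fsum_map (O O' S : Type) (q : O -> O') (A : fcat O) (A' : fcat O') (F : fmorph q A A') :
  fmorph (@fsum_ob O O' S q) (fsum S A) (fsum S A').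
Proof.
apply: (@FMorph _ _ (@fsum_ob O O' S q) (fsum S A) (fsum S A') (fsum_map_hom F)).
- by move=> [x|x] //=; rewrite fm_id.
- by move=> [x|x] [y|y] [z|z] n //= g f; rewrite fm_c.
Defined.

Lemma fsum_map_weq (O O' S : Type) (q : O -> O') (A : fcat O) (A' : fcat O') (F : fmorph q A A') :
  (forall x y, weq (fm F x y)) -> forall x y : O + S, weq (fm (fsum_map S F) x y).
Proof. by move=> wF [x|x] [y|y] //=; apply: weq_id. Qed.

Definition eq_map (O : Type) (T : fcat O) (x y : O) : smap (disc (x = y)) (fh T x y).
Proof.
apply: (@SMap (disc (x = y)) (fh T x y) (fun n e => match e in _ = z return fh T x z n with erefl => degen n (fid T x) end)).
by move=> m n d e /=; case: y / e; rewrite sact_degen.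
Defined.

Definition fsum_desc_ob (O S O2 : Type) (q : O -> O2) (r : S -> O2) (x : O + S) : O2 :=
  match x with inl a => q a | inr s => r s end.

Definition fsum_desc_hom (O S O2 : Type) (q : O -> O2) (r : S -> O2) (A : fcat O) (T : fcat O2)
    (F : fmorph q A T) (x y : O + S) : smap (fsum_h A x y) (fh T (fsum_desc_ob q r x) (fsum_desc_ob q r y)) :=
  match x, y with
  | inl a, inl b => fm F a b
  | inl _, inr _ => svoid_map _
  | inr _, inl _ => svoid_map _
  | inr s, inr s' => smap_comp (eq_map T (r s) (r s'))
      (@SMap (disc (s = s')) (disc (r s = r s')) (fun _ e => congr1 r e) (fun _ _ _ _ => erefl))
  end.

Definition fsum_desc (O S O2 : Type) (q : O -> O2) (r : S -> O2) (A : fcat O) (T : fcat O2) (F : fmorph q A T) :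
  fmorph (fsum_desc_ob q r) (fsum S A) T.
Proof.
apply: (@FMorph _ _ (fsum_desc_ob q r) (fsum S A) T (fsum_desc_hom r F)).
- by move=> [x|x] /=; [rewrite fm_id|rewrite degen0].
- move=> [x|x] [y|y] [z|z] n //= g f; first by rewrite fm_c.
  by case: z / g; case: y / f; rewrite /= fc_idl.
Defined.

(** Every object of [B] is some [q x], so the end of an isomorphism lifts strictly. The isomorphism
    and its inverse then lift on vertices, and being inverse is detected on components by
    injectivity. *)
Lemma local_trivial_fib (O : Type) (B : scat) (q : O -> B) (E : fcat O) (P : fmorph q E (fcat_of B)) :
  (forall x y, kan_fibration (fm P x y)) -> (forall x y, weq (fm P x y)) ->
  (forall x y (b : shom (q x) (q y) 0), exists u, fm P x y 0 u = b) ->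
  (forall x y (u v : fh E x y 0), connected (fm P x y 0 u) (fm P x y 0 v) -> connected u v) ->
  (forall b, exists x, q x = b) ->
  bergner_weq (sfunctor_out P) /\ bergner_fib (sfunctor_out P).
Proof.
move=> kP wP sP iP qs; split.
  apply/bergner_weqP; split=> // b; have [x <-] := qs b; exists x; exact: isomorphic_refl.
split=> // x y' g [h [hg gh]]; have [x' ex] := qs y'; subst y'.
have [u uE] := sP x x' (pi0_repr g); have [v vE] := sP x' x (pi0_repr h).
exists x', (pi0_class u); split.
  exists (pi0_class v); split.
    rewrite [LHS]pi0_scmpE; apply/pi0_classP/iP; rewrite /= fm_c fm_id uE vE.
    by apply/pi0_classP; apply: etrans (esym (pi0_scmpE _ _)) _; rewrite !pi0_reprK; exact: hg.
  rewrite [LHS]pi0_scmpE; apply/pi0_classP/iP; rewrite /= fm_c fm_id uE vE.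
  by apply/pi0_classP; apply: etrans (esym (pi0_scmpE _ _)) _; rewrite !pi0_reprK; exact: gh.
by rewrite /= pi0_mapE uE pi0_reprK.
Qed.

Lemma sfunctor_compA (A B C D : scat) (H : sfunctor C D) (G : sfunctor B C) (F : sfunctor A B) :
  sfunctor_comp H (sfunctor_comp G F) = sfunctor_comp (sfunctor_comp H G) F.
Proof. exact: (@cmpA SCAT). Qed.

Lemma sfunctor_comp_idl (A B : scat) (F : sfunctor A B) : sfunctor_comp (sfunctor_id B) F = F.
Proof. exact: (@cmp_idl SCAT). Qed.

Lemma sfunctor_comp_idr (A B : scat) (F : sfunctor A B) : sfunctor_comp F (sfunctor_id A) = F.
Proof. exact: (@cmp_idr SCAT). Qed.

(* A cofibration is a retract of a relative free extension [J], for which cobase change of [f] is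
   computed by words, and the pushout [f'] is a retract of the resulting map [Ff]. *)
Theorem bergner_left_proper : left_proper bergner_weq bergner_fib.
Proof.
move=> A B C D i f f' i' [cm univ] ci /bergner_weqP[wf of_].
(* The objects of [B] are added on the side of [A] to make the functor to [B] surjective on objects,
   and on the side of [C] to keep a pushout square. *)
pose F0 := fsum_map B (fmorph_of f).
pose P0 := fsum_desc (fun b : B => b) (fmorph_of i).
have wF0 x y : weq (fm F0 x y) by apply: fsum_map_weq.
have [E [D' [P [F [e [d [[Pe Fe wF] [kP wP sP iP] ext]]]]]]] := resolution (Stage P0 wF0).
rewrite /= in e d Pe Fe wF ext.
pose J : sfunctor A (scat_of E) := sfunctor_in (fmorph_comp e (fsum_inl B (fcat_of A))).
pose J' : sfunctor C (scat_of D') := sfunctor_in (fmorph_comp d (fsum_inl B (fcat_of C))).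
pose Pf : sfunctor (scat_of E) B := sfunctor_out P.
pose Ff : sfunctor (scat_of E) (scat_of D') := sfunctor_btw F.
have PJ : sfunctor_comp Pf J = i.
  apply: (@sfunctor_ext _ _ (sfunctor_comp Pf J) i (fun _ => erefl)) => x y n u.
  exact: (Pe (inl x) (inl y) n u).
have FJ : sfunctor_comp Ff J = sfunctor_comp J' f.
  apply: (@sfunctor_ext _ _ (sfunctor_comp Ff J) (sfunctor_comp J' f) (fun _ => erefl)) => x y n u.
  exact: (Fe (inl x) (inl y) n u).
have [wPf fPf] : bergner_weq Pf /\ bergner_fib Pf.
  by apply: local_trivial_fib => // b; exists (inr b).
have [w [wi Pw]] : exists w : sfunctor B (scat_of E),
    sfunctor_comp w i = J /\ sfunctor_comp Pf w = sfunctor_id B.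
  apply: (ci _ _ Pf wPf fPf J (sfunctor_id B)).
  by apply: etrans PJ _; symmetry; exact: (sfunctor_comp_idl i).
pose H := sfunctor_comp f' Pf; pose r : C + B -> D := fsum_desc_ob i' f'.
have [eob _] := sfunctor_extE cm.
(* On the objects of [A] the functor [H] is [f' i], which equals [i' f] only propositionally. Its
   object map is exchanged for one that factors through [C + B]. *)
have [|psi psiE] := @sfunctor_change_ob _ E D H (fun x => r (fsum_ob f x)).
  by case=> [a|b] //; exact: eob a.
pose psi0 : fmorph r (fsum B (fcat_of C)) (fcat_of D) := fsum_desc f' (fmorph_of i').
have HJ : sfunctor_comp (sfunctor_out psi) J = sfunctor_comp i' f.
  rewrite psiE; apply: etrans (esym (sfunctor_compA f' Pf J)) _.
  by rewrite PJ; exact: cm.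
have [|G [Gd GF]] := ext _ r (fcat_of D) psi psi0.
  move=> [x|x] [y|y] n u //=.
    exact: esym (sfunctor_eqE (o := fun a => i' (f a)) HJ u).
  (* Between added objects there are only identities, which both sides preserve. *)
  case: y / u => /=; symmetry.
  apply: etrans (congr1 (fm psi (inr x) (inr x) n) _) _.
    exact: etrans (degen_smap (fm e (inr x) (inr x)) n _) (congr1 _ (fm_id e (inr x))).
  exact: etrans (degen_smap (fm psi (inr x) (inr x)) n _) (congr1 _ (fm_id psi (inr x))).
pose r' : sfunctor (scat_of D') D := sfunctor_out G.
have rJ : sfunctor_comp r' J' = i'.
  apply: (@sfunctor_ext _ _ (sfunctor_comp r' J') i' (fun _ => erefl)) => x y n u.
  exact: (Gd (inl x) (inl y) n u).
have rF : sfunctor_comp r' Ff = H.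
  rewrite -psiE.
  apply: (@sfunctor_ext _ _ (sfunctor_comp r' Ff) (sfunctor_out psi) (fun _ => erefl)) => x y n u.
  exact: GF.
have wFf : bergner_weq Ff.
  apply/bergner_weqP; split=> [|[c|b]]; first exact: wF.
    have [a fa] := of_ c; exists (inl a); exact: (isomorphic_map (pi0_functor J') fa).
  by exists (inr b); exact: isomorphic_refl.
have sq : sfunctor_comp (sfunctor_comp Ff w) i = sfunctor_comp J' f.
  by rewrite -FJ -wi; symmetry; exact: (sfunctor_compA Ff w i).
(* The pushout property of [D] supplies the section [s'] of [r'] that completes the retract diagram
   given by [w] and [Pf]. *)
have [s' [[sf si] _]] := univ (scat_of D') (sfunctor_comp Ff w) J' sq.
have {}sf : sfunctor_comp s' f' = sfunctor_comp Ff w := sf.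
have {}si : sfunctor_comp s' i' = J' := si.
have [id' [_ idU]] := univ D f' i' cm.
apply: (@bergner_weq_retract _ _ _ _ f' Ff w Pf s' r'); [exact: Pw| |exact: sf|exact: esym rF|exact: wFf].
transitivity id'; [symmetry|]; apply: idU; split.
- apply: etrans (esym (sfunctor_compA r' s' f')) _.
  apply: etrans (congr1 (sfunctor_comp r') sf) _.
  apply: etrans (sfunctor_compA r' Ff w) _.
  apply: etrans (congr1 (fun K => sfunctor_comp K w) rF) _.
  apply: etrans (esym (sfunctor_compA f' Pf w)) _.
  exact: etrans (congr1 (sfunctor_comp f') Pw) (sfunctor_comp_idr _).
- by apply: etrans (esym (sfunctor_compA r' s' i')) _; rewrite si; exact: rJ.
- exact: sfunctor_comp_idl.
- exact: sfunctor_comp_idl.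
Qed.

Theorem corollary8p10 : proper bergner_weq bergner_fib.
Proof. by split; [exact: bergner_left_proper|exact: bergner_right_proper]. Qed.
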